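(* Let $W$ be an open set with $\mathcal T\subset W\subset\Omega$, and let $p_n:W\to\mathcal M^{-1}$ ($n\in\mathbb N$) be a sequence of holomorphic mappings with $\det p_n(x)=1$ for all $x\in W$, such that the sequence $\varphi_n(x):=p_n(x)\,x\,p_n(x)^{-1}$, $x\in W$, converges locally uniformly on $W$ to a holomorphic mapping $\psi:W\to\Omega$. Then there are a neighborhood $U$ of $\mathcal T$ (with $U\subset W$, independent of $n$) and holomorphic functions $a_n,b_n:U\to\mathbb C$ (identified with scalar multiples of the identity matrix) such that $\det\big(a_n(x)+x\,b_n(x)\big)=1$ for all $x\in U$ and all $n$, and the sequence $p_n(x)\big(a_n(x)+x\,b_n(x)\big)$ converges locally uniformly on $U$ to a holomorphic mapping $u:U\to\mathcal M^{-1}$.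
   Context: $\mathcal M$ denotes the algebra of $2\times2$ complex matrices and $\mathcal M^{-1}$ the group of invertible $2\times2$ complex matrices. $\Omega=\Omega_2$ is the spectral ball, i.e. the domain of all $x\in\mathcal M$ with spectral radius less than $1$. A matrix $M\in\mathcal M$ is cyclic if there is $v\in\mathbb C^2$ such that $v, Mv$ span $\mathbb C^2$. $\mathcal T$ is the set of non-cyclic matrices lying in $\Omega$. For scalars $a,b$ and a matrix $x$, $a+xb$ means $aI+bx$, with $I$ the identity matrix. *)

(* Defs.v *)
From HB Require Import structures.
From mathcomp Require Import all_boot all_order all_algebra complex.
From mathcomp Require Import all_classical all_reals all_analysis.
Set Implicit Arguments.
Unset Strict Implicit.
Unset Printing Implicit Defensive.
Import Order.TTheory GRing.Theory Num.Theory numFieldNormedType.Exports.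
Local Open Scope classical_set_scope.
Local Open Scope ring_scope.

(* The library equips only abstract field structures with their normed-module
   structure over themselves; R[i] is a concrete type, so it is copied from the
   regular module R[i]^o. Differentiability over R[i] is then complex
   differentiability, and matrices carry the maximum norm of their entries. *)
#[export, non_forgetful_inheritance]
HB.instance Definition _ (R : realType) := NormedModule.copy R[i] (R[i]^o).

(* The eigenvalues of x form a finite set, nonempty for m > 0, so this [sup] is
   the largest modulus of an eigenvalue. *)
Definition spectral_radius (R : realType) (m : nat) (x : 'M[R[i]]_m) : R :=
  sup [set ComplexField.Normc.normc a | a in [set a : R[i] | eigenvalue x a]].

Definition spectral_ball (R : realType) (m : nat) : set 'M[R[i]]_m :=
  [set x | spectral_radius x < 1].
Arguments spectral_ball : clear implicits.

Definition cyclic_mx (K : fieldType) (x : 'M[K]_2) : Prop :=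
  exists v : 'cV[K]_2, (<<[:: v; x *m v]>> = fullv)%VS.

Definition noncyclic_ball (R : realType) : set 'M[R[i]]_2 :=
  [set x | spectral_ball R 2 x /\ ~ cyclic_mx x].
Arguments noncyclic_ball : clear implicits.

Definition holomorphic_on (R : realType) (V W : normedModType R[i])
    (U : set V) (f : V -> W) : Prop :=
  forall x, U x -> differentiable f x.

Definition cvg_locally_uniformly (T : topologicalType) (V : uniformType)
    (U : set T) (f : nat -> T -> V) (g : T -> V) : Prop :=
  forall x, U x -> exists2 N, nbhs x N & {uniform N `&` U, f @ \oo --> g}.

(* Main.v *)
From HB Require Import structures.
Require Import Defs.
From mathcomp Require Import all_boot all_order all_algebra complex.
From mathcomp Require Import all_classical all_reals all_analysis.
From mathcomp Require Import ring lra.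
Import Order.TTheory GRing.Theory Num.Theory numFieldNormedType.Exports.
Local Open Scope classical_set_scope.
Local Open Scope ring_scope.
Set Implicit Arguments.
Unset Strict Implicit.
Unset Printing Implicit Defensive.

(** A matrix p with p x p^-1 prescribed is only determined up to right
multiplication by the commutant of x, which consists of the a + b x when x is
cyclic and jumps to all matrices when x is scalar.  So the p_n may well diverge
although the conjugates phi_n converge, and the scalar matrices, which are the
elements of T, are where the correcting factors a_n + x b_n have to be found.

At a scalar matrix c the derivative of phi_n is y |-> p_n(c) y p_n(c)^-1.
Derivatives of a locally uniformly convergent sequence of holomorphic maps
converge, and the entries of this conjugation are quadratic in p_n(c); together
with det p_n = 1 they give all products of two entries ([hc_products]).  Hence
p_n(c) converges up to a sign.  A sign is constant on balls, so it can be chosen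
near each c ([local_sign]), and since T is connected one sequence of signs
e_n serves the whole of T ([global_sign]).

Put P_n(x) = e_n p_n(tr x / 2).  This converges near T, and so does
C_n = P_n^-1 phi_n P_n, which equals r_n x r_n^-1 for a matrix r_n of determinant
one that is the identity on scalar matrices.  It remains to solve q x = C q with
q close to the identity, by operations on C that respect convergence: the r_n
themselves need not converge.  Write y and z for the traceless parts of x and C,
as vectors of C^3 with the quadratic form A^2 + B C, which is minus the
determinant; y and z have the same length.  Hadamard's lemma gives z = M y with M
the identity on T.  With N = (1 + M) / 2 the equality of lengths reads
(N y).(z - y) = 0, so w = N^T (z - y), taken with respect to the form, is
orthogonal to y.  The coordinates of y form a regular sequence, so by exactness of
the Koszul complex w is a vector product of y with some k ([koszul]), and then
det N + N k intertwines x and C ([intertwine_numeric]).  At scalar matrices it is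
the identity, so it can be divided by the square root of its determinant;
the result is [gauge C] ([gauge_intertwines], [hc_gauge]).

Finally Q_n = P_n gauge(C_n) converges and conjugates x into phi_n(x), so
p_n^-1 Q_n commutes with x and has determinant one; a family of matrices
commuting with x that is holomorphic near T has the form a + x b with a and b
holomorphic ([commutant]).  Thus p_n (a_n + x b_n) = Q_n.

The operations used are sums, products, inverses and square roots near one, and
division of f(x) - f(Z x) by a coordinate l, where Z projects onto the zero set of
l.  The property that is carried through them is [hcauchy]: differentiability on
one ball for all n, and uniform Cauchyness there.  The division is the only
delicate one.  It rests on the Cauchy estimates, which are derived here from
complex differentiability alone, without integrals: the contour integral over a
square is replaced by sums of values at midpoints after repeated trisection, for
which Goursat's subdivision argument goes through ([goursat]) and yields a weak
maximum principle ([centre_bound]); powers of the function turn it into a sharp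
one that tolerates isolated non-differentiable points ([power_bound]), and this,
applied to divided differences, bounds first and second order Taylor remainders
([lipschitz_bound], [taylor_bound]).  These bounds give Weierstrass' theorem and
the removable singularity in the division ([hdiv_in]). *)

(** * A real-valued norm and epsilon-delta calculus *)

Section RealNorm.
Variable R : realType.
Local Notation C := (R[i]).

(** The norm takes its values in R[i], where the order is partial; its real part
carries the same information in an ordered field. *)
Definition nm (V : normedModType C) (x : V) : R := complex.Re `|x|.

Section NormTheory.
Variable V : normedModType C.
Implicit Types x y : V.

Lemma nmE x : `|x| = (nm x)%:C%C.
Proof. by rewrite /nm RRe_real ?ger0_real. Qed.

Lemma nm_ge0 x : 0 <= nm x.
Proof. by rewrite -ler0c -nmE. Qed.

Lemma nmD x y : nm (x + y) <= nm x + nm y.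
Proof. by rewrite -lecR rmorphD /= -!nmE ler_normD. Qed.

Lemma nmN x : nm (- x) = nm x.
Proof. by rewrite /nm normrN. Qed.

Lemma nmBC x y : nm (x - y) = nm (y - x).
Proof. by rewrite -nmN opprB. Qed.

Lemma nmB x y : nm (x - y) <= nm x + nm y.
Proof. by rewrite -(nmN y) nmD. Qed.

Lemma nm_tri z x y : nm (x - y) <= nm (x - z) + nm (z - y).
Proof. by rewrite (_ : x - y = (x - z) + (z - y)) ?nmD// addrA subrK. Qed.

Lemma nm0 : nm (0 : V) = 0.
Proof. by rewrite /nm normr0. Qed.

Lemma nm_eq0 x : (nm x == 0) = (x == 0).
Proof. by rewrite -(normr_eq0 x) nmE (inj_eq (@complexI R)). Qed.

Lemma nm_gt0 x : (0 < nm x) = (x != 0).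
Proof. by rewrite lt_neqAle nm_ge0 andbT eq_sym nm_eq0. Qed.

Lemma nmZ (a : C) x : nm (a *: x) = nm a * nm x.
Proof. by apply: (@complexI R); rewrite rmorphM /= -!nmE normrZ. Qed.

Lemma ballnm x (r : R) : ball x r%:C%C = [set y | nm (x - y) < r].
Proof.
apply/funext => y; rewrite -ball_normE.
have -> : ball_ (fun z => `|z|) x r%:C%C y = (`|x - y| < r%:C%C) by [].
by rewrite nmE ltcR.
Qed.

Lemma nbhs_nm x (A : set V) : nbhs x A <->
  exists2 r : R, 0 < r & forall y, nm (x - y) < r -> A y.
Proof.
rewrite -nbhs_ballE; split => [[e /= e0 eA]|[r r0 rA]]; last first.
  by exists r%:C%C; rewrite /= ?ltcR //; move=> y; rewrite ballnm; apply: rA.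
have eE : e = (complex.Re e)%:C%C by rewrite RRe_real ?gtr0_real.
exists (complex.Re e); first by rewrite -ltcR -eE.
by move=> y xy; apply: eA; rewrite eE ballnm.
Qed.

End NormTheory.

Lemma nmM (a b : C) : nm (a * b) = nm a * nm b.
Proof. by apply: (@complexI R); rewrite rmorphM /= -!nmE normrM. Qed.

Lemma nm1 : nm (1 : C) = 1.
Proof. by rewrite /nm normr1. Qed.

Lemma nmV (a : C) : nm a^-1 = (nm a)^-1.
Proof. by apply: (@complexI R); rewrite fmorphV /= -!nmE normfV. Qed.

Lemma nmX (a : C) n : nm (a ^+ n) = nm a ^+ n.
Proof. by elim: n => [|n IH]; rewrite ?expr0 ?nm1// !exprS nmM IH. Qed.

Lemma nmR (x : R) : nm (x%:C%C : C) = `|x|.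
Proof. by rewrite /nm normc_def /= expr0n addr0 sqrtr_sqr. Qed.

Lemma nmi : nm ('i%C : C) = 1.
Proof. by rewrite /nm normc_def /= expr0n add0r expr1n sqrtr1. Qed.

Lemma Re_nm (a : C) : `|complex.Re a| <= nm a.
Proof.
by rewrite /nm normc_def /= -sqrtr_sqr ler_wsqrtr// lerDl sqr_ge0.
Qed.

Lemma Im_nm (a : C) : `|complex.Im a| <= nm a.
Proof.
by rewrite /nm normc_def /= -sqrtr_sqr ler_wsqrtr// lerDr sqr_ge0.
Qed.

Lemma nm_ReIm (a : C) : nm a <= `|complex.Re a| + `|complex.Im a|.
Proof.
rewrite {1}(complexE a) (le_trans (nmD _ _))// nmM nmi mul1r !nmR.
exact: lexx.
Qed.

Section EpsDelta.
Variables (V W : normedModType C).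
Implicit Types (f : V -> W) (x : V).

Lemma cvg_nm (T : Type) (F : set_system T) {FF : Filter F} (u : T -> W) (l : W) :
  u @ F --> l <-> forall e : R, 0 < e -> \forall t \near F, nm (l - u t) < e.
Proof.
split => [ul e e0|H].
  by have /= := ul _ (proj2 (nbhs_nm _ _) (ex_intro2 _ _ e e0 (fun y h => h))).
by move=> A /nbhs_nm[e e0 eA]; apply: filterS (H e e0) => t /eA.
Qed.

Lemma continuous_nm f x : {for x, continuous f} <-> forall e : R, 0 < e ->
  exists2 d : R, 0 < d & forall y, nm (x - y) < d -> nm (f x - f y) < e.
Proof.
split => [/cvg_nm H e /H/nbhs_nm//|H].
by apply/cvg_nm => e /H ?; apply/nbhs_nm.
Qed.

Lemma differentiable_nm f x : differentiable f x -> forall e : R, 0 < e ->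
  exists2 d : R, 0 < d & forall h, nm h < d ->
    nm (f (x + h) - f x - 'd f x h) <= e * nm h.
Proof.
move=> /diff_locallyxC fx e e0.
have [rem remE fE] : exists2 rem : V -> W, rem =o_ (0 : V) id &
    forall h, f (x + h) = f x + 'd f x h + rem h.
  by eexists; last exact: fx.
have /eqoP/(_ e%:C%C) := remE; rewrite ltcR => /(_ e0)/nbhs_nm[d d0 H].
exists d => // h hd; rewrite fE -addrA -opprD addrC addKr.
by move: (H h); rewrite sub0r nmN => /(_ hd); rewrite !nmE -rmorphM lecR.
Qed.

(** The quantifier form of the converse of [differentiable_nm]; it also identifies
the differential. *)
Lemma differentiable_from f x (L : {linear V -> W}) : continuous L ->
  (forall e : R, 0 < e -> exists2 d : R, 0 < d & forall h, nm h < d ->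
    nm (f (x + h) - f x - L h) <= e * nm h) ->
  differentiable f x /\ 'd f x = L :> (V -> W).
Proof.
move=> Lc H.
have E : f \o shift x = cst (f x) + L +o_ 0 id.
  apply/eqaddoP => e e0.
  have eE : e = (complex.Re e)%:C%C by rewrite RRe_real ?gtr0_real.
  have := H (complex.Re e); rewrite -ltcR -eE => /(_ e0)[d d0 {}H].
  apply/nbhs_nm; exists d => // h; rewrite sub0r nmN => /H hH.
  rewrite eE !nmE -rmorphM lecR /=; apply: le_trans hH.
  by rewrite [x + h]addrC opprD addrA.
have dE := diff_unique Lc E; split=> //.
by apply/diff_locallyP; rewrite dE.
Qed.

End EpsDelta.
End RealNorm.

(** * Nested squares *)

Section Cousin.
Variable R : realType.
Implicit Types (P : R -> R -> R -> Prop) (x y l : R).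

Lemma ternary_small (l d : R) : 0 < l -> 0 < d -> exists n, l / 3 ^+ n < d.
Proof.
move=> l0 d0; have /cvgrPdist_lt/(_ (d / l)) : (3^-1 : R) ^+ n @[n --> \oo] --> (0 : R).
  apply: cvg_expr; rewrite ger0_norm ?invr_ge0//.
  by rewrite invf_lt1// (ltr_nat _ 1 3).
rewrite divr_gt0// => /(_ isT)[N _ /(_ N (leqnn _))].
rewrite /= sub0r normrN ger0_norm ?exprn_ge0 ?invr_ge0// => H.
by exists N; rewrite -ltr_pdivlMl// mulrC -exprVn.
Qed.

(** The triadic intervals are nested, so the supremum of their left ends lies in all
of them. *)
Lemma ternary_nest (u : nat -> R) (d : nat -> nat) (l : R) : 0 <= l ->
  (forall n, (d n <= 2)%N) ->
  (forall n, u n.+1 = u n + (d n)%:R * (l / 3 ^+ n.+1)) ->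
  exists c, forall n, u n <= c <= u n + l / 3 ^+ n.
Proof.
move=> l0 d2 uS.
have p3 n : 0 <= l / 3 ^+ n :> R by rewrite divr_ge0// exprn_ge0.
have i3 n : l / 3 ^+ n = 3 * (l / 3 ^+ n.+1) :> R.
  by rewrite exprS; field; rewrite expf_neq0 ?pnatr_eq0.
have ui n : u n <= u n.+1 by rewrite uS lerDl mulr_ge0.
have ud n : u n.+1 + l / 3 ^+ n.+1 <= u n + l / 3 ^+ n.
  rewrite uS (i3 n); have : (d n)%:R <= 2 :> R by rewrite (ler_nat _ _ 2).
  have := p3 n.+1; nra.
have un : {homo u : m n / (m <= n)%N >-> m <= n} by exact/nondecreasing_seqP.
have udn k n : u (n + k)%N + l / 3 ^+ (n + k) <= u n + l / 3 ^+ n.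
  elim: k => [|k IH]; rewrite ?addn0// addnS.
  exact: le_trans (ud _) IH.
have bnd n m : u m <= u n + l / 3 ^+ n.
  case: (leqP m n) => [mn|/ltnW nm].
    by rewrite (le_trans (un _ _ mn))// lerDl.
  by have := udn (m - n)%N n; rewrite subnKC//; have := p3 m; lra.
exists (sup (range u)) => n.
apply/andP; split.
  apply: ub_le_sup; last by exists n.
  by exists (u 0%N + l / 3 ^+ 0) => _ [m _ <-].
by apply: ge_sup; [exists (u 0%N), 0%N|move=> _ [m _ <-]].
Qed.

(** Cousin's lemma for trisection: if P failed on the square, it would fail on a
shrinking nest of subsquares, whose common point contradicts the local
hypothesis. *)
Lemma cousin_square P (x0 y0 l0 : R) : 0 < l0 ->
  (forall x y l, 0 < l ->
    (forall i j : nat, (i <= 2)%N -> (j <= 2)%N ->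
       P (x + i%:R * (l / 3)) (y + j%:R * (l / 3)) (l / 3)) -> P x y l) ->
  (forall c1 c2, x0 <= c1 <= x0 + l0 -> y0 <= c2 <= y0 + l0 ->
    exists2 d : R, 0 < d & forall x y l, 0 < l < d ->
      x <= c1 <= x + l -> y <= c2 <= y + l -> P x y l) ->
  P x0 y0 l0.
Proof.
move=> l0_gt0 Psub Ploc; apply: contrapT => nP.
pose S := (nat * nat * (R * R))%type.
pose bad n (s : S) := ~ P s.2.1 s.2.2 (l0 / 3 ^+ n).
(* the integers record which of the nine subsquares t is *)
pose child n (s t : S) := [/\ (t.1.1 <= 2)%N, (t.1.2 <= 2)%N,
  t.2.1 = s.2.1 + t.1.1%:R * (l0 / 3 ^+ n.+1) &
  t.2.2 = s.2.2 + t.1.2%:R * (l0 / 3 ^+ n.+1)].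
pose T := {ns : nat * S | bad ns.1 ns.2}.
have p3 n : 0 < l0 / 3 ^+ n :> R by rewrite divr_gt0// exprn_gt0.
have i3 n : l0 / 3 ^+ n / 3 = l0 / 3 ^+ n.+1 :> R.
  by rewrite exprS; field; rewrite expf_neq0 ?pnatr_eq0.
have next (s : T) : {t : T | (sval t).1 = (sval s).1.+1 /\
    child (sval s).1 (sval s).2 (sval t).2}.
  apply: cid; case: s => [[n s] /= bs].
  have [i [j [i2 j2 Pij]]] : exists i j : nat, [/\ (i <= 2)%N, (j <= 2)%N &
      ~ P (s.2.1 + i%:R * (l0 / 3 ^+ n.+1)) (s.2.2 + j%:R * (l0 / 3 ^+ n.+1))
          (l0 / 3 ^+ n.+1)].
    apply: contrapT => H; apply: bs; apply: Psub => //= i j i2 j2.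
    by rewrite i3; apply: contrapT => Pij; apply: H; exists i, j.
  by exists (exist _ (n.+1, (i, j, (s.2.1 + i%:R * (l0 / 3 ^+ n.+1),
     s.2.2 + j%:R * (l0 / 3 ^+ n.+1)))) Pij); split.
have b0 : bad 0%N (0%N, 0%N, (x0, y0)) by rewrite /bad /= divr1.
have [f [f0 fS]] := dependent_choice next (exist _ (0%N, (0%N, 0%N, (x0, y0))) b0).
have fn n : (sval (f n)).1 = n.
  by elim: n => [|n IH]; [rewrite f0|rewrite (proj1 (fS n)) IH].
pose g n := (sval (f n)).2.
have gS n : child n (g n) (g n.+1) by have := proj2 (fS n); rewrite fn.
have gbad n : bad n (g n) by have := svalP (f n); rewrite fn.
have [||c1 c1P] := @ternary_nest (fun n => (g n).2.1) (fun n => (g n.+1).1.1) l0 (ltW l0_gt0).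
- by move=> n; case: (gS n).
- by move=> n; case: (gS n).
have [||c2 c2P] := @ternary_nest (fun n => (g n).2.2) (fun n => (g n.+1).1.2) l0 (ltW l0_gt0).
- by move=> n; case: (gS n).
- by move=> n; case: (gS n).
have [||d d0 dP] := Ploc c1 c2.
- by have := c1P 0%N; rewrite /g f0 /= divr1.
- by have := c2P 0%N; rewrite /g f0 /= divr1.
have [n nd] := ternary_small l0_gt0 d0.
by apply: (gbad n); apply: dP => //; rewrite p3.
Qed.

End Cousin.

(** * Goursat's theorem for midpoint sums *)

Section Goursat.
Variable R : realType.
Local Notation C := (R[i]).
Local Notation i := ('i%C : C).
Implicit Types (f g : C -> C) (a s t z c : C).

(** The midpoint rule for the mean of f on the segment from a to a + d cut into
3^n equal parts.  The recursion makes additivity under trisection an identity; three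
parts, rather than two, leave a central square around the point studied in
[centre_bound]. *)
Fixpoint avg f n a d : C :=
  if n is m.+1 then
    (avg f m a (d / 3) + avg f m (a + d / 3) (d / 3)
     + avg f m (a + d / 3 + d / 3) (d / 3)) / 3
  else f (a + d / 2).

(** The midpoint rule for the integral of f along the boundary of the square with
corner a and side s. *)
Definition bdy f n a s : C :=
  s * (avg f n a s + i * avg f n (a + s) (i * s)
       - avg f n (a + i * s) s - i * avg f n a (i * s)).

Lemma avg_in f (P : C -> Prop) n a d :
  (forall u v w, P u -> P v -> P w -> P ((u + v + w) / 3)) ->
  (forall t : R, 0 <= t <= 1 -> P (f (a + t%:C%C * d))) -> P (avg f n a d).
Proof.
move=> Pc; elim: n a d => [|n IH] a d Pf /=.
  have -> : d / 2 = (2^-1 : R)%:C%C * d by rewrite fmorphV rmorphMn/= mulrC.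
  by apply: Pf; lra.
have sub (k : R) : 0 <= k <= 2 -> P (avg f n (a + k%:C%C * (d / 3)) (d / 3)).
  move=> k2; apply: IH => t t1.
  have -> : a + k%:C%C * (d / 3) + t%:C%C * (d / 3) = a + ((k + t) / 3)%:C%C * d.
    by rewrite fmorph_div rmorphMn /= rmorphD /=; field.
  by apply: Pf; apply/andP; split; lra.
apply: Pc.
- by have := sub 0; rewrite mul0r addr0; apply; lra.
- by have := sub 1; rewrite mul1r; apply; lra.
- by have := sub 2; rewrite rmorphMn /= mulrDl mul1r addrA; apply; lra.
Qed.

Lemma avgB f g n a d :
  avg (fun z => f z - g z) n a d = avg f n a d - avg g n a d.
Proof. by elim: n a d => [|n IH] a d //=; rewrite !IH; field. Qed.

Lemma avgZ f k n a d : avg (fun z => k * f z) n a d = k * avg f n a d.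
Proof. by elim: n a d => [|n IH] a d //=; rewrite !IH; field. Qed.

Lemma avg_affine k l n a d : avg (fun z => k + l * z) n a d = k + l * (a + d / 2).
Proof. by elim: n a d => [|n IH] a d //=; rewrite !IH; field. Qed.

Lemma bdyB f g n a s : bdy (fun z => f z - g z) n a s = bdy f n a s - bdy g n a s.
Proof. by rewrite /bdy !avgB; ring. Qed.

Lemma bdyZ f k n a s : bdy (fun z => k * f z) n a s = k * bdy f n a s.
Proof. by rewrite /bdy !avgZ; ring. Qed.

(** The midpoint rule is exact on affine functions, whose boundary integrals
vanish. *)
Lemma bdy_affine k l n a s : bdy (fun z => k + l * z) n a s = 0.
Proof.
rewrite /bdy !avg_affine.
by field.
Qed.

(** The contributions of the inner edges of the nine subsquares cancel in pairs. *)
Lemma bdyS f n a t : bdy f n.+1 a (3 * t) =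
  \sum_(j < 3) \sum_(k < 3) bdy f n (a + j%:R * t + k%:R * (i * t)) t.
Proof.
pose H j k := avg f n (a + j%:R * t + k%:R * (i * t)) t.
pose V j k := avg f n (a + j%:R * t + k%:R * (i * t)) (i * t).
have bH j k : bdy f n (a + j%:R * t + k%:R * (i * t)) t =
    t * (H j k + i * V j.+1 k - H j k.+1 - i * V j k).
  rewrite /bdy /H /V -!(addn1 j) -!(addn1 k) !natrD.
  congr (_ * (_ + _ * _ - _ - _)); congr (avg _ _ _ _); ring.
have Hk k : avg f n.+1 (a + k%:R * (i * t)) (3 * t) =
    (H 0%N k + H 1%N k + H 2%N k) / 3.
  rewrite /= (_ : 3 * t / 3 = t); last by field.
  by congr ((_ + _ + _) / _); congr (avg _ _ _ _); ring.
have Vj j : avg f n.+1 (a + j%:R * t) (i * (3 * t)) =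
    (V j 0%N + V j 1%N + V j 2%N) / 3.
  rewrite /= (_ : i * (3 * t) / 3 = i * t); last by field.
  by congr ((_ + _ + _) / _); congr (avg _ _ _ _); ring.
have := Hk 0%N; have := Hk 3%N; have := Vj 0%N; have := Vj 3%N.
rewrite !mul0r !addr0 => V3 V0 H3 H0.
rewrite {1}/bdy V3 V0 H0 (_ : i * (3 * t) = 3 * (i * t)) ?H3; last by ring.
rewrite !big_ord_recl !big_ord0 /= !bH.
by field.
Qed.

End Goursat.

Section Goursat2.
Variable R : realType.
Local Notation C := (R[i]).
Local Notation i := ('i%C : C).
Implicit Types (f g : C -> C) (a s t z c : C).

Lemma mkC (x y : R) : (x +i* y)%C = x%:C%C + i * y%:C%C.
Proof. exact: complexE. Qed.

Lemma mul01_le (u l : R) : 0 <= u <= 1 -> 0 <= l -> 0 <= u * l <= l.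
Proof. by move=> /andP[u0 u1] l0; rewrite mulr_ge0// ler_piMl. Qed.

Lemma nm_nat n : nm (n%:R : C) = n%:R.
Proof. by rewrite -(rmorph_nat (real_complex R)) nmR normr_nat. Qed.

Lemma avg_le f n a d (K : R) :
  (forall t : R, 0 <= t <= 1 -> nm (f (a + t%:C%C * d)) <= K) ->
  nm (avg f n a d) <= K.
Proof.
apply: (@avg_in _ f (fun z => nm z <= K)) => u v w uK vK wK.
rewrite nmM nmV nm_nat.
have := nmD (u + v) w; have := nmD u v; lra.
Qed.

Lemma bdy_le f n a s (K : R) :
  (forall u v : R, 0 <= u <= 1 -> 0 <= v <= 1 ->
    [|| u == 0, u == 1, v == 0 | v == 1] ->
    nm (f (a + (u%:C%C + i * v%:C%C) * s)) <= K) ->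
  nm (bdy f n a s) <= 4 * nm s * K.
Proof.
move=> fK.
have i01 : 0 <= (0 : R) <= 1 by rewrite lexx ler01.
have i11 : 0 <= (1 : R) <= 1 by rewrite lexx ler01.
have b1 : nm (avg f n a s) <= K.
  apply: avg_le => t t1; have := fK t 0 t1 i01.
  by rewrite eqxx !orbT rmorph0 mulr0 addr0; apply.
have b2 : nm (avg f n (a + s) (i * s)) <= K.
  apply: avg_le => t t1; have := fK 1 t i11 t1.
  rewrite eqxx !orbT rmorph1; set x := _ + _; set y := _ + _.
  by rewrite (_ : x = y); [apply|rewrite /x /y; ring].
have b3 : nm (avg f n (a + i * s) s) <= K.
  apply: avg_le => t t1; have := fK t 1 t1 i11.
  rewrite eqxx !orbT rmorph1; set x := _ + _; set y := _ + _.
  by rewrite (_ : x = y); [apply|rewrite /x /y; ring].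
have b4 : nm (avg f n a (i * s)) <= K.
  apply: avg_le => t t1; have := fK 0 t i01 t1.
  rewrite eqxx rmorph0; set x := _ + _; set y := _ + _.
  by rewrite (_ : x = y); [apply|rewrite /x /y; ring].
rewrite /bdy nmM (_ : 4 * nm s * K = nm s * (4 * K)); last by ring.
rewrite ler_wpM2l ?nm_ge0//.
apply: le_trans (nmB _ _) _; rewrite nmM nmi mul1r.
have := nmB (avg f n a s + i * avg f n (a + s) (i * s)) (avg f n (a + i * s) s).
have := nmD (avg f n a s) (i * avg f n (a + s) (i * s)).
rewrite nmM nmi mul1r; lra.
Qed.

Lemma nm_sum (I : Type) (r : seq I) (F : I -> C) :
  nm (\sum_(k <- r) F k) <= \sum_(k <- r) nm (F k).
Proof.
elim/big_ind2 : _ => [|x1 x2 y1 y2 h1 h2|//]; first by rewrite nm0.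
by rewrite (le_trans (nmD _ _))// lerD.
Qed.

Lemma diff_mul1 f z h : 'd f z h = h * 'd f z 1.
Proof. by rewrite -[h in LHS]mulr1 -[h * 1]/(h *: (1 : C)) linearZ. Qed.

(** On a small square around c, f is affine up to an error that is small compared to
the side, so the boundary sum is small compared to the area for every n; areas
and boundary sums are both additive under trisection. *)
Lemma goursat f (x0 y0 l0 : R) : 0 < l0 ->
  (forall z, x0 <= complex.Re z <= x0 + l0 -> y0 <= complex.Im z <= y0 + l0 ->
     differentiable f z) ->
  forall e : R, 0 < e ->
    \forall n \near \oo, nm (bdy f n (x0 +i* y0)%C l0%:C%C) <= e * l0 ^+ 2.
Proof.
move=> l0_gt0 df e e0.
pose P x y l := \forall n \near \oo,
  nm (bdy f n (x +i* y)%C (l : R)%:C%C) <= e * l ^+ 2.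
apply: (@cousin_square _ P) => //.
- move=> x y l l_gt0 Psub.
  have /filter_forall[N _ HN] : forall jk : 'I_3 * 'I_3, \forall n \near \oo,
      nm (bdy f n ((x + jk.1%:R * (l / 3)) +i* (y + jk.2%:R * (l / 3)))%C
        (l / 3)%:C%C) <= e * (l / 3) ^+ 2.
    by move=> [j k]; apply: Psub; rewrite -ltnS ltn_ord.
  exists N.+1 => // -[//|n] /= Nn.
  have -> : l%:C%C = 3 * (l / 3)%:C%C :> C.
    by rewrite fmorph_div rmorphMn /=; field.
  rewrite bdyS; apply: le_trans (nm_sum _ _) _.
  have -> : e * l ^+ 2 = \sum_(j < 3) \sum_(k < 3) (e * (l / 3) ^+ 2).
    by rewrite !sumr_const !card_ord; field.
  apply: ler_sum => j _; apply: le_trans (nm_sum _ _) _.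
  apply: ler_sum => k _; apply: le_trans (HN n Nn (j, k)).
  rewrite le_eqVlt; apply/orP; left; apply/eqP; congr (nm (bdy _ _ _ _)).
  rewrite (mkC x y) (mkC (_ + _) _) !rmorphD !rmorphM !rmorph_nat /=; ring.
- move=> c1 c2 c1P c2P.
  have e8 : 0 < e / 8 by rewrite divr_gt0.
  have [d d0 dP] := differentiable_nm (df (c1 +i* c2)%C c1P c2P) e8.
  exists (d / 2); first by rewrite divr_gt0.
  move=> x y l /andP[l_gt0 ld] xc yc; apply: nearW => n.
  set c := (c1 +i* c2)%C in dP *; set k := 'd f c 1.
  have := bdyB f (fun z => (f c - k * c) + k * z) n (x +i* y)%C l%:C%C.
  rewrite bdy_affine subr0 => <-.
  apply: (@le_trans _ _ (4 * nm (l%:C%C : C) * (e / 8 * (2 * l)))); last first.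
    by rewrite nmR gtr0_norm// le_eqVlt; apply/orP; left; apply/eqP; field.
  apply: bdy_le => u v u1 v1 _.
  set z := (x +i* y)%C + _; have zc : nm (z - c) <= 2 * l.
    have -> : z - c = ((x + u * l - c1) +i* (y + v * l - c2))%C.
      rewrite /z /c (mkC x y) (mkC c1) (mkC (_ - _)) !rmorphB !rmorphD !rmorphM /=; ring.
    apply: le_trans (nm_ReIm _) _ => /=.
    rewrite (_ : 2 * l = l + l); last by ring.
    have ul : 0 <= u * l <= l by apply: mul01_le; rewrite // ltW.
    have vl : 0 <= v * l <= l by apply: mul01_le; rewrite // ltW.
    by apply: lerD; rewrite ler_norml; lra.
  have := dP (z - c); rewrite (_ : c + (z - c) = z); last by ring.
  rewrite diff_mul1 -/k => H.
  have -> : f z - (f c - k * c + k * z) = f z - f c - (z - c) * k by ring.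
  by rewrite (le_trans (H _))//; [lra|rewrite ler_wpM2l// ltW].
Qed.

End Goursat2.

(** * A weak maximum principle *)

Section CentreBound.
Variable R : realType.
Local Notation C := (R[i]).
Local Notation i := ('i%C : C).
Implicit Types (f g h : C -> C) (a t z c : C) (s l : R).

Definition corner c l : C := c - (1 + i) * (l / 2)%:C%C.

Lemma Im_realM (x : R) z : complex.Im (x%:C%C * z) = x * complex.Im z.
Proof. by case: z => a b /=; rewrite mul0r addr0. Qed.

Lemma Im_inv_ge1 (p : R) : - 2^-1 <= p <= 2^-1 ->
  1 <= complex.Im ((p -i* 2^-1)%C^-1 : C).
Proof.
move=> p2; rewrite /= mulNr opprK.
have q0 : 0 < p ^+ 2 + (- 2^-1) ^+ 2 by rewrite sqrrN ltr_wpDl ?sqr_ge0// exprn_gt0 ?invr_gt0.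
by rewrite ler_pdivlMr // mul1r; nra.
Qed.

Lemma avg_inv_ge1 n a d c t : t != 0 ->
  (forall x : R, 0 <= x <= 1 -> exists2 p : R, - 2^-1 <= p <= 2^-1 &
     a + x%:C%C * d - c = t * (p -i* 2^-1)%C) ->
  1 <= complex.Im (t * avg (fun z => (z - c)^-1) n a d).
Proof.
move=> t0 H; apply: (@avg_in _ _ (fun w => 1 <= complex.Im (t * w))).
  move=> u v w uP vP wP.
  have -> : t * ((u + v + w) / 3) = (3^-1 : R)%:C%C * (t * u + t * v + t * w).
    by rewrite fmorphV rmorph_nat /=; field.
  rewrite Im_realM !raddfD /=; lra.
move=> x /H[p p2 ->]; rewrite invfM mulrA mulfV// mul1r.
exact: Im_inv_ge1.
Qed.

(** The exact integral is 2 pi i.  All that is needed is that the sums stay away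
from zero: on each edge the imaginary part of the normalized integrand is at
least one. *)
Lemma bdy_inv_ge4 n c s : 0 < s ->
  4 <= nm (bdy (fun z => (z - c)^-1) n (corner c s) s%:C%C).
Proof.
move=> s0; apply: le_trans (Im_nm _); apply: le_trans (ler_norm _).
have sn0 : s%:C%C != 0 :> C by rewrite (inj_eq (@complexI R) s 0) gt_eqF.
have ii : i * i = -1 by rewrite -expr2 sqr_i.
have in0 : i != 0 by rewrite -nm_eq0 nmi oner_neq0.
have mkC' (p : R) : (p -i* 2^-1)%C = p%:C%C - i / 2 :> C.
  by rewrite (mkC p) rmorphN fmorphV rmorph_nat mulrN.
have s2 : (s / 2)%:C%C = s%:C%C / 2 :> C by rewrite fmorph_div rmorph_nat.
set f := fun z => _; rewrite /bdy.
set A1 := avg _ _ _ _; set A2 := avg _ _ _ _; set A3 := avg _ _ _ _.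
set A4 := avg _ _ _ _.
have -> : s%:C%C * (A1 + i * A2 - A3 - i * A4) =
  s%:C%C * A1 + (s%:C%C * i) * A2 + (- s%:C%C) * A3 + (- (s%:C%C * i)) * A4 by ring.
rewrite !raddfD /=.
have h1 : 1 <= complex.Im (s%:C%C * A1).
  apply: avg_inv_ge1 => [//|x x1]; exists (x - 2^-1); first by lra.
  by rewrite mkC' rmorphB fmorphV rmorph_nat /corner s2; field.
have h2 : 1 <= complex.Im (s%:C%C * i * A2).
  apply: avg_inv_ge1 => [|x x1]; first by rewrite mulf_neq0.
  exists (x - 2^-1); first by lra.
  rewrite mkC' rmorphB fmorphV rmorph_nat /corner s2.
  transitivity (s%:C%C * (i * (x%:C%C - 1 / 2) - (-1) / 2)); first by field.
  by rewrite -ii; field.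
have h3 : 1 <= complex.Im (- s%:C%C * A3).
  apply: avg_inv_ge1 => [|x x1]; first by rewrite oppr_eq0.
  exists (2^-1 - x); first by lra.
  by rewrite mkC' rmorphB fmorphV rmorph_nat /corner s2; field.
have h4 : 1 <= complex.Im (- (s%:C%C * i) * A4).
  apply: avg_inv_ge1 => [|x x1]; first by rewrite oppr_eq0 mulf_neq0.
  exists (2^-1 - x); first by lra.
  rewrite mkC' rmorphB fmorphV rmorph_nat /corner s2.
  transitivity (s%:C%C * (i * (x%:C%C - 1 / 2) + (-1) / 2)); first by field.
  by rewrite -ii; field.
lra.
Qed.

Lemma corner_edge c l (u v : R) : 0 <= l -> 0 <= u <= 1 -> 0 <= v <= 1 ->
  let z := corner c l + (u%:C%C + i * v%:C%C) * l%:C%C in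
  nm (z - c) <= l /\ ([|| u == 0, u == 1, v == 0 | v == 1] -> l / 2 <= nm (z - c)).
Proof.
move=> l0 u1 v1 z.
have -> : z - c = (((u - 2^-1) * l) +i* ((v - 2^-1) * l))%C.
  by rewrite /z /corner (mkC (_ * _)) !rmorphM !rmorphB !fmorphV rmorph_nat /=; field.
split.
  apply: le_trans (nm_ReIm _) _ => /=.
  rewrite (_ : l = l / 2 + l / 2); last by field.
  have ul : 0 <= u * l <= l by exact: mul01_le.
  have vl : 0 <= v * l <= l by exact: mul01_le.
  by apply: lerD; rewrite ler_norml; lra.
set w := (_ +i* _)%C; move=> /or4P[] /eqP E.
- by apply: le_trans (Re_nm _); rewrite /= E ler_normr; apply/orP; right; lra.
- by apply: le_trans (Re_nm _); rewrite /= E ler_normr; apply/orP; left; lra.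
- by apply: le_trans (Im_nm _); rewrite /= E ler_normr; apply/orP; right; lra.
- by apply: le_trans (Im_nm _); rewrite /= E ler_normr; apply/orP; left; lra.
Qed.

(** Of the nine subsquares only the central one contains c, so the other eight
contribute arbitrarily little. *)
Lemma goursat_ring f c l : 0 < l ->
  (forall z, nm (z - c) <= l -> z != c -> differentiable f z) ->
  forall e : R, 0 < e -> \forall n \near \oo,
    nm (bdy f n.+1 (corner c l) l%:C%C) <=
      e + nm (bdy f n (corner c (l / 3)) (l / 3)%:C%C).
Proof.
move=> l0 df e e0; case: c df => x y df.
have x2E (j k : nat) : corner (x +i* y)%C l + j%:R * (l / 3)%:C%C +
    k%:R * (i * (l / 3)%:C%C) =
    ((x - l / 2 + j%:R * (l / 3)) +i* (y - l / 2 + k%:R * (l / 3)))%C.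
  rewrite /corner (mkC x y) (mkC (_ + _)) !rmorphD !rmorphN !rmorphM !rmorph_nat /=; ring.
have /filter_forall[N _ HN] : forall jk : 'I_3 * 'I_3, \forall n \near \oo,
    jk != (1, 1) -> nm (bdy f n (corner (x +i* y)%C l + jk.1%:R * (l / 3)%:C%C +
      jk.2%:R * (i * (l / 3)%:C%C)) (l / 3)%:C%C) <= e / 9.
  move=> [j k]; have [E|jk] := eqVneq (j, k) (1, 1).
    by apply: nearW => n /eqP; rewrite E.
  rewrite x2E /=.
  have e9 : 0 < e / 9 / (l / 3) ^+ 2.
    by rewrite divr_gt0 ?exprn_gt0 ?divr_gt0.
  have l30 : 0 < l / 3 by rewrite divr_gt0.
  suff dsub z : x - l / 2 + j%:R * (l / 3) <= complex.Re z <=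
        x - l / 2 + j%:R * (l / 3) + l / 3 ->
      y - l / 2 + k%:R * (l / 3) <= complex.Im z <=
        y - l / 2 + k%:R * (l / 3) + l / 3 -> differentiable f z.
    have := goursat l30 dsub e9; rewrite divfK ?gt_eqF ?exprn_gt0//.
    by apply: filterS => n Hn _.
  move=> zj zk.
  have jle : (j%:R <= 2 :> R) by rewrite (ler_nat _ _ 2) -ltnS ltn_ord.
  have kle : (k%:R <= 2 :> R) by rewrite (ler_nat _ _ 2) -ltnS ltn_ord.
  have j0 : 0 <= j%:R :> R by rewrite ler0n.
  have k0 : 0 <= k%:R :> R by rewrite ler0n.
  apply: df.
    case: z zj zk => a b /= zj zk.
    rewrite (_ : _ - _ = ((a - x) +i* (b - y))%C); last first.
      rewrite (mkC a b) (mkC x y) (mkC (_ - _)) !rmorphB /=; ring.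
    apply: le_trans (nm_ReIm _) _ => /=.
    rewrite (_ : l = l / 2 + l / 2); last by field.
    have jl : 0 <= j%:R * (l / 3) <= 2 * (l / 3) by nra.
    have kl : 0 <= k%:R * (l / 3) <= 2 * (l / 3) by nra.
    by apply: lerD; rewrite ler_norml; lra.
  apply/eqP => zE; rewrite zE /= in zj zk; move/eqP: jk; apply.
  case: j zj {x2E jle j0} => [[|[|[|//]]] jP] /= zj; [exfalso; lra| |exfalso; lra].
  case: k zk {kle k0} => [[|[|[|//]]] kP] /= zk; [exfalso; lra| |exfalso; lra].
  by congr (_, _); apply: val_inj.
exists N => // n Nn.
have -> : l%:C%C = 3 * (l / 3)%:C%C :> C by rewrite fmorph_div rmorph_nat /=; field.
rewrite bdyS pair_bigA (bigD1 (1, 1)) //= addrC.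
apply: le_trans (nmD _ _) _; apply: lerD.
  rewrite -big_filter; apply: le_trans (nm_sum _ _) _; rewrite big_filter.
  have -> : e = \sum_(jk : 'I_3 * 'I_3) e / 9.
    by rewrite sumr_const card_prod !card_ord; field.
  rewrite big_mkcond; apply: ler_sum => jk _; case: ifP => [|_].
    exact: (HN n Nn jk).
  by rewrite divr_ge0// ltW.
rewrite le_eqVlt; apply/orP; left; apply/eqP; congr (nm (bdy _ _ _ _)).
by rewrite /corner !rmorphM !fmorphV !rmorph_nat /= (_ : 1 %% 3 = 1)%N //; field.
Qed.

(** The quotient (h z - h c) / (z - c) is bounded near c and differentiable
elsewhere, so its boundary sums vanish in the limit: replacing the square by its
central subsquare m times costs little, and makes the perimeter small.  Comparing
the two terms of the quotient on the boundary of the square bounds h c by the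
values of h there. *)
Lemma centre_bound h c s (M : R) : 0 < s ->
  (forall z, nm (z - c) <= s -> differentiable h z) ->
  (forall z, s / 2 <= nm (z - c) <= s -> nm (h z) <= M) ->
  nm (h c) <= 2 * M.
Proof.
move=> s0 dh hM.
pose k z := (h z - h c) / (z - c).
have dk z : nm (z - c) <= s -> z != c -> differentiable k z.
  move=> zs zc; apply: differentiableM.
    by apply: differentiableB; [exact: dh|exact: differentiable_cst].
  by apply: differentiableV; rewrite ?subr_eq0.
have [B B0 [d d0 kB]] : exists2 B : R, 0 <= B & exists2 d : R, 0 < d &
    forall z, nm (z - c) < d -> nm (k z) <= B.
  have hc : differentiable h c by apply: dh; rewrite subrr nm0 ltW.
  have [d d0 H] := differentiable_nm hc ltr01.
  exists (1 + nm ('d h c 1)); first by rewrite addr_ge0 ?nm_ge0.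
  exists d => // z /H; rewrite (_ : c + (z - c) = z); last by ring.
  rewrite (diff_mul1 _ _ (z - c)) mul1r /k => {}H.
  have [->|zc] := eqVneq z c.
    by rewrite !subrr mul0r nm0 addr_ge0 ?nm_ge0.
  rewrite nmM nmV ler_pdivrMr ?nm_gt0 ?subr_eq0//.
  have := nmD (h z - h c - (z - c) * 'd h c 1) ((z - c) * 'd h c 1).
  rewrite subrK nmM; lra.
have claim m : forall l, 0 < l -> l <= s -> l / 3 ^+ m < d -> forall e : R, 0 < e ->
    \forall n \near \oo, nm (bdy k n (corner c l) l%:C%C) <= e + 4 * (l / 3 ^+ m) * B.
  elim: m => [|m IH] l l0 ls ld e e0.
    apply: nearW => n; rewrite divr1 in ld *.
    apply: le_trans (@bdy_le _ k n _ _ B _) _.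
      move=> u v u1 v1 _; apply: kB.
      by apply: le_lt_trans (proj1 (corner_edge c (ltW l0) u1 v1)) ld.
    rewrite nmR gtr0_norm//; have := mulr_ge0 (ltW l0) B0; lra.
  have l3 : l / 3 ^+ m.+1 = l / 3 / 3 ^+ m.
    by rewrite exprS; field; rewrite expf_neq0 ?pnatr_eq0.
  have e2 : 0 < e / 2 by rewrite divr_gt0.
  rewrite l3 in ld *.
  have l30 : 0 < l / 3 by rewrite divr_gt0.
  have l3s : l / 3 <= s by lra.
  have [N1 _ H1] := IH _ l30 l3s ld _ e2.
  have dkl z : nm (z - c) <= l -> z != c -> differentiable k z.
    by move=> zl zc; apply: dk => //; rewrite (le_trans zl).
  have [N2 _ H2] := goursat_ring l0 dkl e2.
  exists (maxn N1 N2).+1 => // -[//|n]; rewrite /= ltnS geq_max => /andP[n1 n2].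
  have := H1 n n1; have := H2 n n2 => /=; lra.
apply/ler_addgt0Pr => e e0; have e2 : 0 < e / 2 by rewrite divr_gt0.
have e3 : 0 < e / (8 * (B + 1)) by rewrite divr_gt0// mulr_gt0// ltr_wpDl.
pose d' := Num.min d (e / (8 * (B + 1))).
have d'0 : 0 < d' by rewrite lt_min d0.
have [m md] := ternary_small s0 d'0.
move: (md); rewrite lt_min => /andP[md1 md2].
have [N _ /(_ N (leqnn _)) /= HN] := claim m s s0 (lexx _) md1 _ e2.
have Be : 4 * (s / 3 ^+ m) * B <= e / 2.
  move: md2; rewrite ltr_pdivlMr ?mulr_gt0 ?ltr_wpDl// => md2.
  have : 0 <= s / 3 ^+ m by rewrite divr_ge0 ?exprn_ge0// ltW.
  nra.
have E z : k z = h z / (z - c) - h c * (z - c)^-1 by rewrite /k mulrBl.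
move: HN; have -> : k = fun z => h z / (z - c) - h c * (z - c)^-1.
  by apply/funext => z.
rewrite bdyB bdyZ => HN.
have H8 : nm (bdy (fun z => h z / (z - c)) N (corner c s) s%:C%C) <= 8 * M.
  apply: le_trans (@bdy_le _ _ N _ _ (M / (s / 2)) _) _; last first.
    by rewrite nmR gtr0_norm//; rewrite le_eqVlt; apply/orP; left; apply/eqP; field; rewrite gt_eqF.
  move=> u v u1 v1 uv; have [zs /(_ uv) zs2] := corner_edge c (ltW s0) u1 v1.
  rewrite nmM nmV; apply: ler_pM; rewrite ?invr_ge0 ?nm_ge0//.
    by apply: hM; rewrite zs2 zs.
  rewrite lef_pV2// ?posrE ?divr_gt0//.
  by apply: lt_le_trans zs2; rewrite divr_gt0.
have H4 := bdy_inv_ge4 N c s0.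
set X := bdy _ _ _ _ in HN H8; set Y := bdy _ _ _ _ in HN H4.
have := nmB X (X - h c * Y).
rewrite (_ : X - (X - h c * Y) = h c * Y) ?(nmM (h c) Y); last by ring.
have := ler_wpM2l (nm_ge0 (h c)) H4; lra.
Qed.

End CentreBound.

(** * Cauchy estimates by divided differences *)

Section NearEq.
Variable R : realType.
Local Notation C := (R[i]).

Lemma differentiable_near_eq (V W : normedModType C) (f g : V -> W) x (r : R) :
  0 < r -> (forall y, nm (x - y) < r -> f y = g y) -> differentiable f x ->
  differentiable g x /\ 'd g x = 'd f x :> (V -> W).
Proof.
move=> r0 fg df; apply: differentiable_from; first exact: diff_continuous.
move=> e e0; have [d d0 H] := differentiable_nm df e0.
exists (Num.min d r) => [|h]; first by rewrite lt_min d0.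
rewrite lt_min => /andP[/H + hr].
rewrite !fg// ?subrr ?nm0//.
by rewrite opprD addrA subrr sub0r nmN.
Qed.

Lemma differentiable_subc (V : normedModType C) (a x : V) :
  differentiable (fun y : V => y - a) x.
Proof.
apply: differentiableB; last exact: differentiable_cst.
exact: (@ex_diff _ _ _ _ _ _ _ (is_diff_id x)).
Qed.

End NearEq.

(** Stated over an abstract field, where the continuity of the field operations
applies directly; likewise for the other limit computations in a numFieldType
below. *)
Lemma continuous_quotient (K : numFieldType) (g : K -> K) x a v :
  {for x, continuous g} -> x - v != 0 ->
  {for x, continuous (fun y => (g y - a) / (y - v))}.
Proof.
move=> gc xv.
have ca : {for x, continuous (fun=> a : K)} by exact: cst_continuous.
have cv : {for x, continuous (fun=> v : K)} by exact: cst_continuous.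
have ci : {for x, continuous (id : K -> K)} by move=> ?.
have h1 : {for x, continuous (fun y => g y - a)} by exact: continuousB gc ca.
have h2 : {for x, continuous (fun y => y - v)} by exact: continuousB ci cv.
exact: continuousM h1 (@continuousV K K (fun y => y - v) x xv h2).
Qed.

Section DividedDifference.
Variable R : realType.
Local Notation C := (R[i]).
Implicit Types (f g m : C -> C) (w z c : C) (s r M K : R).

(** A product is differentiable at a zero of a differentiable factor as soon as the
other factor is continuous.  This is how isolated singularities are removed. *)
Lemma differentiable_mul0 m g z : differentiable m z -> m z = 0 ->
  {for z, continuous g} -> differentiable (fun x => m x * g x) z.
Proof.
move=> dm mz /continuous_nm gc.
have dL : differentiable (fun x => g z * m x) z.
  by apply: differentiableM => //; exact: differentiable_cst.
apply: (proj1 (differentiable_from (diff_continuous dL) _)).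
move=> e e0.
have e2 : 0 < e / 2 by rewrite divr_gt0.
have [d1 d10 H1] := differentiable_nm dL e2.
have [d2 d20 H2] := differentiable_nm dm ltr01.
pose B := 1 + nm ('d m z 1).
have B0 : 0 < B by rewrite ltr_wpDr ?nm_ge0.
have [d3 d30 H3] := gc (e / 2 / B) (divr_gt0 e2 B0).
exists (Num.min d1 (Num.min d2 d3)) => [|h]; first by rewrite !lt_min d10 d20.
rewrite !lt_min => /and3P[h1 h2 h3].
have {}H1 := H1 h h1; have {}H2 := H2 h h2.
have {}H3 : nm (g z - g (z + h)) < e / 2 / B.
  by apply: H3; rewrite opprD addrA subrr sub0r nmN.
rewrite mz mulr0 subr0 in H1; rewrite mz subr0 diff_mul1 mul1r in H2.
rewrite mz mul0r subr0.
set D := 'd _ _ _ in H1 *; set X := m (z + h) in H1 H2 *.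
have XB : nm X <= B * nm h.
  have := nmD (X - h * 'd m z 1) (h * 'd m z 1); rewrite subrK nmM /B; lra.
have -> : X * g (z + h) - D = (g z * X - D) - X * (g z - g (z + h)) by ring.
apply: le_trans (nmB _ _) _; rewrite nmM.
rewrite (_ : e * nm h = e / 2 * nm h + (B * nm h) * (e / 2 / B)); last first.
  by field; rewrite gt_eqF.
by apply: lerD => //; apply: ler_pM; rewrite ?nm_ge0// ltW.
Qed.

Definition powf g n : C -> C := fun x => g x ^+ n.

Lemma powfS g n : powf g n.+1 = fun x => g x * powf g n x.
Proof. by apply/funext => x; rewrite /powf exprS. Qed.

Lemma powf0 g : powf g 0 = cst 1.
Proof. by apply/funext => x; rewrite /powf expr0. Qed.

Lemma continuous_powf g n z : {for z, continuous g} -> {for z, continuous (powf g n)}.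
Proof.
move=> gc; elim: n => [|n IH]; first by rewrite powf0; exact: cst_continuous.
by rewrite powfS; exact: (cvgM gc IH).
Qed.

Lemma differentiable_powf g n z : differentiable g z -> differentiable (powf g n) z.
Proof.
move=> dg; elim: n => [|n IH]; first by rewrite powf0; exact: differentiable_cst.
by rewrite powfS; exact: differentiableM.
Qed.

(** [centre_bound] applied to m g^n gives |m c| |g c|^n <= 2 K M^n for all n, and
the constants disappear in the limit.  The factor m, which vanishes where g is
merely continuous, makes the products differentiable. *)
Lemma power_bound m g c s M K : 0 < s ->
  (forall z, nm (z - c) <= s -> differentiable m z) ->
  (forall z, nm (z - c) <= s -> nm (m z) <= K) ->
  (forall z, nm (z - c) <= s -> {for z, continuous g}) ->
  (forall z, nm (z - c) <= s -> m z != 0 -> differentiable g z) ->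
  (forall z, s / 2 <= nm (z - c) <= s -> nm (g z) <= M) ->
  m c != 0 -> nm (g c) <= M.
Proof.
move=> s0 dm mK gc dg gM mc; rewrite leNgt; apply/negP => Mlt.
have cs : nm (c - c) <= s by rewrite subrr nm0 ltW.
have M0 : 0 <= M.
  apply: le_trans (nm_ge0 (g (c + s%:C%C))) _; apply: gM.
  by rewrite addrC addKr nmR gtr0_norm// lexx andbT; lra.
have G0 : 0 < nm (g c) by exact: le_lt_trans Mlt.
have K0 : 0 <= K by apply: le_trans (mK c cs); exact: nm_ge0.
have H n : nm (m c) <= 2 * K * (M / nm (g c)) ^+ n.
  have : nm (m c * g c ^+ n) <= 2 * (K * M ^+ n).
    apply: (@centre_bound R (fun z => m z * powf g n z) c s) => // z.
      move=> zs; have [mz|mz] := eqVneq (m z) 0.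
        apply: differentiable_mul0 => //; first exact: dm.
        exact/continuous_powf/gc.
      apply: differentiableM; first exact: dm.
      by apply: differentiable_powf; exact: dg.
    move=> /andP[z1 z2]; rewrite nmM nmX.
    apply: ler_pM; rewrite ?exprn_ge0 ?nm_ge0//; first exact: mK.
    by apply: lerXn2r; rewrite ?nnegrE ?nm_ge0 // gM// z1.
  rewrite nmM nmX expr_div_n (mulrA (2 * K)) ler_pdivlMr ?exprn_gt0//; lra.
have mc0 : 0 < nm (m c) by rewrite nm_gt0.
have e0 : 0 < nm (m c) / (2 * K + 1) by rewrite divr_gt0// ltr_wpDl// mulr_ge0.
have /cvgrPdist_lt/(_ _ e0) :
    (M / nm (g c)) ^+ n @[n --> \oo] --> (0 : R).
  apply: cvg_expr; rewrite ger0_norm ?divr_ge0//; last exact: ltW.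
  by rewrite ltr_pdivrMr// mul1r.
move=> [N _ /(_ N (leqnn _))] /=; rewrite sub0r normrN ger0_norm; last first.
  by rewrite exprn_ge0// divr_ge0// ltW.
rewrite ltr_pdivlMr ?ltr_wpDl ?mulr_ge0// => HN.
have := H N; have : 0 <= (M / nm (g c)) ^+ N by rewrite exprn_ge0// divr_ge0// ltW.
lra.
Qed.

Definition dq f w z : C := if z == w then 'd f w 1 else (f z - f w) / (z - w).

Lemma dqE f w z : dq f w z * (z - w) = f z - f w.
Proof.
rewrite /dq; case: eqVneq => [->|zw]; first by rewrite !subrr mulr0.
by rewrite divfK// subr_eq0.
Qed.

Lemma dqNE f w z : z != w -> dq f w z = (f z - f w) / (z - w).
Proof. by rewrite /dq => /negbTE ->. Qed.

Lemma differentiable_dq f w z : z != w -> differentiable f z ->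
  differentiable (dq f w) z.
Proof.
move=> zw df.
have zw0 : 0 < nm (z - w) by rewrite nm_gt0 subr_eq0.
have fE y : nm (z - y) < nm (z - w) -> (f y - f w) / (y - w) = dq f w y.
  by move=> yz; rewrite /dq; case: eqVneq => // yw; rewrite yw ltxx in yz.
apply: (proj1 (differentiable_near_eq zw0 fE _)).
apply: differentiableM.
  by apply: differentiableB => //; exact: differentiable_cst.
by apply: differentiableV; rewrite ?subr_eq0.
Qed.

Lemma continuous_dq f w z : differentiable f z -> {for z, continuous (dq f w)}.
Proof.
move=> df; have [zw|zw] := eqVneq z w; last first.
  by apply: differentiable_continuous; exact: differentiable_dq.
rewrite zw in df *; apply/continuous_nm => e e0.
have e2 : 0 < e / 2 by rewrite divr_gt0.
have [d d0 H] := differentiable_nm df e2; exists d => // y yd.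
rewrite /dq eqxx; case: eqVneq => [_|yw]; first by rewrite subrr nm0.
rewrite nmBC in yd; have := H (y - w) yd.
rewrite (_ : w + (y - w) = y) ?(diff_mul1 _ _ (y - w)); last by ring.
have yw0 : 0 < nm (y - w) by rewrite nm_gt0 subr_eq0.
have -> : f y - f w - (y - w) * 'd f w 1 =
    - ((y - w) * ('d f w 1 - (f y - f w) / (y - w))).
  by field; rewrite subr_eq0.
rewrite nmN nmM mulrC ler_pM2r// => /le_lt_trans; apply; lra.
Qed.

Lemma continuous_dq_off g v x : {for x, continuous g} -> x != v ->
  {for x, continuous (dq g v)}.
Proof.
move=> gc xv.
have vx0 : 0 < nm (x - v) by rewrite nm_gt0 subr_eq0.
have xv0 : x - v != 0 by rewrite subr_eq0.
have /continuous_nm c1 := @continuous_quotient _ g x (g v) v gc xv0.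
apply/continuous_nm => e e0; have [d d0 Hd] := c1 e e0.
exists (Num.min d (nm (x - v))) => [|y]; first by rewrite lt_min d0.
rewrite lt_min => /andP[/Hd + yx].
rewrite [dq _ v x]/dq (negbTE xv) [dq _ v y]/dq; case: eqVneq => // yv.
by rewrite yv ltxx in yx.
Qed.

(** On an annulus around z the denominator of the divided difference
is bounded below, and by [power_bound] this controls its value at z; the factor
x - w takes care of the point w. *)
Lemma dq_bound f w z r M : 0 < r ->
  (forall x, nm (x - w) < r -> differentiable f x) ->
  (forall x, nm (x - w) < r -> nm (f x) <= M) ->
  nm (z - w) < r / 16 -> z != w -> nm (dq f w z) <= 32 * M / r.
Proof.
move=> r0 df fM zr zw; have r4 : 0 < r / 4 by rewrite divr_gt0.
have near x : nm (x - z) <= r / 4 -> nm (x - w) < r.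
  by have := nm_tri z x w; lra.
apply: (@power_bound (fun x => x - w) (dq f w) z (r / 4) _ r r4).
- by move=> x _; exact: differentiable_subc.
- by move=> x /near /ltW.
- by move=> x /near/df; exact: continuous_dq.
- by move=> x /near/df dx xw; apply: differentiable_dq dx; rewrite -subr_eq0.
- move=> x /andP[x1 x2].
  have xw : r / 16 <= nm (x - w).
    by have := nm_tri w x z; rewrite (nmBC w z); lra.
  have xw0 : x != w by rewrite -subr_eq0 -nm_gt0; lra.
  rewrite dqNE// nmM nmV ler_pdivrMr; last by rewrite nm_gt0 subr_eq0.
  have fx := fM x (near x x2).
  have fw : nm (f w) <= M by apply: fM; rewrite subrr nm0.
  apply: (@le_trans _ _ (2 * M)); first by rewrite mulr_natl mulr2n (le_trans (nmB _ _))// lerD.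
  have M0 : 0 <= M by exact: le_trans (nm_ge0 _) fw.
  rewrite (_ : 2 * M = 32 * M / r * (r / 16)); last by field; rewrite gt_eqF.
  by rewrite ler_wpM2l// divr_ge0 ?mulr_ge0// ltW.
- by rewrite subr_eq0.
Qed.

(** Bounds pass from a punctured neighbourhood to its centre for functions that are
lower semicontinuous there; this extends bounds on divided differences to
the derivative. *)
Lemma le_of_punctured (F : C -> R) w (K : R) r : 0 < r ->
  (forall e, 0 < e -> exists2 d : R, 0 < d &
     forall y, nm (w - y) < d -> F w <= F y + e) ->
  (forall x, nm (w - x) < r -> x != w -> F x <= K) -> F w <= K.
Proof.
move=> r0 Fc FK; apply/ler_addgt0Pr => e e0; have [d d0 H] := Fc e e0.
pose t := Num.min d r / 2.
have t0 : 0 < t by rewrite divr_gt0// lt_min d0.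
have td : t < d.
  by rewrite /t ltr_pdivrMr// gt_min; apply/orP; left; lra.
have tr : t < r.
  by rewrite /t ltr_pdivrMr// gt_min; apply/orP; right; lra.
have wt : nm (w - (w + t%:C%C)) = t.
  by rewrite opprD addrA subrr sub0r nmN nmR gtr0_norm.
apply: le_trans (H (w + t%:C%C) _) _; rewrite ?wt// lerD2r.
apply: FK; rewrite ?wt//.
by rewrite -subr_eq0 addrC addKr (inj_eq (@complexI R) t 0) gt_eqF.
Qed.

Lemma cauchy_bound f w r M : 0 < r ->
  (forall x, nm (x - w) < r -> differentiable f x) ->
  (forall x, nm (x - w) < r -> nm (f x) <= M) ->
  nm ('d f w 1) <= 32 * M / r.
Proof.
move=> r0 df fM.
have dw : differentiable f w by apply: df; rewrite subrr nm0.
have r16 : 0 < r / 16 by rewrite divr_gt0.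
suff : nm (dq f w w) <= 32 * M / r by rewrite /dq eqxx.
apply: (@le_of_punctured (fun x => nm (dq f w x)) w _ (r / 16)) => //.
  move=> e e0; have /continuous_nm/(_ e e0)[d d0 H] := continuous_dq (w := w) dw.
  exists d => // y /H; have := nmD (dq f w w - dq f w y) (dq f w y).
  by rewrite subrK; lra.
by move=> x xr xw; apply: dq_bound => //; rewrite nmBC.
Qed.

Lemma lipschitz_bound f w z r M : 0 < r ->
  (forall x, nm (x - w) < r -> differentiable f x) ->
  (forall x, nm (x - w) < r -> nm (f x) <= M) ->
  nm (z - w) < r / 16 -> nm (f z - f w) <= 32 * M / r * nm (z - w).
Proof.
move=> r0 df fM zr; have [->|zw] := eqVneq z w.
  by rewrite !subrr nm0 mulr0.
rewrite -dqE nmM ler_wpM2r ?nm_ge0//; exact: dq_bound.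
Qed.

(** The second divided difference, with nodes w and v, is bounded by the same
argument as the first; letting v tend to w turns it into the Taylor remainder. *)
Lemma taylor_bound f w z r M : 0 < r ->
  (forall x, nm (x - w) < r -> differentiable f x) ->
  (forall x, nm (x - w) < r -> nm (f x) <= M) ->
  nm (z - w) < r / 32 ->
  nm (f z - f w - (z - w) * 'd f w 1) <= 1024 * M / r ^+ 2 * nm (z - w) ^+ 2.
Proof.
move=> r0 df fM zr; have [->|zw] := eqVneq z w.
  by rewrite !subrr nm0 mul0r subr0 nm0 expr0n mulr0.
have M0 : 0 <= M.
  by apply: le_trans (nm_ge0 _) (fM w _); rewrite subrr nm0.
have L0 : 0 <= 1024 * M / r ^+ 2.
  by apply: divr_ge0; [apply: mulr_ge0; [exact: ler0n|]|exact/exprn_ge0/ltW].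
have zw0 : 0 < nm (z - w) by rewrite nm_gt0 subr_eq0.
have r4 : 0 < r / 4 by rewrite divr_gt0.
have near x : nm (x - z) <= r / 4 -> nm (x - w) < r.
  by have := nm_tri z x w; lra.
have qM x : r / 16 <= nm (x - w) < r -> nm (dq f w x) <= 32 * M / r.
  move=> /andP[x1 x2].
  have xw0 : x != w by rewrite -subr_eq0 -nm_gt0; lra.
  rewrite dqNE// nmM nmV ler_pdivrMr; last by rewrite nm_gt0 subr_eq0.
  have fx := fM x x2.
  have fw : nm (f w) <= M by apply: fM; rewrite subrr nm0.
  apply: (@le_trans _ _ (2 * M)); first by rewrite mulr_natl mulr2n (le_trans (nmB _ _))// lerD.
  rewrite (_ : 2 * M = 32 * M / r * (r / 16)); last by field; rewrite gt_eqF.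
  by rewrite ler_wpM2l// divr_ge0 ?mulr_ge0// ltW.
have H v : nm (v - w) < r / 32 -> v != w -> v != z ->
    nm (dq f w z - dq f w v) <= 1024 * M / r ^+ 2 * nm (z - v).
  move=> vr vw vz; rewrite -dqE nmM ler_wpM2r ?nm_ge0//.
  have dqd x : nm (x - w) < r -> x != w -> differentiable (dq f w) x.
    by move=> /df dx xw; exact: differentiable_dq.
  apply: (@power_bound (fun x => (x - w) * (x - v)) (dq (dq f w) v) z (r / 4)
      _ (r * (2 * r)) r4).
  - by move=> x _; apply: differentiableM; exact: differentiable_subc.
  - move=> x xz; have xr := near x xz; rewrite nmM.
    apply: ler_pM; rewrite ?nm_ge0//; first exact: ltW.
    by have := nm_tri w x v; rewrite (nmBC w v); lra.
  - move=> x xz; have xr := near x xz.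
    have [->|xv] := eqVneq x v.
      apply: continuous_dq; apply: dqd vw; lra.
    by apply: continuous_dq_off xv; apply: continuous_dq; exact: df.
  - move=> x xz; rewrite mulf_eq0 negb_or !subr_eq0 => /andP[xw xv].
    by apply: differentiable_dq xv _; apply: dqd xw; exact: near.
  - move=> x /andP[x1 x2].
    have xv : r / 16 <= nm (x - v).
      have := nm_tri v x z; have := nm_tri w v z; rewrite (nmBC w z); lra.
    have xw : r / 16 <= nm (x - w).
      by have := nm_tri w x z; rewrite (nmBC w z); lra.
    have xv0 : x != v by rewrite -subr_eq0 -nm_gt0; lra.
    rewrite dqNE// nmM nmV ler_pdivrMr; last first.
      by rewrite nm_gt0 subr_eq0.
    have q1 : nm (dq f w x) <= 32 * M / r by apply: qM; rewrite xw near.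
    have q2 : nm (dq f w v) <= 32 * M / r by apply: dq_bound => //; lra.
    apply: (@le_trans _ _ (2 * (32 * M / r))).
      by rewrite mulr_natl mulr2n (le_trans (nmB _ _))// lerD.
    rewrite (_ : 2 * (32 * M / r) = 1024 * M / r ^+ 2 * (r / 16)); last first.
      by field; rewrite gt_eqF.
    by rewrite ler_wpM2l.
  - by rewrite mulf_neq0// subr_eq0// eq_sym.
have dw : differentiable f w by apply: df; rewrite subrr nm0.
have -> : f z - f w - (z - w) * 'd f w 1 = (dq f w z - dq f w w) * (z - w).
  by rewrite [RHS]mulrBl dqE /dq eqxx [_ * (z - w)]mulrC.
rewrite nmM expr2 mulrA ler_wpM2r ?nm_ge0//.
set L := 1024 * M / r ^+ 2 in H L0 *.
rewrite -subr_le0.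
pose F v := nm (dq f w z - dq f w v) - L * nm (z - v).
apply: (@le_of_punctured F w 0 (Num.min (r / 32) (nm (z - w)))).
- by rewrite lt_min zw0 divr_gt0.
- move=> e e0; have e2 : 0 < e / 2 by rewrite divr_gt0.
  have /continuous_nm/(_ _ e2)[d d0 Hd] := continuous_dq (w := w) dw.
  have L1 : 0 < L + 1 by rewrite ltr_wpDl.
  exists (Num.min d (e / 2 / (L + 1))) => [|y].
    by rewrite lt_min d0 divr_gt0.
  rewrite lt_min => /andP[/Hd yd]; rewrite ltr_pdivlMr// => ye.
  have h1 := nm_tri (dq f w y) (dq f w z) (dq f w w).
  rewrite (nmBC (dq f w y)) in h1.
  have := nm_tri w z y; rewrite /F.
  have := nm_ge0 (w - y).
  set u := nm (w - y) in ye *; set a := nm (z - w); set b := nm (z - y).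
  move=> u0 /(ler_wpM2l L0); nra.
- move=> x; rewrite lt_min => /andP[xr xz] xw.
  rewrite subr_le0; apply: H => //; first by rewrite nmBC.
  by apply/eqP => xE; rewrite xE nmBC ltxx in xz.
Qed.

End DividedDifference.

(** * Weierstrass' theorem *)

Section Lines.
Variable R : realType.
Local Notation C := (R[i]).
Variable V : normedModType C.
Implicit Types (f : V -> C) (x v : V) (r M : R).

Lemma differentiable_line x v (t : C) :
  differentiable (fun s : C => x + s *: v) t /\
  'd (fun s : C => x + s *: v) t 1 = v.
Proof.
have L : is_diff t (fun s : C => x + s *: v) (0 + ( *:%R^~ v : C -> V)).
  by apply: is_diffD.
by split; [exact: ex_diff|rewrite diff_val/= /GRing.add/= add0r scale1r].
Qed.

(** Several variables are reduced to one by restriction to complex lines. *)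
Lemma diff_line f x v (t : C) : differentiable f (x + t *: v) ->
  differentiable (fun s : C => f (x + s *: v)) t /\
  'd (fun s : C => f (x + s *: v)) t 1 = 'd f (x + t *: v) v.
Proof.
move=> df; have [dl lE] := differentiable_line x v t.
split; first exact: (differentiable_comp dl df).
by have := diff_comp dl df; rewrite /comp => -> /=; rewrite lE.
Qed.

Section Bounds.
Variables (f : V -> C) (x : V) (r M : R).
Hypothesis r0 : 0 < r.
Hypothesis df : forall y, nm (y - x) < r -> differentiable f y.
Hypothesis fM : forall y, nm (y - x) < r -> nm (f y) <= M.

Let line_in v (t : C) : v != 0 -> nm (t - 0) < r / nm v ->
  nm ((x + t *: v) - x) < r.
Proof.
by move=> v0; rewrite subr0 addrC addKr nmZ ltr_pdivlMr ?nm_gt0.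
Qed.

Let dline v (t : C) : v != 0 -> nm (t - 0) < r / nm v ->
  differentiable (fun s : C => f (x + s *: v)) t.
Proof.
by move=> v0 tr; apply: (proj1 (diff_line (df _))); exact: line_in.
Qed.

Let line0 v : 'd (fun s : C => f (x + s *: v)) 0 1 = 'd f x v.
Proof.
have dx : differentiable f (x + (0 : C) *: v).
  by rewrite scale0r addr0; apply: df; rewrite subrr nm0.
by rewrite (proj2 (diff_line dx)) scale0r addr0.
Qed.

Let cE (a : R) v : a / (r / nm v) = a / r * nm v.
Proof. by rewrite invf_div mulrA mulrAC. Qed.

Let cE2 (a : R) v : a / (r / nm v) ^+ 2 = a / r ^+ 2 * nm v ^+ 2.
Proof. by rewrite expr_div_n invf_div mulrA mulrAC. Qed.

Let nm10 : nm (1 - 0 : C) = 1. Proof. by rewrite subr0 nm1. Qed.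

Lemma diff_bound v : nm ('d f x v) <= 32 * M / r * nm v.
Proof.
have [->|v0] := eqVneq v 0; first by rewrite linear0 !nm0 mulr0.
have rv : 0 < r / nm v by rewrite divr_gt0// nm_gt0.
have := @cauchy_bound _ (fun s : C => f (x + s *: v)) 0 _ _ rv
  (fun t tr => dline v0 tr) (fun t tr => fM (line_in v0 tr)).
by rewrite line0 cE.
Qed.

Lemma lip_bound v : nm v < r / 16 ->
  nm (f (x + v) - f x) <= 32 * M / r * nm v.
Proof.
have [->|v0 vr] := eqVneq v 0; first by rewrite addr0 subrr !nm0 mulr0.
have rv : 0 < r / nm v by rewrite divr_gt0// nm_gt0.
have := @lipschitz_bound _ (fun s : C => f (x + s *: v)) 0 1 _ _ rv
  (fun t tr => dline v0 tr) (fun t tr => fM (line_in v0 tr)).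
rewrite nm10 mulr1 scale1r scale0r addr0 cE; apply.
by rewrite mulrAC ltr_pdivlMr ?nm_gt0// mul1r.
Qed.

Lemma taylor_le v : nm v < r / 32 ->
  nm (f (x + v) - f x - 'd f x v) <= 1024 * M / r ^+ 2 * nm v ^+ 2.
Proof.
have [->|v0 vr] := eqVneq v 0.
  by rewrite addr0 subrr linear0 subr0 !nm0 expr0n mulr0.
have rv : 0 < r / nm v by rewrite divr_gt0// nm_gt0.
have := @taylor_bound _ (fun s : C => f (x + s *: v)) 0 1 _ _ rv
  (fun t tr => dline v0 tr) (fun t tr => fM (line_in v0 tr)).
rewrite nm10 expr1n mulr1 scale1r scale0r addr0 subr0 mul1r line0.
rewrite cE2; apply.
by rewrite mulrAC ltr_pdivlMr ?nm_gt0// mul1r.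
Qed.

End Bounds.
End Lines.

Lemma diffB_bound (R : realType) (V : normedModType R[i]) (f g : V -> R[i])
    (x : V) (r M : R) : 0 < r ->
  (forall y, nm (y - x) < r -> differentiable f y) ->
  (forall y, nm (y - x) < r -> differentiable g y) ->
  (forall y, nm (y - x) < r -> nm (f y - g y) <= M) ->
  forall v, nm ('d f x v - 'd g x v) <= 32 * M / r * nm v.
Proof.
move=> r0 df dg fgM v.
have xx : nm (x - x) < r by rewrite subrr nm0.
have dfg y : nm (y - x) < r -> differentiable (fun z => f z - g z) y.
  by move=> yr; apply: differentiableB; [exact: df|exact: dg].
have E := congr1 (fun k : V -> R[i] => k v) (diffB (df x xx) (dg x xx)).
exact: (eq_ind _ (fun z : R[i] => nm z <= _) (diff_bound r0 dfg fgM v) _ E).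
Qed.

Lemma cvg_affine (K : numFieldType) (u v : nat -> K) (a l m : K) :
  u @ \oo --> l -> v @ \oo --> m -> (fun n => a * u n + v n) @ \oo --> a * l + m.
Proof. by move=> ul vm; apply: cvgD => //; apply: cvgMl_tmp. Qed.

Section Weierstrass.
Variable R : realType.
Local Notation C := (R[i]).

Definition cseq (u : nat -> C) := forall e : R, 0 < e -> exists N, forall m n,
  (N <= m)%N -> (N <= n)%N -> nm (u m - u n) <= e.

Lemma complex_complete (u : nat -> C) : cseq u -> exists l : C, u @ \oo --> l.
Proof.
move=> uC.
have cauchyR (p : nat -> R) : (forall e : R, 0 < e -> exists N, forall n,
    (N <= n)%N -> `|p N - p n| < e) -> cvg (p @ \oo).
  move=> H; apply: cauchy_cvg; apply: cauchy_exP => e e0.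
  have [N HN] := H e e0; exists (p N); exists N => // n /= Nn.
have {}uC e : 0 < e -> exists N, forall n, (N <= n)%N -> nm (u N - u n) < e.
  move=> e0; have e2 : 0 < e / 2 by rewrite divr_gt0.
  have [N HN] := uC _ e2; exists N => n Nn.
  by apply: le_lt_trans (HN _ _ (leqnn _) Nn) _; rewrite ltr_pdivrMr//; lra.
have cR : cvg ((fun n => complex.Re (u n)) @ \oo).
  apply: cauchyR => e /uC[N HN]; exists N => n /HN; apply: le_lt_trans.
  by rewrite -raddfB; exact: Re_nm.
have cI : cvg ((fun n => complex.Im (u n)) @ \oo).
  apply: cauchyR => e /uC[N HN]; exists N => n /HN; apply: le_lt_trans.
  by rewrite -raddfB; exact: Im_nm.
set a := lim _ in cR; set b := lim _ in cI.
exists (a +i* b)%C; apply/cvg_nm => e e0; have e2 : 0 < e / 2 by rewrite divr_gt0.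
have /cvgrPdist_lt/(_ _ e2)[N1 _ H1] := cR.
have /cvgrPdist_lt/(_ _ e2)[N2 _ H2] := cI.
exists (maxn N1 N2) => // n /=; rewrite geq_max => /andP[/H1/= h1 /H2/= h2].
apply: le_lt_trans (nm_ReIm _) _.
rewrite !raddfB /=; lra.
Qed.

Lemma cvg_nmN (u : nat -> C) (l : C) : u @ \oo --> l <-> forall e : R, 0 < e ->
  exists N, forall n, (N <= n)%N -> nm (l - u n) < e.
Proof.
rewrite cvg_nm; split => H e /H.
  by case=> N _ HN; exists N => n /HN.
by case=> N HN; exists N => // n /HN.
Qed.

Lemma limit_le (u : nat -> C) (l : C) (a : C) (K : R) (N : nat) :
  u @ \oo --> l -> (forall n, (N <= n)%N -> nm (u n - a) <= K) -> nm (l - a) <= K.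
Proof.
move=> /cvg_nmN ul H; apply/ler_addgt0Pr => e /ul[N' HN'].
have := HN' (maxn N N') (leq_maxr _ _); have := H _ (leq_maxl N N').
by have := nm_tri (u (maxn N N')) l a; lra.
Qed.

Variable V : normedModType C.
Implicit Types (F : nat -> V -> C) (f : V -> C) (x v : V) (r M : R).

(** The differentials converge pointwise by [diff_bound], and the uniform bound of
[taylor_le] on the remainders passes to the limit. *)
Lemma weierstrass F f x r : 0 < r ->
  (forall n y, nm (y - x) < r -> differentiable (F n) y) ->
  (forall e : R, 0 < e -> exists N, forall n y, (N <= n)%N -> nm (y - x) < r ->
     nm (F n y - f y) <= e) ->
  differentiable f x.
Proof.
move=> r0 dF Fu.
have xx : nm (x - x) < r by rewrite subrr nm0.
have [N HN] := Fu 1 ltr01.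
have /continuous_nm/(_ 1 ltr01)[d d0 Hd] := differentiable_continuous (dF N x xx).
pose M := nm (F N x) + 4.
pose s := Num.min d r.
have s0 : 0 < s by rewrite lt_min d0.
have sr y : nm (y - x) < s -> nm (y - x) < r by rewrite lt_min => /andP[].
have FM n y : (N <= n)%N -> nm (y - x) < s -> nm (F n y) <= M.
  move=> Nn ys; have h1 := HN n y Nn (sr y ys).
  have h2 := HN N y (leqnn _) (sr y ys).
  have h3 : nm (F N x - F N y) < 1.
    by apply: Hd; rewrite nmBC; move: ys; rewrite lt_min => /andP[].
  have := nmD (F n y - f y) (f y); have := nmD (f y - F N y) (F N y).
  have := nmD (F N y - F N x) (F N x); rewrite !subrK /M.
  rewrite (nmBC (f y)) (nmBC (F N y) (F N x)).
  move: (nm _) (nm _) (nm _) (nm _) (nm _) (nm _) (nm _) h1 h2 h3 => *; lra.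
have dFs n y : nm (y - x) < s -> differentiable (F n) y by move=> /sr; exact: dF.
have Dc v : cseq (fun n => 'd (F n) x v).
  move=> e e0; have K0 : 0 < 32 * nm v / s + 1.
    by rewrite ltr_wpDl// divr_ge0 ?(ltW s0)// mulr_ge0// nm_ge0.
  have e'0 : 0 < e / (32 * nm v / s + 1) / 2 by rewrite !divr_gt0.
  have [N' HN'] := Fu _ e'0; exists N' => m n N'm N'n.
  have BM y : nm (y - x) < s -> nm (F m y - F n y) <= e / (32 * nm v / s + 1).
    move=> /sr yr.
    have := HN' m y N'm yr; have := HN' n y N'n yr.
    have := nm_tri (f y) (F m y) (F n y); rewrite (nmBC (f y)).
    move: (nm _) (nm _) (nm _) => a b c *; lra.
  have := diffB_bound s0 (dFs m) (dFs n) BM v.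
  move=> /le_trans; apply.
  rewrite (_ : 32 * _ / s * nm v = e * ((32 * nm v / s) / (32 * nm v / s + 1))).
    by rewrite ler_piMr ?ltW// ltr_pdivrMr// mul1r ltrDl.
  move: (_ + 1) K0 => D D0; field; rewrite !gt_eqF//.
have /choice[L LP] : forall v, exists l : C, (fun n => 'd (F n) x v) @ \oo --> l.
  by move=> v; apply: complex_complete; exact: Dc.
have linL : linear L.
  move=> a u v; apply: (cvg_unique _ (LP (a *: u + v))); first exact: norm_hausdorff.
  rewrite (_ : (fun n => _) = (fun n => a * 'd (F n) x u + 'd (F n) x v)).
    exact: cvg_affine (LP u) (LP v).
  by apply/funext => n; rewrite linearP.
pose Lp : {linear V -> C} := HB.pack L (GRing.isLinear.Build C V C _ L linL).
have Lb v : nm (Lp v) <= 32 * M / s * nm v.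
  rewrite -[Lp v]subr0; apply: (@limit_le _ _ 0 _ N (LP v)) => n Nn.
  by rewrite subr0; apply: diff_bound s0 (dFs n) _ _ => y ys; exact: FM.
have M0 : 0 <= M by rewrite addr_ge0 ?nm_ge0.
have Lc : continuous Lp.
  move=> y; apply/continuous_nm => e e0.
  have K0 : 0 < 32 * M / s + 1.
    by rewrite ltr_wpDl// divr_ge0 ?(ltW s0)// mulr_ge0.
  exists (e / (32 * M / s + 1)) => [|z]; first by rewrite divr_gt0.
  rewrite ltr_pdivlMr// mulrDr mulr1 -linearB => h.
  by apply: le_lt_trans (Lb _) _; have := nm_ge0 (y - z); lra.
have Lt v : nm v < s / 32 ->
    nm (f (x + v) - f x - Lp v) <= 1024 * M / s ^+ 2 * nm v ^+ 2.
  move=> vs; apply/ler_addgt0Pr => e e0.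
  have e3 : 0 < e / 3 by rewrite divr_gt0.
  have [N1 H1] := Fu _ e3.
  have /cvg_nmN/(_ _ e3)[N2 H2] := LP v.
  pose n := maxn N (maxn N1 N2).
  have nN : (N <= n)%N by rewrite leq_maxl.
  have n1 : (N1 <= n)%N by rewrite /n maxnCA leq_maxl.
  have n2 : (N2 <= n)%N by rewrite /n maxnA leq_maxr.
  have T := taylor_le s0 (dFs n) (fun y ys => FM n y nN ys) vs.
  have xvr : nm (x + v - x) < r.
    rewrite addrC addKr (lt_le_trans vs)// ler_pdivrMr// (le_trans (_ : s <= r)).
      by [].
      by rewrite ge_min lexx orbT.
    by rewrite ler_peMr// ?ltW//; lra.
  have h1 := H1 n (x + v) n1 xvr; have h2 := H1 n x n1 xx.
  have h3 := ltW (H2 n n2).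
  have -> : f (x + v) - f x - Lp v = (F n (x + v) - F n x - 'd (F n) x v)
     - (F n (x + v) - f (x + v)) + (F n x - f x) - (L v - 'd (F n) x v).
    have -> : Lp v = L v by []. ring.
  apply: le_trans (nmB _ _) _.
  rewrite (_ : _ + e = 1024 * M / s ^+ 2 * nm v ^+ 2 + e / 3 + e / 3 + e / 3); last first.
    by field; rewrite gt_eqF.
  apply: lerD h3; apply: le_trans (nmD _ _) _; apply: lerD h2.
  by apply: le_trans (nmB _ _) _; apply: lerD h1.
apply: (proj1 (differentiable_from Lc _)) => e e0.
set K := 1024 * M / s ^+ 2 in Lt.
have K0 : 0 <= K.
  by apply: divr_ge0; [apply: mulr_ge0; [exact: ler0n|]|exact/exprn_ge0/ltW].
have K1 : 0 < K + 1 by rewrite ltr_wpDl.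
exists (Num.min (s / 32) (e / (K + 1))) => [|h].
  by rewrite lt_min !divr_gt0.
rewrite lt_min (ltr_pdivlMr _ _ K1) => /andP[/Lt + he].
move/le_trans; apply; rewrite expr2 mulrA ler_wpM2r ?nm_ge0//.
have := nm_ge0 h; move: (nm h) he => u; nra.
Qed.

End Weierstrass.

(** * Division by a linear form *)

Section Division.
Variable R : realType.
Local Notation C := (R[i]).
Variable V : normedModType C.
Implicit Types (f g : V -> C) (x y v : V) (r M : R).

Lemma harmonic_le (K e : R) : 0 <= K -> 0 < e ->
  exists N, forall n, (N <= n)%N -> K / n.+1%:R <= e.
Proof.
move=> K0 e0; exists (Num.bound (K / e)) => n Nn.
rewrite ler_pdivrMr ?ltr0n// -ler_pdivrMl// mulrC.
have := archi_boundP (divr_ge0 K0 (ltW e0)) => /ltW/le_trans; apply.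
by rewrite ler_nat ltnW.
Qed.

Lemma loc_bounded f x : differentiable f x -> exists2 s : R, 0 < s &
  exists M : R, forall y, nm (y - x) < s -> nm (f y) <= M.
Proof.
move=> /differentiable_continuous/continuous_nm/(_ 1 ltr01)[d d0 H].
exists d => //; exists (nm (f x) + 1) => y; rewrite nmBC => /H.
have := nmD (f y - f x) (f x); rewrite subrK nmBC.
move: (nm _) (nm _) (nm _) => a b c *; lra.
Qed.

(** The Cauchy estimates at a point y use f on a ball around y; here it is one radius
and one bound for all y near x. *)
Lemma doubled_ball f x r : 0 < r ->
  (forall y, nm (y - x) < r -> differentiable f y) ->
  exists2 s : R, 0 < s & exists M, [/\ 0 <= M,
    (forall y, nm (y - x) < s -> forall z, nm (z - y) < s -> differentiable f z) &
    (forall y, nm (y - x) < s -> forall z, nm (z - y) < s -> nm (f z) <= M)].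
Proof.
move=> r0 df.
have [|s0 s00 [M FM0]] := @loc_bounded f x; first by apply: df; rewrite subrr nm0.
exists (Num.min s0 r / 2); first by rewrite divr_gt0// lt_min s00.
set s := Num.min s0 r / 2.
have s2 y z : nm (y - x) < s -> nm (z - y) < s -> nm (z - x) < s0 /\ nm (z - x) < r.
  move=> ys zy; apply/andP; rewrite -lt_min.
  apply: le_lt_trans (nm_tri y z x) _; move: ys zy; rewrite /s; lra.
exists M; split=> [|y ys z zy|y ys z zy].
- by apply: le_trans (nm_ge0 (f x)) _; apply: FM0; rewrite subrr nm0.
- by apply: df; apply: proj2 (s2 y z ys zy).
- by apply: FM0; apply: proj1 (s2 y z ys zy).
Qed.

(** A directional derivative is a uniform limit of difference quotients, by
[taylor_le]. *)
Lemma differentiable_diff f x r v : 0 < r ->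
  (forall y, nm (y - x) < r -> differentiable f y) ->
  differentiable (fun y => 'd f y v : C) x.
Proof.
move=> r0 df.
have [s s_gt0 [M [M0 dfs FM]]] := doubled_ball r0 df.
pose K := 1024 * M / s ^+ 2 * nm v ^+ 2.
have K0 : 0 <= K.
  rewrite /K; apply: mulr_ge0; last exact: exprn_ge0 (nm_ge0 _).
  by apply: divr_ge0; [apply: mulr_ge0; [exact: ler0n|]|exact/exprn_ge0/ltW].
have v1 : 0 < nm v + 1 by rewrite ltr_wpDl ?nm_ge0.
pose q := s / (64 * (nm v + 1)).
have q0 : 0 < q by rewrite divr_gt0// mulr_gt0.
pose t n : R := q / n.+1%:R.
have t0 n : 0 < t n by rewrite divr_gt0// ltr0n.
have tq n : t n <= q by rewrite ler_pdivrMr ?ltr0n// ler_peMr ?(ltW q0)// ler1n.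
have tv n : nm ((t n)%:C%C *: v) < s / 32.
  rewrite nmZ nmR gtr0_norm//.
  apply: le_lt_trans (ler_wpM2r (nm_ge0 v) (tq n)) _.
  rewrite /q mulrAC ltr_pdivrMr ?mulr_gt0//.
  rewrite (_ : s / 32 * (64 * (nm v + 1)) = s * (2 * nm v + 2)); last by field.
  by rewrite ltr_pM2l//; have := nm_ge0 v; lra.
apply: (@weierstrass _ _ (fun n y => (t n)%:C%C^-1 * (f (y + (t n)%:C%C *: v) - f y))
  _ x (s / 2)); first by rewrite divr_gt0.
  move=> n y ys; have ys' : nm (y - x) < s by lra.
  have h1 : differentiable (fun y : V => y + (t n)%:C%C *: v) y.
    rewrite -[(t n)%:C%C *: v]opprK; exact: differentiable_subc.
  apply: differentiableM; first exact: differentiable_cst.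
  apply: differentiableB; last by apply: dfs ys' _ _; rewrite subrr nm0.
  apply: (differentiable_comp h1); apply: dfs ys' _ _.
  by rewrite addrC addKr; have := tv n; lra.
move=> e e0; have [N HN] := harmonic_le (mulr_ge0 K0 (ltW q0)) e0.
exists N => n y Nn ys; have ys' : nm (y - x) < s by lra.
have tn0 : (t n)%:C%C != 0 :> C by rewrite (inj_eq (@complexI R) _ 0) gt_eqF.
have := taylor_le s_gt0 (dfs y ys') (FM y ys') (tv n).
rewrite linearZ /= nmZ nmR gtr0_norm// => H.
have -> : (t n)%:C%C^-1 * (f (y + (t n)%:C%C *: v) - f y) - 'd f y v =
   (t n)%:C%C^-1 * (f (y + (t n)%:C%C *: v) - f y - (t n)%:C%C * 'd f y v).
  by field.
rewrite nmM nmV nmR gtr0_norm// ler_pdivrMl//.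
apply: le_trans H _; have := ler_wpM2l (ltW (t0 n)) (HN n Nn); apply: le_trans.
have -> : K * q / n.+1%:R = K * t n by exact: (esym (mulrA _ _ _)).
rewrite /K; move: (1024 * M / s ^+ 2) => A.
by rewrite le_eqVlt; apply/orP; left; apply/eqP; ring.
Qed.

Variables (e : V) (l : {linear V -> C}).
Hypothesis e1 : nm e <= 1.
Hypothesis l1 : forall x, nm (l x) <= nm x.
Hypothesis le1 : l e = 1.

(** The homotopy from the projection along e onto the kernel of l, at t = 0, to the
identity, at t = 1. *)
Definition sect (t : R) x : V := x - ((1 - t)%:C%C * l x) *: e.
Local Notation Z := (sect 0).

Lemma sect_fix t x : l x = 0 -> sect t x = x.
Proof. by move=> lx; rewrite /sect lx mulr0 scale0r subr0. Qed.

Lemma sect_sub t x x0 : l x0 = 0 -> 0 <= t <= 1 ->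
  nm (sect t x - x0) <= 2 * nm (x - x0).
Proof.
move=> lx0 t01.
have -> : sect t x - x0 = (x - x0) - ((1 - t)%:C%C * l (x - x0)) *: e.
  by rewrite linearB lx0 subr0 addrAC.
apply: le_trans (nmB _ _) _; rewrite mulr_natl mulr2n lerD2l nmZ nmM nmR.
have h := l1 (x - x0).
apply: le_trans (ler_piMr _ e1) _; first by rewrite mulr_ge0// nm_ge0.
apply: le_trans h; rewrite ler_piMl ?nm_ge0// ger0_norm; lra.
Qed.

Lemma differentiable_l x : differentiable l x.
Proof.
apply: linear_differentiable => y; apply/continuous_nm => d d0.
by exists d => // z; apply: le_lt_trans; rewrite -linearB.
Qed.

Lemma differentiable_sect t x : differentiable (sect t) x.
Proof.
apply: differentiableB; first exact: (@ex_diff _ _ _ _ _ _ _ (is_diff_id x)).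
apply: differentiableZl; apply: differentiableM; first exact: differentiable_cst.
exact: differentiable_l.
Qed.

(** The quotient of f - f (sect 0) by l; both vanish on the kernel of l, where the
quotient is the derivative along e. *)
Definition hdiv f x : C := if l x == 0 then 'd f x e else (f x - f (Z x)) / l x.

Lemma hdivE f x : l x * hdiv f x = f x - f (Z x).
Proof.
rewrite /hdiv; case: eqP => [lx|/eqP lx]; first by rewrite sect_fix// lx mul0r subrr.
by rewrite mulrC divfK.
Qed.

Lemma hdiv_out f x : l x != 0 -> differentiable f x -> differentiable f (Z x) ->
  differentiable (hdiv f) x.
Proof.
move=> lx dx dZ.
have /continuous_nm/(_ (nm (l x))) := differentiable_continuous (differentiable_l x).
rewrite nm_gt0 => /(_ lx)[d d0 H].
have fE y : nm (x - y) < d -> (f y - f (Z y)) / l y = hdiv f y.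
  move=> /H; rewrite /hdiv; case: eqVneq => // ->; by rewrite subr0 ltxx.
apply: (proj1 (differentiable_near_eq d0 fE _)).
apply: differentiableM.
  apply: differentiableB => //.
  exact: (differentiable_comp (differentiable_sect 0 x) dZ).
by apply: differentiableV => //; exact: differentiable_l.
Qed.

(** Near the kernel of l, the quotient is the mean over t of the derivative of f
along e at the points sect t x.  Riemann sums of this mean are differentiable, and
converge uniformly by the bound on second order remainders. *)
Lemma hdiv_in f x r : 0 < r -> l x = 0 ->
  (forall y, nm (y - x) < r -> differentiable f y) ->
  differentiable (hdiv f) x.
Proof.
move=> r0 lx df.
have [s s_gt0 [M [M0 dfs FM]]] := doubled_ball r0 df.
pose K := 1024 * M / s ^+ 2.
have K0 : 0 <= K.
  by apply: divr_ge0; [apply: mulr_ge0; [exact: ler0n|]|exact/exprn_ge0/ltW].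
pose D y : C := 'd f y e.
have dD y : nm (y - x) < s -> differentiable D y.
  by move=> ys; exact: (@differentiable_diff f y s e s_gt0 (dfs y ys)).
pose p n k : R := k%:R / n.+1%:R.
have p01 n k : (k <= n.+1)%N -> 0 <= p n k <= 1.
  by move=> kn; rewrite /p divr_ge0 ?ler0n//= ler_pdivrMr ?ltr0n// mul1r ler_nat.
pose A n y : C := n.+1%:R^-1 * \sum_(k < n.+1) D (sect (p n k) y).
apply: (@weierstrass _ _ A _ x (s / 64)); first by rewrite divr_gt0.
  move=> n y ys; apply: differentiableM; first exact: differentiable_cst.
  rewrite (_ : (fun y => _) = \sum_(k < n.+1) (fun y => D (sect (p n k) y))); last first.
    by apply/funext => z; rewrite fct_sumE.
  apply: differentiable_sum => k.
  apply: (differentiable_comp (differentiable_sect (p n k) y)).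
  apply: dD; apply: le_lt_trans (sect_sub _ lx _) _; first by apply/p01/ltnW.
  lra.
move=> d d0; have [N HN] := harmonic_le (mulr_ge0 K0 (ltW s_gt0)) d0.
exists N => n y Nn ys; apply: le_trans (HN n Nn).
have nn0 : n.+1%:R != 0 :> R by rewrite pnatr_eq0.
have nn0C : n.+1%:R != 0 :> C by rewrite pnatr_eq0.
have ly : nm (l y) <= s / 64.
  by rewrite -[l y]subr0 -lx -linearB; apply: le_trans (l1 _) (ltW ys).
have [ly0|ly0] := eqVneq (l y) 0.
  have -> : A n y = hdiv f y.
    rewrite /hdiv ly0 eqxx /A (eq_bigr (fun=> D y)); last first.
      by move=> k _; rewrite sect_fix.
    by rewrite sumr_const card_ord -(mulr_natl (D y)) mulrA mulVf// mul1r.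
  by rewrite subrr nm0 divr_ge0 ?ler0n// mulr_ge0// ltW.
have lyp : 0 < nm (l y) by rewrite nm_gt0.
have step k : (k < n.+1)%N -> nm (f (sect (p n k.+1) y) - f (sect (p n k) y)
     - (l y / n.+1%:R) * D (sect (p n k) y)) <= K * (nm (l y) / n.+1%:R) ^+ 2.
  move=> kn; set z := sect (p n k) y.
  have zs : nm (z - x) < s.
    apply: le_lt_trans (sect_sub _ lx _) _; first by apply/p01/ltnW.
    lra.
  have zE : sect (p n k.+1) y = z + (l y / n.+1%:R) *: e.
    have E : (1 - p n k.+1)%:C%C * l y = (1 - p n k)%:C%C * l y - l y / n.+1%:R.
      by rewrite /p !rmorphB !fmorph_div !rmorph_nat /= -(natr1 k); field.
    by rewrite /z /sect E scalerBl opprD opprK addrA.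
  have nle : nm ((l y / n.+1%:R) *: e) <= nm (l y) / n.+1%:R.
    rewrite nmZ nmM nmV nm_nat ler_piMr// divr_ge0 ?ler0n//; exact: nm_ge0.
  have vs : nm ((l y / n.+1%:R) *: e) < s / 32.
    apply: le_lt_trans nle _; rewrite ltr_pdivrMr ?ltr0n//.
    apply: le_lt_trans ly _.
    have n1 : 1 <= n.+1%:R :> R by rewrite ler1n.
    by have := ler_wpM2l (ltW s_gt0) n1; have := s_gt0; lra.
  have := taylor_le s_gt0 (dfs z zs) (FM z zs) vs.
  rewrite -zE linearZ /= -/(D z) => /le_trans; apply.
  rewrite -/K ler_wpM2l// lerXn2r ?nnegrE ?nm_ge0//.
  by rewrite divr_ge0 ?ler0n//; exact: nm_ge0.
have lE : l y * (hdiv f y - A n y) = \sum_(k < n.+1) (f (sect (p n k.+1) y) -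
    f (sect (p n k) y) - (l y / n.+1%:R) * D (sect (p n k) y)).
  rewrite sumrB -mulr_sumr mulrBr hdivE /A mulrA; congr (_ - _).
  rewrite -(big_mkord xpredT (fun k => f (sect (p n k.+1) y) - f (sect (p n k) y))).
  rewrite (telescope_sumr (fun k => f (sect (p n k) y))) //.
  rewrite /p mul0r divff// (_ : sect 1 y = y) //.
  by rewrite /sect subrr mul0r scale0r subr0.
rewrite nmBC -(ler_pM2l lyp) -nmM lE.
apply: le_trans (nm_sum _ _) _.
apply: (@le_trans _ _ (\sum_(k < n.+1) K * (nm (l y) / n.+1%:R) ^+ 2)).
  by apply: ler_sum => k _; exact: step.
rewrite sumr_const card_ord -(mulr_natl (K * _)).
rewrite (_ : _ * (K * _) = nm (l y) * (K * nm (l y) / n.+1%:R)); last by field.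
rewrite ler_pM2l// ler_pM2r ?invr_gt0 ?ltr0n// ler_wpM2l//.
by apply: le_trans ly _; rewrite ler_pdivrMr// ler_peMr// ?ltW//; lra.
Qed.

(** Division is continuous in f for uniform convergence, at the cost of shrinking
the ball. *)
Lemma hdivB_bound f g x0 r M : 0 < r -> l x0 = 0 ->
  (forall y, nm (y - x0) < r -> differentiable f y) ->
  (forall y, nm (y - x0) < r -> differentiable g y) ->
  (forall y, nm (y - x0) < r -> nm (f y - g y) <= M) ->
  forall y, nm (y - x0) < r / 64 -> nm (hdiv f y - hdiv g y) <= 64 * M / r.
Proof.
move=> r0 lx0 df dg fgM y yr.
have r2 : 0 < r / 2 by rewrite divr_gt0.
have M0 : 0 <= M.
  by apply: le_trans (nm_ge0 _) (fgM x0 _); rewrite subrr nm0.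
have i01 : 0 <= (0 : R) <= 1 by rewrite lexx ler01.
have Zr : nm (Z y - x0) < r / 2.
  by apply: le_lt_trans (sect_sub y lx0 i01) _; lra.
have in_r z : nm (z - Z y) < r / 2 -> nm (z - x0) < r.
  by move=> zz; apply: le_lt_trans (nm_tri (Z y) _ _) _; lra.
have cE : 32 * M / (r / 2) = 64 * M / r by field; rewrite gt_eqF.
have [ly|ly] := eqVneq (l y) 0.
  rewrite /hdiv ly eqxx.
  have yZ : Z y = y by rewrite sect_fix.
  rewrite yZ in in_r.
  have := diffB_bound r2 (fun z h => df z (in_r z h)) (fun z h => dg z (in_r z h))
     (fun z h => fgM z (in_r z h)) e.
  rewrite cE => /le_trans; apply; rewrite ler_piMr// divr_ge0 ?(ltW r0)//.
  by rewrite mulr_ge0.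
rewrite /hdiv (negbTE ly) -mulrBl nmM nmV ler_pdivrMr ?nm_gt0//.
have dh z : nm (z - Z y) < r / 2 -> differentiable (fun w => f w - g w) z.
  by move=> /in_r h; apply: differentiableB; [exact: df|exact: dg].
have yE : y = Z y + l y *: e by rewrite /sect subr0 mul1r subrK.
have ve : nm (l y *: e) <= nm (l y) by rewrite nmZ ler_piMr// nm_ge0.
have vs : nm (l y *: e) < r / 2 / 16.
  apply: le_lt_trans ve _.
  by rewrite -[l y]subr0 -lx0 -linearB; apply: le_lt_trans (l1 _) _; lra.
have := lip_bound r2 dh (fun z h => fgM z (in_r z h)) vs.
rewrite -yE cE => H.
have -> : f y - f (Z y) - (g y - g (Z y)) = f y - g y - (f (Z y) - g (Z y)) by ring.
apply: le_trans H _; rewrite ler_wpM2l// divr_ge0 ?(ltW r0)//.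
by rewrite mulr_ge0.
Qed.

End Division.

(** * Uniformly Cauchy families of holomorphic functions *)

Section UniformCauchy.
Variable R : realType.
Local Notation C := (R[i]).
Variable V : normedModType C.
Implicit Types (F G : nat -> V -> C) (f : V -> C) (x y : V) (r M : R).

(** The radius does not depend on n: this is what yields one neighbourhood for all
terms of the sequence. *)
Definition hcauchy x0 F := exists2 r : R, 0 < r &
  (forall n y, nm (y - x0) < r -> differentiable (F n) y) /\
  (forall e : R, 0 < e -> exists N, forall m n y, (N <= m)%N -> (N <= n)%N ->
     nm (y - x0) < r -> nm (F m y - F n y) <= e).

Lemma hcauchy_at x0 F : hcauchy x0 F -> cseq (fun n => F n x0).
Proof.
move=> [r r0 [_ H]] e /H[N HN]; exists N => m n Nm Nn; apply: HN => //.
by rewrite subrr nm0.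
Qed.

Lemma hcauchy_near x0 F : hcauchy x0 F -> exists2 r : R, 0 < r &
  forall x, nm (x - x0) < r -> hcauchy x F.
Proof.
move=> [r r0 [dF uF]]; exists (r / 2) => [|x xr]; first by rewrite divr_gt0.
have in_r y : nm (y - x) < r / 2 -> nm (y - x0) < r.
  by move=> yx; apply: le_lt_trans (nm_tri x _ _) _; lra.
exists (r / 2); first by rewrite divr_gt0.
split => [n y /in_r|e /uF[N HN]]; first exact: dF.
by exists N => m n y Nm Nn /in_r; exact: HN.
Qed.

Lemma hcauchy_shrink x0 F r0 : hcauchy x0 F -> 0 < r0 -> exists2 r : R, 0 < r &
  [/\ r <= r0, (forall n y, nm (y - x0) < r -> differentiable (F n) y) &
  (forall e : R, 0 < e -> exists N, forall m n y, (N <= m)%N -> (N <= n)%N ->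
     nm (y - x0) < r -> nm (F m y - F n y) <= e)].
Proof.
move=> [r rp [dF uF]] r00; exists (Num.min r r0); first by rewrite lt_min rp.
have in_r y : nm (y - x0) < Num.min r r0 -> nm (y - x0) < r.
  by rewrite lt_min => /andP[].
split=> [|n y /in_r|e /uF[N HN]]; first by rewrite ge_min lexx orbT.
  exact: dF.
by exists N => m n y Nm Nn /in_r; exact: HN.
Qed.

Lemma hcauchy_const x0 f r : 0 < r ->
  (forall y, nm (y - x0) < r -> differentiable f y) -> hcauchy x0 (fun=> f).
Proof.
move=> r0 df; exists r; first exact: r0.
split=> [_ y|e e0]; first exact: df.
by exists 0%N => m n y _ _ _; rewrite subrr nm0 ltW.
Qed.

Lemma hcauchy_seq x0 (c : nat -> C) : cseq c -> hcauchy x0 (fun n _ => c n).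
Proof.
move=> cc; exists 1; first exact: ltr01.
split=> [n y _|e /cc[N HN]].
  exact: differentiable_cst.
by exists N => m n y Nm Nn _; exact: HN.
Qed.

Lemma cseq_cst (c : C) : cseq (fun=> c).
Proof. by move=> e e0; exists 0%N => m n _ _; rewrite subrr nm0 ltW. Qed.

Lemma hcauchy_cst x0 (c : C) : hcauchy x0 (fun _ _ => c).
Proof. exact: hcauchy_seq (cseq_cst c). Qed.

Lemma hcauchyD x0 F G : hcauchy x0 F -> hcauchy x0 G ->
  hcauchy x0 (fun n y => F n y + G n y).
Proof.
move=> [r1 r10 [dF uF]] /hcauchy_shrink/(_ r10)[r r0 [rr dG uG]].
have in_r y : nm (y - x0) < r -> nm (y - x0) < r1 by move=> yr; exact: lt_le_trans rr.
exists r; first exact: r0.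
split=> [n y yr|e e0].
  by apply: differentiableD; [apply: dF; exact: in_r|exact: dG].
have e2 : 0 < e / 2 by rewrite divr_gt0.
have [N1 H1] := uF _ e2; have [N2 H2] := uG _ e2.
exists (maxn N1 N2) => m n y; rewrite !geq_max => /andP[m1 m2] /andP[n1 n2] yr.
have h1 := H1 m n y m1 n1 (in_r y yr); have h2 := H2 m n y m2 n2 yr.
have -> : F m y + G m y - (F n y + G n y) = (F m y - F n y) + (G m y - G n y) by ring.
apply: le_trans (nmD _ _) _; move: (nm _) (nm _) h1 h2 => *; lra.
Qed.

Lemma hcauchy_bounded x0 F : hcauchy x0 F -> exists2 r : R, 0 < r &
  exists M N, 0 < M /\ forall n y, (N <= n)%N -> nm (y - x0) < r -> nm (F n y) <= M.
Proof.
move=> [r r0 [dF uF]]; have [N HN] := uF 1 ltr01.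
have [|s s0 [M HM]] := @loc_bounded _ _ (F N) x0; first by apply: dF; rewrite subrr nm0.
exists (Num.min r s); first by rewrite lt_min r0.
have M0 : 0 <= M by apply: le_trans (nm_ge0 _) (HM x0 _); rewrite subrr nm0.
exists (M + 1), N; split; first by rewrite ltr_wpDl.
move=> n y Nn; rewrite lt_min => /andP[/HN + /HM].
move=> /(_ n N Nn (leqnn _)); have := nmD (F n y - F N y) (F N y); rewrite subrK.
move: (nm _) (nm _) (nm _) => a b c *; lra.
Qed.

Lemma hcauchyM x0 F G : hcauchy x0 F -> hcauchy x0 G ->
  hcauchy x0 (fun n y => F n y * G n y).
Proof.
move=> hF hG.
have [rF rF0 [MF [NF [MF0 bF]]]] := hcauchy_bounded hF.
have [rG rG0 [MG [NG [MG0 bG]]]] := hcauchy_bounded hG.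
have [r1 r10 [rr1 dF uF]] := hcauchy_shrink hF rF0.
have [r2 r20 [rr2 dG uG]] := hcauchy_shrink hG rG0.
exists (Num.min r1 r2); first by rewrite lt_min r10.
split=> [n y|e e0].
  by rewrite lt_min => /andP[y1 y2]; apply: differentiableM; [exact: dF|exact: dG].
have eG : 0 < e / 2 / MG by rewrite !divr_gt0.
have eF : 0 < e / 2 / MF by rewrite !divr_gt0.
have [N1 H1] := uF _ eG; have [N2 H2] := uG _ eF.
exists (maxn (maxn N1 N2) (maxn NF NG)) => m n y.
rewrite !geq_max => /andP[/andP[m1 m2] /andP[m3 m4]] /andP[/andP[n1 n2] /andP[n3 n4]].
rewrite lt_min => /andP[y1 y2].
have -> : F m y * G m y - F n y * G n y =
  (F m y - F n y) * G m y + F n y * (G m y - G n y) by ring.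
apply: le_trans (nmD _ _) _; rewrite !nmM.
have -> : e = e / 2 / MG * MG + MF * (e / 2 / MF) by field; rewrite !gt_eqF.
apply: lerD; apply: ler_pM; rewrite ?nm_ge0//.
- exact: H1.
- by apply: bG => //; exact: lt_le_trans rr2.
- by apply: bF => //; exact: lt_le_trans rr1.
- exact: H2.
Qed.

Lemma hcauchyZ x0 (c : C) F : hcauchy x0 F -> hcauchy x0 (fun n y => c * F n y).
Proof. by move=> hF; apply: hcauchyM => //; exact: hcauchy_cst. Qed.

Lemma hcauchyN x0 F : hcauchy x0 F -> hcauchy x0 (fun n y => - F n y).
Proof.
move=> /(@hcauchyZ _ (-1)).
by under eq_fun do under eq_fun do rewrite mulN1r.
Qed.

Lemma hcauchyB x0 F G : hcauchy x0 F -> hcauchy x0 G ->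
  hcauchy x0 (fun n y => F n y - G n y).
Proof. by move=> hF /hcauchyN; exact: hcauchyD. Qed.

Lemma hcauchy_comp x0 (p : V -> V) (K : R) F : 0 < K ->
  (forall y, nm (p y - x0) <= K * nm (y - x0)) ->
  (forall y, differentiable p y) ->
  hcauchy x0 F -> hcauchy x0 (fun n y => F n (p y)).
Proof.
move=> K0 pK dp [r r0 [dF uF]]; exists (r / K); first by rewrite divr_gt0.
have in_r y : nm (y - x0) < r / K -> nm (p y - x0) < r.
  by rewrite ltr_pdivlMr// mulrC; exact: le_lt_trans.
split=> [n y /in_r yr|e /uF[N HN]].
  exact: (differentiable_comp (dp y) (dF n _ yr)).
by exists N => m n y Nm Nn /in_r; exact: HN.
Qed.

Lemma hcauchyV x0 F (c : R) r : 0 < c -> 0 < r ->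
  (forall n y, nm (y - x0) < r -> c <= nm (F n y)) ->
  hcauchy x0 F -> hcauchy x0 (fun n y => (F n y)^-1).
Proof.
move=> c0 rp Fc /hcauchy_shrink/(_ rp)[s s0 [sr dF uF]]; exists s => //.
have {}Fc n y : nm (y - x0) < s -> c <= nm (F n y).
  by move=> ys; apply: Fc; exact: lt_le_trans sr.
have F0 n y : nm (y - x0) < s -> F n y != 0.
  by move=> /(Fc n); rewrite -nm_gt0; exact: lt_le_trans.
split=> [n y ys|e e0]; first by apply: differentiableV; [exact: dF|exact: F0].
have ec : 0 < e * c ^+ 2 by rewrite mulr_gt0// exprn_gt0.
have [N HN] := uF _ ec; exists N => m n y Nm Nn ys.
have Fm := F0 m y ys; have Fn := F0 n y ys.
have -> : (F m y)^-1 - (F n y)^-1 = (F n y - F m y) * ((F m y)^-1 * (F n y)^-1).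
  by field; rewrite Fm Fn.
rewrite !nmM !nmV -[_^-1 * _^-1]invfM ler_pdivrMr ?mulr_gt0 ?nm_gt0//.
apply: le_trans (HN n m y Nn Nm ys) _; rewrite ler_wpM2l ?(ltW e0)// expr2.
by apply: ler_pM; rewrite ?(ltW c0)// Fc.
Qed.

Lemma hcauchy_eventually x0 F G r N : 0 < r ->
  (forall n y, nm (y - x0) < r -> differentiable (F n) y) ->
  (forall n y, (N <= n)%N -> nm (y - x0) < r -> F n y = G n y) ->
  hcauchy x0 G -> hcauchy x0 F.
Proof.
move=> r0 dF FG /hcauchy_shrink/(_ r0)[s s0 [sr dG uG]].
have in_r y : nm (y - x0) < s -> nm (y - x0) < r by move=> ys; exact: lt_le_trans sr.
exists s; first exact: s0.
split=> [n y /in_r|e /uG[N' HN]]; first exact: dF.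
exists (maxn N N') => m n y; rewrite !geq_max => /andP[m1 m2] /andP[n1 n2] ys.
by rewrite !FG ?in_r//; exact: HN.
Qed.

(** Bounds that only hold from rank N on become uniform after this reindexing. *)
Lemma hcauchy_max x0 F N : hcauchy x0 F -> hcauchy x0 (fun n => F (maxn n N)).
Proof.
move=> [r r0 [dF uF]]; exists r; first exact: r0.
split=> [n y|e /uF[N' HN]]; first exact: dF.
by exists N' => m n y Nm Nn; apply: HN; rewrite leq_max ?Nm ?Nn.
Qed.

Lemma common_radius (P : nat -> R -> Prop) N :
  (forall n r s, s <= r -> P n r -> P n s) ->
  (forall n, exists2 r : R, 0 < r & P n r) ->
  exists2 r : R, 0 < r & forall n, (n < N)%N -> P n r.
Proof.
move=> mono H; elim: N => [|N [r r0 IH]]; first by exists 1.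
have [s s0 Ps] := H N; exists (Num.min r s) => [|n]; first by rewrite lt_min r0.
rewrite ltnS leq_eqVlt => /predU1P[->|/IH Pr].
  by apply: (mono N s) => //; rewrite ge_min lexx orbT.
by apply: (mono n r) => //; rewrite ge_min lexx.
Qed.

(** The tail of the sequence is controlled by one of its terms, and the finitely
many others by their continuity. *)
Lemma hcauchy_near1 x0 F (e : R) : 0 < e -> hcauchy x0 F ->
  (forall n, F n x0 = 1) ->
  exists2 r : R, 0 < r & forall n y, nm (y - x0) < r -> nm (F n y - 1) <= e.
Proof.
move=> e0 [r r0 [dF uF]] F1; have e2 : 0 < e / 2 by rewrite divr_gt0.
have [N HN] := uF _ e2.
have [||s s0 Hs] := @common_radius (fun n r => forall y, nm (y - x0) < r ->
    nm (F n y - 1) <= e / 2) N.+1.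
- by move=> n r1 s1 sr H y ys; apply: H; exact: lt_le_trans sr.
- move=> n; have dn : differentiable (F n) x0 by apply: dF; rewrite subrr nm0.
  have /continuous_nm/(_ _ e2)[d d0 Hd] := differentiable_continuous dn.
  by exists d => // y; rewrite nmBC => /Hd/ltW; rewrite F1 nmBC.
exists (Num.min r s) => [|n y]; first by rewrite lt_min r0.
rewrite lt_min => /andP[yr ys]; have [Nn|nN] := leqP N n.
  apply: le_trans (nm_tri (F N y) _ _) _.
  have := HN n N y Nn (leqnn _) yr; have := Hs N (ltnSn _) y ys.
  move: (nm _) (nm _) => *; lra.
by have := Hs n (leqW nN) y ys; move: (nm _) => *; lra.
Qed.

End UniformCauchy.

(** * Square roots near one, limits *)

Lemma continuous_invD (K : numFieldType) (g : K -> K) x a :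
  {for x, continuous g} -> g x + a != 0 ->
  {for x, continuous (fun y => (g y + a)^-1)}.
Proof.
move=> gc ga.
have ca : {for x, continuous (fun=> a : K)} by exact: cst_continuous.
have h1 : {for x, continuous (fun y => g y + a)} by exact: continuousD gc ca.
exact: (@continuousV K K (fun y => g y + a) x ga h1).
Qed.

Section SquareRoot.
Variable R : realType.
Local Notation C := (R[i]).
Implicit Types z w s : C.

Lemma Re_sqrtc_ge0 z : 0 <= complex.Re (sqrtc z).
Proof. by case: z => a b /=; exact: sqrtr_ge0. Qed.

(** s^2 - 1 = (s - 1) (s + 1), and |s + 1| >= 1 in the right half plane. *)
Lemma root_near1 s (e : R) : 0 <= complex.Re s -> nm (s ^+ 2 - 1) <= e -> nm (s - 1) <= e.
Proof.
move=> s0; have -> : s ^+ 2 - 1 = (s - 1) * (s + 1) by ring.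
rewrite nmM; apply: le_trans; rewrite ler_peMr ?nm_ge0//.
apply: le_trans (Re_nm _); apply: le_trans (ler_norm _).
by rewrite raddfD /= lerDr.
Qed.

Lemma root_Re s (e : R) : 0 <= complex.Re s -> nm (s ^+ 2 - 1) <= e ->
  1 - e <= complex.Re s.
Proof.
move=> s0 /(root_near1 s0) h; have := le_trans (Re_nm _) h.
by rewrite raddfB /= ler_norml; lra.
Qed.

Lemma sqrtc_lip z w : nm (z - 1) <= 3 / 4 -> nm (w - 1) <= 3 / 4 ->
  2^-1 <= nm (sqrtc z + sqrtc w) /\ nm (sqrtc z - sqrtc w) <= 2 * nm (z - w).
Proof.
rewrite -{1}(sqr_sqrtc z) -{1}(sqr_sqrtc w) => hz hw.
have rz := root_Re (Re_sqrtc_ge0 z) hz; have rw := root_Re (Re_sqrtc_ge0 w) hw.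
have h : 2^-1 <= nm (sqrtc z + sqrtc w).
  apply: le_trans (Re_nm _); apply: le_trans (ler_norm _).
  by rewrite raddfD /=; lra.
split=> //; rewrite -{2}(sqr_sqrtc z) -{2}(sqr_sqrtc w) subr_sqr nmM.
by have := ler_wpM2l (nm_ge0 (sqrtc z - sqrtc w)) h; lra.
Qed.

(** sqrt w - sqrt z = (w - z) / (sqrt w + sqrt z), a product of a differentiable
function vanishing at z and a continuous one. *)
Lemma differentiable_sqrtc z : nm (z - 1) <= 2^-1 -> differentiable (@sqrtc R) z.
Proof.
move=> z1; have near w : nm (z - w) < 4^-1 -> nm (w - 1) <= 3 / 4.
  by move=> zw; have := nm_tri z w 1; rewrite (nmBC w z); lra.
have z3 : nm (z - 1) <= 3 / 4 by lra.
have sc : {for z, continuous (@sqrtc R)}.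
  apply/continuous_nm => e e0; exists (Num.min 4^-1 (e / 2)) => [|w].
    by rewrite lt_min; apply/andP; split; lra.
  rewrite lt_min => /andP[/near/(sqrtc_lip z3)[_ h] h2].
  by apply: le_lt_trans h _; lra.
have sz : sqrtc z + sqrtc z != 0.
  by rewrite -nm_gt0; have [h _] := sqrtc_lip z3 z3; lra.
have gc := continuous_invD sc sz.
pose g w : C := (sqrtc w + sqrtc z)^-1.
have E w : nm (z - w) < 4^-1 -> (w - z) * g w + sqrtc z = sqrtc w.
  move=> /near/sqrtc_lip/(_ z3)[h _]; rewrite /g.
  have n0 : sqrtc w + sqrtc z != 0 by rewrite -nm_gt0; lra.
  rewrite -{1}(sqr_sqrtc w) -{1}(sqr_sqrtc z) subr_sqr -mulrA mulfV//.
  by rewrite mulr1 subrK.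
have q0 : 0 < 4^-1 :> R by rewrite invr_gt0.
apply: (proj1 (differentiable_near_eq q0 E _)).
apply: differentiableD; last exact: differentiable_cst.
apply: differentiable_mul0; [exact: differentiable_subc|exact: subrr|exact: gc].
Qed.

Variable V : normedModType C.

Lemma hcauchy_sqrtc (F : nat -> V -> C) (x0 : V) r : 0 < r ->
  (forall n y, nm (y - x0) < r -> nm (F n y - 1) <= 2^-1) ->
  hcauchy x0 F -> hcauchy x0 (fun n y => sqrtc (F n y)).
Proof.
move=> r0 F1 /hcauchy_shrink/(_ r0)[s s0 [sr dF uF]].
have {}F1 n y : nm (y - x0) < s -> nm (F n y - 1) <= 2^-1.
  by move=> ys; apply: F1; exact: lt_le_trans sr.
exists s; first exact: s0.
split=> [n y ys|e e0].
  exact: (differentiable_comp (dF n y ys) (differentiable_sqrtc (F1 n y ys))).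
have e2 : 0 < e / 2 by rewrite divr_gt0.
have [N HN] := uF _ e2; exists N => m n y Nm Nn ys.
have h : 2^-1 <= 3 / 4 :> R by lra.
have [_ H] := sqrtc_lip (le_trans (F1 m y ys) h) (le_trans (F1 n y ys) h).
by apply: le_trans H _; have := HN m n y Nm Nn ys; lra.
Qed.

Lemma sqrtc_ge z : nm (z - 1) <= 2^-1 -> 2^-1 <= nm (sqrtc z).
Proof.
rewrite -{1}(sqr_sqrtc z) => h.
apply: le_trans (Re_nm _); apply: le_trans (ler_norm _).
by have := root_Re (Re_sqrtc_ge0 z) h; lra.
Qed.

End SquareRoot.

Section HcauchyLimit.
Variable R : realType.
Local Notation C := (R[i]).
Variable V : normedModType C.
Implicit Types (F : nat -> V -> C) (x y : V).

Lemma cseq_lim (u : nat -> C) : cseq u -> u @ \oo --> lim (u @ \oo).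
Proof. by move=> /complex_complete[l /cvgP]. Qed.

Definition hlim F y : C := lim ((fun n => F n y) @ \oo).

Lemma hcauchy_lim x0 F : hcauchy x0 F -> exists2 r : R, 0 < r &
  (forall y, nm (y - x0) < r -> differentiable (hlim F) y) /\
  (forall e : R, 0 < e -> exists N, forall n y, (N <= n)%N ->
     nm (y - x0) < r -> nm (F n y - hlim F y) <= e).
Proof.
move=> [r r0 [dF uF]].
have cF y : nm (y - x0) < r -> (fun n => F n y) @ \oo --> hlim F y.
  move=> yr; apply: cseq_lim => e /uF[N HN]; exists N => m n Nm Nn.
  exact: HN.
have uL : forall e : R, 0 < e -> exists N, forall n y, (N <= n)%N ->
     nm (y - x0) < r -> nm (F n y - hlim F y) <= e.
  move=> e /uF[N HN]; exists N => n y Nn yr.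
  rewrite nmBC; apply: (@limit_le _ _ _ _ _ N (cF y yr)) => m Nm.
  exact: HN.
exists (r / 2); first by rewrite divr_gt0.
split=> [y yr|e /uL[N HN]]; last first.
  by exists N => n y Nn yr; apply: HN => //; lra.
have r2 : 0 < r / 2 by rewrite divr_gt0.
have in_r z : nm (z - y) < r / 2 -> nm (z - x0) < r.
  by move=> zy; apply: le_lt_trans (nm_tri y _ _) _; lra.
apply: (@weierstrass _ _ F _ y (r / 2) r2) => [n z /in_r|e /uL[N HN]].
  exact: dF.
by exists N => n z Nn /in_r; exact: HN.
Qed.

Variables (e : V) (l : {linear V -> C}).
Hypothesis e1 : nm e <= 1.
Hypothesis l1 : forall x, nm (l x) <= nm x.

Lemma hdiv_ball x0 r f : l x0 = 0 -> 0 < r ->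
  (forall y, nm (y - x0) < r -> differentiable f y) ->
  forall y, nm (y - x0) < r / 2 -> differentiable (hdiv e l f) y.
Proof.
move=> lx0 r0 df y yr; have [ly|ly] := eqVneq (l y) 0.
  have r2 : 0 < r / 2 by rewrite divr_gt0.
  apply: (hdiv_in e1 l1 r2 ly) => z zy; apply: df.
  by apply: le_lt_trans (nm_tri y _ _) _; lra.
apply: (hdiv_out l1 ly); [by apply: df; lra|apply: df].
have i01 : 0 <= (0 : R) <= 1 by rewrite lexx ler01.
by apply: le_lt_trans (sect_sub e1 l1 y lx0 i01) _; lra.
Qed.

Lemma hcauchy_hdiv x0 F : l x0 = 0 -> hcauchy x0 F ->
  hcauchy x0 (fun n => hdiv e l (F n)).
Proof.
move=> lx0 [r r0 [dF uF]]; exists (r / 64); first by rewrite divr_gt0.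
split=> [n y yr|d d0].
  by apply: (hdiv_ball lx0 r0 (dF n)); lra.
have d64 : 0 < d * r / 64 by rewrite divr_gt0// mulr_gt0.
have [N HN] := uF _ d64; exists N => m n y Nm Nn yr.
have := hdivB_bound e1 l1 r0 lx0 (dF m) (dF n)
  (fun z zr => HN m n z Nm Nn zr) yr.
by rewrite (_ : 64 * (d * r / 64) / r = d)//; field; rewrite gt_eqF.
Qed.

End HcauchyLimit.

(** * Matrices of size two *)

Section Mat2.
Variable R : realType.
Local Notation C := (R[i]).
Local Notation M2 := 'M[C]_2.

Lemma nm_mx (x : M2) (r : R) : 0 < r ->
  (nm x < r <-> forall i j, nm (x i j) < r).
Proof.
move=> r0; have H : ball (0 : M2) r%:C%C x <-> nm x < r.
  by rewrite ballnm /= sub0r nmN.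
rewrite -H; split=> [[_ h] i j|h].
  by have := h i j; rewrite ballnm /= mxE sub0r nmN.
split; first by rewrite ltcR.
by move=> i j; rewrite ballnm /= mxE sub0r nmN.
Qed.

Lemma nm_mxle (x : M2) (r : R) : 0 <= r -> (forall i j, nm (x i j) <= r) -> nm x <= r.
Proof.
move=> r0 H; apply/ler_addgt0Pr => e e0; apply/ltW/nm_mx => [|i j].
  by rewrite ltr_wpDl.
by apply: le_lt_trans (H i j) _; rewrite ltrDl.
Qed.

Lemma nm_entry (x : M2) i j : nm (x i j) <= nm x.
Proof.
apply/ler_addgt0Pr => e e0; apply/ltW.
have r0 : 0 < nm x + e by rewrite ltr_wpDl ?nm_ge0.
by apply: (proj1 (nm_mx x r0)); rewrite ltrDl.
Qed.

Definition mx2 (a b c d : C) : M2 := \matrix_(i, j)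
  if i == 0 then (if j == 0 then a else b) else (if j == 0 then c else d).

Lemma mx2P (x : M2) : x = mx2 (x 0 0) (x 0 1) (x 1 0) (x 1 1).
Proof.
apply/matrixP => i j; rewrite mxE.
by case: i j => [[|[|//]] i1] [[|[|//]] j1]; congr (x _ _); apply: val_inj.
Qed.

Lemma mx2_ext (x y : M2) : x 0 0 = y 0 0 -> x 0 1 = y 0 1 -> x 1 0 = y 1 0 ->
  x 1 1 = y 1 1 -> x = y.
Proof. by move=> h1 h2 h3 h4; rewrite (mx2P x) (mx2P y) h1 h2 h3 h4. Qed.

Lemma mx2E a b c d : (mx2 a b c d 0 0 = a) * (mx2 a b c d 0 1 = b) *
  (mx2 a b c d 1 0 = c) * (mx2 a b c d 1 1 = d).
Proof. by rewrite !mxE. Qed.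

Lemma mulmx2 (x y : M2) i j : (x *m y) i j = x i 0 * y 0 j + x i 1 * y 1 j.
Proof.
rewrite mxE !big_ord_recl big_ord0 addr0.
by congr (_ * _ + _ * _); congr (_ _ _); apply: val_inj.
Qed.

Lemma det2 (x : M2) : \det x = x 0 0 * x 1 1 - x 0 1 * x 1 0.
Proof.
rewrite (expand_det_row _ 0) !big_ord_recl big_ord0 addr0 /cofactor !det_mx11 !mxE.
rewrite /= expr0 expr1 mul1r mulN1r mulrN.
by congr (_ * _ - _ * _); congr (x _ _); apply: val_inj.
Qed.

Lemma scalar2 (a : C) : ((a%:M : M2) 0 0 = a) * ((a%:M : M2) 0 1 = 0) *
  ((a%:M : M2) 1 0 = 0) * ((a%:M : M2) 1 1 = a).
Proof. by rewrite !mxE /= ?mulr1n ?mulr0n. Qed.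

(** The adjugate, which is polynomial in the entries and defined everywhere; it is the
inverse in determinant one. *)
Definition adj2 (x : M2) : M2 := mx2 (x 1 1) (- x 0 1) (- x 1 0) (x 0 0).

Lemma adj2_inv (x : M2) : \det x = 1 -> invmx x = adj2 x.
Proof.
move=> dx; have ux : x \in unitmx by rewrite unitmxE dx unitr1.
have H : x *m adj2 x = 1%:M.
  rewrite det2 in dx.
  apply: mx2_ext; rewrite mulmx2 !mx2E !scalar2 -?dx; ring.
by rewrite -[adj2 x]mul1mx -(mulVmx ux) -mulmxA H mulmx1.
Qed.

Lemma differentiable_mx2 (V : normedModType C) (f : V -> M2) (x : V) :
  (forall i j, differentiable (fun y => f y i j : C) x) -> differentiable f x.
Proof.
move=> df.
pose D i j : M2 := delta_mx i j.
have -> : f = (fun y => f y 0 0 *: D 0 0 + f y 0 1 *: D 0 1 + f y 1 0 *: D 1 0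
   + f y 1 1 *: D 1 1).
  by apply/funext => y; apply: mx2_ext; rewrite !mxE /= ?mulr1 ?mulr0 ?addr0 ?add0r.
by do 3 ?[apply: differentiableD]; apply: differentiableZl; exact: df.
Qed.

Lemma differentiable_entry (V : normedModType C) (f : V -> M2) (x : V) i j :
  differentiable f x -> differentiable (fun y => f y i j : C) x.
Proof. by move=> df; exact: (differentiable_comp df (differentiable_coord (f x) i j)). Qed.

Definition entry i j (x : M2) : C := x i j.

Fact entry_linear i j : linear (entry i j).
Proof. by move=> a x y; rewrite /entry !mxE. Qed.

HB.instance Definition _ i j :=
  GRing.isLinear.Build C M2 C _ (entry i j) (entry_linear i j).

Definition halfdiff (x : M2) : C := (x 0 0 - x 1 1) / 2.

Fact halfdiff_linear : linear halfdiff.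
Proof.
move=> a x y; rewrite /halfdiff !mxE -[a *: _ in RHS]/(a * _); by field.
Qed.

HB.instance Definition _ :=
  GRing.isLinear.Build C M2 C _ halfdiff halfdiff_linear.

Definition tau (x : M2) : C := (x 0 0 + x 1 1) / 2.
(** The projection onto scalar matrices. *)
Definition ptau (x : M2) : M2 := (tau x)%:M.

Lemma nm_halfdiff x : nm (halfdiff x) <= nm x.
Proof.
rewrite /halfdiff nmM nmV nm_nat ler_pdivrMr//.
apply: le_trans (nmB _ _) _; rewrite mulr_natr mulr2n.
by apply: lerD; exact: nm_entry.
Qed.

Lemma nm_tau x : nm (tau x) <= nm x.
Proof.
rewrite /tau nmM nmV nm_nat ler_pdivrMr//.
apply: le_trans (nmD _ _) _; rewrite mulr_natr mulr2n.
by apply: lerD; exact: nm_entry.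
Qed.

Lemma tau_scalar (a : C) : tau a%:M = a.
Proof. by rewrite /tau !scalar2; field. Qed.

Lemma ptau_scalar (a : C) : ptau a%:M = a%:M.
Proof. by rewrite /ptau tau_scalar. Qed.

Lemma tauB x y : tau (x - y) = tau x - tau y.
Proof. by rewrite /tau !mxE; field. Qed.

Lemma nm_scalar (a : C) : nm (a%:M : M2) <= nm a.
Proof.
apply: nm_mxle (nm_ge0 _) _ => i j; rewrite mxE; case: (i == j) => //=.
by rewrite mulr0n nm0 nm_ge0.
Qed.

Lemma ptau_near (a : C) x : nm (ptau x - a%:M) <= nm (x - a%:M).
Proof.
rewrite /ptau -raddfB /=; apply: le_trans (nm_scalar _) _.
by rewrite -[X in tau x - X]tau_scalar -tauB nm_tau.
Qed.

Lemma differentiable_ptau x : differentiable ptau x.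
Proof.
have dt : differentiable tau x.
  apply: differentiableM; last exact: differentiable_cst.
  by apply: differentiableD; exact: differentiable_coord.
apply: differentiable_mx2 => i j; rewrite /ptau.
have [->|ij] := eqVneq i j.
  rewrite (_ : (fun y => _) = tau) //.
  by apply/funext => y; rewrite mxE eqxx mulr1n.
rewrite (_ : (fun y => _) = cst 0); first exact: differentiable_cst.
by apply/funext => y; rewrite mxE (negbTE ij) mulr0n.
Qed.

Lemma eigenvalue_scalar (a b : C) : eigenvalue (a%:M : M2) b = (b == a).
Proof.
apply/eigenvalueP/eqP => [[v]|->].
  rewrite mul_mx_scalar => /eqP; rewrite -subr_eq0 -scalerBl scaler_eq0 subr_eq0.
  by case/orP => [/eqP-> //|->].
exists (delta_mx 0 0); first by rewrite mul_mx_scalar.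
apply/eqP => /matrixP/(_ 0 0); rewrite !mxE /= => /eqP; exact/negP/oner_neq0.
Qed.

Lemma spectral_radius_scalar (a : C) : spectral_radius (a%:M : M2) = nm a.
Proof.
rewrite /spectral_radius (_ : [set _ | _ in _] = [set nm a]) ?sup1//.
apply/seteqP; split => x /=.
  by move=> [b]; rewrite eigenvalue_scalar => /eqP-> <-.
by move=> ->; exists a; rewrite ?eigenvalue_scalar.
Qed.

Lemma span2_full (v w : 'cV[C]_2) : v 0 0 * w 1 0 - v 1 0 * w 0 0 != 0 ->
  (<<[:: v; w]>> = fullv)%VS.
Proof.
set D := _ - _ => D0; apply/eqP; rewrite eqEsubv subvf /=; apply/subvP => u _.
have -> : u = ((u 0 0 * w 1 0 - u 1 0 * w 0 0) / D) *: v +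
    ((v 0 0 * u 1 0 - v 1 0 * u 0 0) / D) *: w.
  apply/matrixP => i j; rewrite (ord1 j) !mxE.
  have : D * D^-1 = 1 by rewrite divff.
  move: D^-1 => D'; rewrite /D => E.
  have [->|->] : i = 0 \/ i = 1.
  - by case: i => [[|[|//]] i1]; [left|right]; exact: val_inj.
  - by rewrite -[LHS]mulr1 -E; ring.
  - by rewrite -[LHS]mulr1 -E; ring.
by rewrite span_cons span_seq1 memv_add ?memvZ ?memv_line.
Qed.

(** If every vector v is parallel to x v, testing v on the two basis vectors and
their sum shows that x is scalar. *)
Lemma noncyclic_scalar (x : M2) : ~ cyclic_mx x -> exists a, x = a%:M.
Proof.
move=> ncx; have H (v : 'cV[C]_2) : v 0 0 * (x *m v) 1 0 - v 1 0 * (x *m v) 0 0 = 0.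
  by apply/eqP/negPn/negP => h; apply: ncx; exists v; exact: span2_full.
have E (v : 'cV[C]_2) i : (x *m v) i 0 = x i 0 * v 0 0 + x i 1 * v 1 0.
  rewrite mxE !big_ord_recl big_ord0 addr0.
  by congr (_ * _ + _ * _); congr (_ _ _); apply: val_inj.
pose v a b : 'cV[C]_2 := \col_i if i == 0 then a else b.
have h1 := H (v 1 0); have h2 := H (v 0 1); have h3 := H (v 1 1).
rewrite !E !mxE /= in h1 h2 h3.
have x10 : x 1 0 = 0 by rewrite -h1; ring.
have x01 : x 0 1 = 0 by apply/eqP; rewrite -oppr_eq0 -h2; apply/eqP; ring.
have x11 : x 1 1 = x 0 0.
  by apply/eqP; rewrite -subr_eq0 -h3 x10 x01; apply/eqP; ring.
by exists (x 0 0); apply: mx2_ext; rewrite ?scalar2.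
Qed.

Lemma scalar_noncyclic (a : C) : ~ cyclic_mx (a%:M : M2).
Proof.
move=> [v vE].
have : (<<[:: v; a%:M *m v]>> <= <[v]>)%VS.
  by apply/span_subvP => u; rewrite !inE => /orP[]/eqP->;
    rewrite ?mul_scalar_mx ?memvZ ?memv_line.
by move=> /dimvS; rewrite vE dimvf dim_vline; case: (v != 0).
Qed.

Lemma noncyclic_ballP (x : M2) :
  noncyclic_ball R x <-> exists2 a, nm a < 1 & x = a%:M.
Proof.
split=> [[xb /noncyclic_scalar[a xa]]|[a a1 ->]].
  by exists a => //; move: xb; rewrite /spectral_ball /= xa spectral_radius_scalar.
split; last exact: scalar_noncyclic.
by rewrite /spectral_ball /= spectral_radius_scalar.
Qed.

End Mat2.

(** * Derivatives read off along a ray, and cancellation *)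

Section DirectionalDerivative.
Variable R : realType.
Local Notation C := (R[i]).
Variable V : normedModType C.
Implicit Types (f g : V -> C) (x v : V).

Lemma real_small (x v : V) (d : R) : 0 < d -> exists2 t : R, 0 < t &
  t < d /\ nm (t%:C%C *: v) < d.
Proof.
move=> d0; have v1 : 0 < nm v + 1 by rewrite ltr_wpDl ?nm_ge0.
exists (d / (nm v + 1) / 2); first by rewrite !divr_gt0.
set t := d / (nm v + 1).
have t0 : 0 < t by rewrite divr_gt0.
have tE : t * (nm v + 1) = d by rewrite divfK ?gt_eqF.
have tv : 0 <= t * nm v by rewrite mulr_ge0 ?nm_ge0// ltW.
by rewrite nmZ nmR gtr0_norm ?divr_gt0//; split; lra.
Qed.

(** Real t suffice: the differential exists, so it is determined by one ray. *)
Lemma diff_dir f g x v (d : R) : 0 < d -> differentiable f x ->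
  {for x, continuous g} ->
  (forall t : R, 0 < t -> nm (t%:C%C *: v) < d ->
     f (x + t%:C%C *: v) - f x = t%:C%C * g (x + t%:C%C *: v)) ->
  'd f x v = g x.
Proof.
move=> d0 df /continuous_nm gc fg; apply/eqP; rewrite -subr_eq0 -nm_eq0.
rewrite eq_le nm_ge0 andbT; apply/ler_addgt0Pr => e e0; rewrite add0r.
have e2 : 0 < e / 2 by rewrite divr_gt0.
have v1 : 0 < nm v + 1 by rewrite ltr_wpDl ?nm_ge0.
have e3 : 0 < e / 2 / (nm v + 1) by rewrite divr_gt0.
have [d1 d10 H1] := differentiable_nm df e3; have [d2 d20 H2] := gc _ e2.
have [|t t0 []] := @real_small x v (Num.min d (Num.min d1 d2)).
  by rewrite !lt_min d0 d10.
rewrite !lt_min => _ /and3P[td td1 td2].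
have E : 'd f x (t%:C%C *: v) = t%:C%C * 'd f x v by rewrite linearZ.
have := H1 _ td1; rewrite fg// E -mulrBr.
rewrite nmZ nmM nmR gtr0_norm// => h1.
have h2 : nm (g x - g (x + t%:C%C *: v)) < e / 2.
  by apply: H2; rewrite opprD addrA subrr sub0r nmN.
have h3 : nm (g (x + t%:C%C *: v) - 'd f x v) <= e / 2.
  rewrite -(ler_pM2l t0); apply: le_trans h1 _.
  rewrite (_ : _ * (t * nm v) = t * (e / 2 * (nm v / (nm v + 1)))); last first.
    by field; rewrite gt_eqF.
  rewrite ler_pM2l// ler_piMr ?(ltW e2)// ler_pdivrMr// mul1r lerDl.
  exact: ler01.
apply: le_trans (nm_tri (g (x + t%:C%C *: v)) _ _) _.
rewrite (nmBC ('d f x v)) (nmBC _ (g x)).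
move: (nm _) (nm _) h2 h3 => *; lra.
Qed.

(** The zeros of a nonzero linear form have no interior points. *)
Lemma cancel_form (l : {linear V -> C}) (e : V) f x (d : R) : 0 < d -> l e = 1 ->
  {for x, continuous f} ->
  (forall y, nm (y - x) < d -> l y * f y = 0) -> f x = 0.
Proof.
move=> d0 le1 /continuous_nm fc lf; have [lx|lx] := eqVneq (l x) 0; last first.
  have := lf x; rewrite subrr nm0 => /(_ d0)/eqP.
  by rewrite mulf_eq0 (negbTE lx) => /eqP.
apply/eqP; rewrite -nm_eq0 eq_le nm_ge0 andbT.
apply/ler_addgt0Pr => c c0; rewrite add0r; have [d1 d10 H] := fc c c0.
have [|t t0 []] := @real_small x e (Num.min d d1); first by rewrite lt_min d0.
rewrite !lt_min => _ /andP[td td1].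
have lE : l (x + t%:C%C *: e) = t%:C%C.
  by rewrite linearD linearZ /= le1 lx add0r; exact: mulr1.
have dE : x + t%:C%C *: e - x = t%:C%C *: e by rewrite addrC addKr.
have := lf (x + t%:C%C *: e); rewrite dE => /(_ td)/eqP.
rewrite lE mulf_eq0 (inj_eq (@complexI R) t 0) gt_eqF//= => /eqP fx0.
have := H (x + t%:C%C *: e); rewrite fx0 subr0 nmBC dE.
by move=> /(_ td1)/ltW.
Qed.

Lemma cancel_ball x0 (l : {linear V -> C}) e (s : R) f : l e = 1 ->
  (forall z, nm (z - x0) < s -> differentiable f z) ->
  (forall z, nm (z - x0) < s -> l z * f z = 0) ->
  forall y, nm (y - x0) < s / 2 -> f y = 0.
Proof.
move=> le1 df lf y ys; have s2 : 0 < s / 2 by apply: le_lt_trans ys; exact: nm_ge0.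
apply: (@cancel_form l e f y (s / 2) s2 le1).
  by apply: differentiable_continuous; apply: df; lra.
move=> z zy; apply: lf; apply: le_lt_trans (nm_tri y _ _) _; lra.
Qed.

Lemma hcauchy_eq (x0 : V) (F G : nat -> V -> C) (r : R) : 0 < r ->
  (forall n y, nm (y - x0) < r -> G n y = F n y) -> hcauchy x0 G -> hcauchy x0 F.
Proof.
move=> r0 FG /hcauchy_shrink/(_ r0)[s s0 [sr dG uG]].
have GF n y : nm (y - x0) < s -> G n y = F n y.
  by move=> ys; apply: FG; exact: lt_le_trans sr.
exists (s / 2); first by rewrite divr_gt0.
have s2 : 0 < s / 2 by rewrite divr_gt0.
split=> [n y ys|e /uG[N HN]].
  have H z : nm (y - z) < s / 2 -> G n z = F n z.
    rewrite nmBC => zy; apply: GF; apply: le_lt_trans (nm_tri y _ _) _; lra.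
  by apply: (proj1 (differentiable_near_eq s2 H _)); apply: dG; lra.
exists N => m n y Nm Nn ys; have ys' : nm (y - x0) < s by lra.
by rewrite -!GF//; exact: HN.
Qed.

End DirectionalDerivative.

Section LocallyUniform.
Variable R : realType.
Local Notation C := (R[i]).
Local Notation M2 := 'M[C]_2.

Lemma uniform_nm (A : set M2) (f : nat -> M2 -> M2) (g : M2 -> M2) :
  {uniform A, f @ \oo --> g} <-> forall e : R, 0 < e -> exists N, forall n y,
    (N <= n)%N -> A y -> nm (g y - f n y) < e.
Proof.
split=> [H e e0|H P /uniform_nbhs[E [entE EP]]].
  pose E : set (M2 * M2) := [set xy | ball xy.1 e%:C%C xy.2].
  have entE : entourage E.
    rewrite -entourage_ballE; exists e%:C%C => //=; by rewrite ltcR.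
  have nE : nbhs (g : {uniform` A -> M2}) [set h | forall y, A y -> E (g y, h y)].
    by apply/uniform_nbhs; exists E; split.
  have [N _ HN] := H _ nE; exists N => n y Nn Ay; have := HN n Nn y Ay.
  by rewrite /E /= ballnm.
have [e /= e0 eE] : exists2 e : R, 0 < e & forall x y : M2, nm (x - y) < e -> E (x, y).
  move: entE; rewrite -entourage_ballE => -[d /= d0 dE].
  have eE : d = (complex.Re d)%:C%C by rewrite RRe_real ?gtr0_real.
  exists (complex.Re d); first by rewrite -ltcR -eE.
  by move=> x y xy; apply: dE; rewrite /= eE ballnm.
have [N HN] := H e e0; exists N => // n Nn; apply: EP => y Ay; apply: eE.
exact: HN.
Qed.

End LocallyUniform.

(** * Hadamard's lemma and Koszul exactness in matrix coordinates *)

Section Gauge.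
Variable R : realType.
Local Notation C := (R[i]).
Local Notation M2 := 'M[C]_2.
Implicit Types (f : M2 -> C) (c : M2 -> M2) (x : M2).

(** A traceless matrix is written A eA + B eB + C eC.  For each coordinate, ZX kills
it and DX f is the quotient of f - f ZX by it. *)
Definition eA : M2 := mx2 1 0 0 (-1).
Definition eB : M2 := mx2 0 1 0 0.
Definition eC : M2 := mx2 0 0 1 0.
Definition lA : {linear M2 -> C} := @halfdiff R.
Definition lB : {linear M2 -> C} := @entry R 0 1.
Definition lC : {linear M2 -> C} := @entry R 1 0.
Definition ZA : M2 -> M2 := sect eA lA 0.
Definition ZB : M2 -> M2 := sect eB lB 0.
Definition ZC : M2 -> M2 := sect eC lC 0.
Definition DA : (M2 -> C) -> M2 -> C := hdiv eA lA.
Definition DB : (M2 -> C) -> M2 -> C := hdiv eB lB.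
Definition DC : (M2 -> C) -> M2 -> C := hdiv eC lC.

Lemma lAE x : lA x = (x 0 0 - x 1 1) / 2. Proof. by []. Qed.
Lemma lBE x : lB x = x 0 1. Proof. by []. Qed.
Lemma lCE x : lC x = x 1 0. Proof. by []. Qed.

Lemma nm_mx2 (a b c d : C) (r : R) : 0 <= r ->
  nm a <= r -> nm b <= r -> nm c <= r -> nm d <= r -> nm (mx2 a b c d : M2) <= r.
Proof.
move=> r0 ar br cr dr; apply: nm_mxle => // i j; rewrite mxE.
by case: ifP; case: ifP.
Qed.

Lemma nm_eA : nm eA <= 1.
Proof. by apply: nm_mx2; rewrite ?nmN ?nm1 ?nm0 ?ler01. Qed.

Lemma nm_eB : nm eB <= 1.
Proof. by apply: nm_mx2; rewrite ?nm1 ?nm0 ?ler01. Qed.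

Lemma nm_eC : nm eC <= 1.
Proof. by apply: nm_mx2; rewrite ?nm1 ?nm0 ?ler01. Qed.

Lemma nm_lA x : nm (lA x) <= nm x. Proof. exact: nm_halfdiff. Qed.
Lemma nm_lB x : nm (lB x) <= nm x. Proof. exact: nm_entry. Qed.
Lemma nm_lC x : nm (lC x) <= nm x. Proof. exact: nm_entry. Qed.

Lemma lA_e : lA eA = 1. Proof. by rewrite lAE !mx2E; field. Qed.
Lemma lB_e : lB eB = 1. Proof. by rewrite lBE !mx2E. Qed.
Lemma lC_e : lC eC = 1. Proof. by rewrite lCE !mx2E. Qed.

Lemma lA_scalar (a : C) : lA a%:M = 0.
Proof. by rewrite lAE !scalar2 subrr mul0r. Qed.
Lemma lB_scalar (a : C) : lB a%:M = 0. Proof. by rewrite lBE !scalar2. Qed.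
Lemma lC_scalar (a : C) : lC a%:M = 0. Proof. by rewrite lCE !scalar2. Qed.

Lemma sect0 (e : M2) (l : {linear M2 -> C}) x : sect e l 0 x = x - l x *: e.
Proof. by rewrite /sect subr0 mul1r. Qed.

Lemma subZ_entry (b : C) x (y : M2) j k : (x - b *: y) j k = x j k - b * y j k.
Proof. by rewrite !mxE. Qed.

Lemma ZAE x : ZA x = mx2 (tau x) (x 0 1) (x 1 0) (tau x).
Proof.
rewrite /ZA sect0 lAE; apply: mx2_ext; rewrite subZ_entry !mx2E /tau.
- by field.
- by rewrite mulr0 subr0.
- by rewrite mulr0 subr0.
- by field.
Qed.

Lemma ZBE x : ZB x = mx2 (x 0 0) 0 (x 1 0) (x 1 1).
Proof.
rewrite /ZB sect0 lBE; apply: mx2_ext; rewrite subZ_entry !mx2E ?mulr0 ?subr0//.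
by rewrite mulr1 subrr.
Qed.

Lemma ZCE x : ZC x = mx2 (x 0 0) (x 0 1) 0 (x 1 1).
Proof.
rewrite /ZC sect0 lCE; apply: mx2_ext; rewrite subZ_entry !mx2E ?mulr0 ?subr0//.
by rewrite mulr1 subrr.
Qed.

Lemma Z_ptau x : ZB (ZC (ZA x)) = ptau x.
Proof.
by rewrite ZBE ZCE ZAE; apply: mx2_ext; rewrite !mx2E /ptau !scalar2.
Qed.

Lemma lA_ZB x : lA (ZB x) = lA x. Proof. by rewrite ZBE !lAE !mx2E. Qed.
Lemma lA_ZC x : lA (ZC x) = lA x. Proof. by rewrite ZCE !lAE !mx2E. Qed.
Lemma lC_ZB x : lC (ZB x) = lC x. Proof. by rewrite ZBE !lCE !mx2E. Qed.
Lemma lB_ZC x : lB (ZC x) = lB x. Proof. by rewrite ZCE !lBE !mx2E. Qed.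
Lemma lB_ZB x : lB (ZB x) = 0. Proof. by rewrite ZBE lBE mx2E. Qed.
Lemma lC_ZC x : lC (ZC x) = 0. Proof. by rewrite ZCE lCE mx2E. Qed.

Lemma DAE f x : lA x * DA f x = f x - f (ZA x). Proof. exact: hdivE. Qed.
Lemma DBE f x : lB x * DB f x = f x - f (ZB x). Proof. exact: hdivE. Qed.
Lemma DCE f x : lC x * DC f x = f x - f (ZC x). Proof. exact: hdivE. Qed.

Lemma differentiable_lA x : differentiable lA x. Proof. exact: (differentiable_l nm_lA). Qed.
Lemma differentiable_lB x : differentiable lB x. Proof. exact: (differentiable_l nm_lB). Qed.
Lemma differentiable_lC x : differentiable lC x. Proof. exact: (differentiable_l nm_lC). Qed.
Lemma differentiable_ZB x : differentiable ZB x. Proof. exact: (differentiable_sect _ nm_lB). Qed.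
Lemma differentiable_ZC x : differentiable ZC x. Proof. exact: (differentiable_sect _ nm_lC). Qed.

Section AtScalar.
Variable a : C.
Local Notation hc := (@hcauchy R M2 a%:M).

Let i01 : 0 <= (0 : R) <= 1. Proof. by rewrite lexx ler01. Qed.

Lemma nm_ZB y : nm (ZB y - a%:M) <= 2 * nm (y - a%:M).
Proof. exact: (sect_sub nm_eB nm_lB y (lB_scalar a) i01). Qed.
Lemma nm_ZC y : nm (ZC y - a%:M) <= 2 * nm (y - a%:M).
Proof. exact: (sect_sub nm_eC nm_lC y (lC_scalar a) i01). Qed.

Lemma DB_scalar f : DB f a%:M = 'd f (a%:M : M2) eB.
Proof. by rewrite /DB /hdiv lB_scalar eqxx. Qed.
Lemma DC_scalar f : DC f a%:M = 'd f (a%:M : M2) eC.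
Proof. by rewrite /DC /hdiv lC_scalar eqxx. Qed.
Lemma DA_scalar f : DA f a%:M = 'd f (a%:M : M2) eA.
Proof. by rewrite /DA /hdiv lA_scalar eqxx. Qed.

Lemma DB_ball r f : 0 < r ->
  (forall y, nm (y - a%:M) < r -> differentiable f y) ->
  forall y, nm (y - a%:M) < r / 2 -> differentiable (DB f) y.
Proof. exact: (hdiv_ball nm_eB nm_lB (lB_scalar a)). Qed.

Lemma DC_ball r f : 0 < r ->
  (forall y, nm (y - a%:M) < r -> differentiable f y) ->
  forall y, nm (y - a%:M) < r / 2 -> differentiable (DC f) y.
Proof. exact: (hdiv_ball nm_eC nm_lC (lC_scalar a)). Qed.

Lemma hc_lA : hc (fun _ => lA).
Proof. by apply: (hcauchy_const ltr01) => y _; exact: differentiable_lA. Qed.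
Lemma hc_lB : hc (fun _ => lB).
Proof. by apply: (hcauchy_const ltr01) => y _; exact: differentiable_lB. Qed.
Lemma hc_lC : hc (fun _ => lC).
Proof. by apply: (hcauchy_const ltr01) => y _; exact: differentiable_lC. Qed.

Lemma hc_DA F : hc F -> hc (fun n => DA (F n)).
Proof. exact: (hcauchy_hdiv nm_eA nm_lA (lA_scalar a)). Qed.
Lemma hc_DB F : hc F -> hc (fun n => DB (F n)).
Proof. exact: (hcauchy_hdiv nm_eB nm_lB (lB_scalar a)). Qed.
Lemma hc_DC F : hc F -> hc (fun n => DC (F n)).
Proof. exact: (hcauchy_hdiv nm_eC nm_lC (lC_scalar a)). Qed.

Lemma hc_ZB F : hc F -> hc (fun n x => F n (ZB x)).
Proof. exact: (hcauchy_comp (ltr0Sn R 1) nm_ZB differentiable_ZB). Qed.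
Lemma hc_ZC F : hc F -> hc (fun n x => F n (ZC x)).
Proof. exact: (hcauchy_comp (ltr0Sn R 1) nm_ZC differentiable_ZC). Qed.

End AtScalar.

#[local] Opaque lA lB lC ZA ZB ZC DA DB DC.

(** The coordinates are killed one after the other, B, then C, then A; what is left
in the end is the scalar part, and the coefficients of f telescope. *)
Definition colB f := DB f.
Definition colC f := DC (fun x => f (ZB x)).
Definition colA f := DA (fun x => f (ZB (ZC x))).

Lemma hadamard f x :
  f x = lA x * colA f x + lB x * colB f x + lC x * colC f x + f (ptau x).
Proof.
have E (s t u v p q m : C) : p = u - t -> q = s - v -> m = v - u -> s = p + q + m + t.
  by move=> -> -> ->; ring.
have EA := DAE (fun y => f (ZB (ZC y))) x; rewrite Z_ptau in EA.
exact: (E _ _ _ _ _ _ _ EA (DBE f x) (DCE (fun y => f (ZB y)) x)).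
Qed.

Section Koszul.
Variables wA wB wC : M2 -> C.
Let g := DB wA.
Let h := DC (fun x => wA (ZB x)).
Let k := DC (fun x => wB x + lA x * g x).

Variables (a : C) (r : R).
Hypothesis r0 : 0 < r.
Hypothesis dA : forall y, nm (y - a%:M) < r -> differentiable wA y.
Hypothesis dB : forall y, nm (y - a%:M) < r -> differentiable wB y.
Hypothesis dC : forall y, nm (y - a%:M) < r -> differentiable wC y.
Hypothesis euler : forall y, nm (y - a%:M) < r ->
  lA y * wA y + lB y * wB y + lC y * wC y = 0.

Let ZBr y s : nm (y - a%:M) < s / 2 -> nm (ZB y - a%:M) < s.
Proof.
by move=> yr; apply: le_lt_trans (nm_ZB a y) _; lra.
Qed.

Let ZCr y s : nm (y - a%:M) < s / 2 -> nm (ZC y - a%:M) < s.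
Proof.
by move=> yr; apply: le_lt_trans (nm_ZC a y) _; lra.
Qed.

Let dcomp f (Z : M2 -> M2) (s : R) : (forall y, differentiable Z y) ->
  (forall y, nm (y - a%:M) < s / 2 -> nm (Z y - a%:M) < s) ->
  (forall z, nm (z - a%:M) < s -> differentiable f z) ->
  forall z, nm (z - a%:M) < s / 2 -> differentiable (fun y => f (Z y)) z.
Proof. by move=> dZ Zr df z zs; exact: (differentiable_comp (dZ z) (df _ (Zr z zs))). Qed.

(** Killing coordinates one at a time: where B = C = 0 the relation reads
A wA = 0, so wA vanishes there and is a combination of B and C with
coefficients g and h.  Substituting, B and C have a relation with coefficients
wB + A g and wC + A h, and the same reasoning with one coordinate less finishes.
Each cancellation costs a factor of the radius. *)
Lemma koszul y : nm (y - a%:M) < r / 64 ->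
  [/\ wA y = lB y * g y + lC y * h y, wB y = lC y * k y - lA y * g y &
      wC y = - (lB y * k y) - lA y * h y].
Proof.
move=> yr.
have r2 : 0 < r / 2 by rewrite divr_gt0.
have dg z : nm (z - a%:M) < r / 2 -> differentiable g z.
  exact: (DB_ball r0 dA).
have dAB z : nm (z - a%:M) < r / 2 -> differentiable (fun y => wA (ZB y)) z.
  exact: (@dcomp wA ZB r differentiable_ZB (fun u ur => ZBr ur) dA).
(* wA vanishes where lB = lC = 0, since there lA * wA = 0 *)
have wA0 z : nm (z - a%:M) < r / 2 / 2 / 2 -> wA (ZB (ZC z)) = 0.
  apply: (@cancel_ball R M2 a%:M lA eA (r / 2 / 2) (fun y => wA (ZB (ZC y))) lA_e).
    exact: (@dcomp (fun y => wA (ZB y)) ZC (r / 2) differentiable_ZC (fun u ur => ZCr ur) dAB).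
  move=> u ur; have := euler (ZBr (ZCr ur)).
  by rewrite lA_ZB lA_ZC lB_ZB lC_ZB lC_ZC !mul0r !addr0.
have EA z : nm (z - a%:M) < r / 2 / 2 / 2 -> wA z = lB z * g z + lC z * h z.
  move=> /wA0 w0; have E2 := DCE (fun y => wA (ZB y)) z; rewrite w0 subr0 in E2.
  by rewrite /g (DBE wA z) E2 subrK.
pose A z := wB z + lA z * g z.
have dA' z : nm (z - a%:M) < r / 2 -> differentiable A z.
  move=> zr; apply: differentiableD; first by apply: dB; lra.
  by apply: differentiableM; [exact: differentiable_lA|exact: dg].
have euler2 z : nm (z - a%:M) < r / 2 / 2 / 2 ->
    lB z * A z + lC z * (wC z + lA z * h z) = 0.
  move=> zr; have zr' : nm (z - a%:M) < r by lra.
  by have := euler zr'; rewrite (EA z zr) /A => <-; ring.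
have AC0 z : nm (z - a%:M) < r / 32 -> A (ZC z) = 0.
  move=> zr; apply: (@cancel_ball R M2 a%:M lB eB (r / 16) (fun y => A (ZC y)) lB_e); last by lra.
    have dA8 u : nm (u - a%:M) < r / 8 -> differentiable A u.
      by move=> ur; apply: dA'; lra.
    have := @dcomp A ZC (r / 8) differentiable_ZC (fun u ur => ZCr ur) dA8.
    by move=> H u ur; apply: H; lra.
  move=> u ur; have ur' : nm (ZC u - a%:M) < r / 2 / 2 / 2.
    by apply: ZCr; lra.
  by have := euler2 _ ur'; rewrite lB_ZC lC_ZC mul0r addr0.
have Ek z : nm (z - a%:M) < r / 32 -> A z = lC z * k z.
  by move=> zr; rewrite /k DCE -/(A z) -/(A (ZC z)) AC0// subr0.
have dh z : nm (z - a%:M) < r / 4 -> differentiable h z.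
  have r22 : 0 < r / 2 / 2 by rewrite !divr_gt0.
  move=> zr; apply: (DC_ball r2 dAB); lra.
have dk z : nm (z - a%:M) < r / 4 -> differentiable k z.
  move=> zr; apply: (DC_ball r2 dA'); lra.
have B0 z : nm (z - a%:M) < r / 64 -> wC z + lA z * h z + lB z * k z = 0.
  move=> zr.
  apply: (@cancel_ball R M2 a%:M lC eC (r / 32) (fun z => wC z + lA z * h z + lB z * k z) lC_e);
    last by lra.
    move=> u ur; apply: differentiableD; last first.
      by apply: differentiableM; [exact: differentiable_lB|apply: dk; lra].
    apply: differentiableD; first by apply: dC; lra.
    by apply: differentiableM; [exact: differentiable_lA|apply: dh; lra].
  move=> u ur; have ur' : nm (u - a%:M) < r / 2 / 2 / 2 by lra.
  by have := euler2 u ur'; rewrite (Ek u ur) => <-; ring.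
have yr8 : nm (y - a%:M) < r / 2 / 2 / 2 by lra.
have yr32 : nm (y - a%:M) < r / 32 by lra.
split; first exact: EA.
- by have := Ek y yr32; rewrite /A => <-; ring.
- by apply/eqP; rewrite -subr_eq0; apply/eqP; rewrite -(B0 y yr); ring.
Qed.

End Koszul.
End Gauge.

#[local] Transparent lA lB lC.

(** * The intertwiner *)

Section Numeric.
Variable F : fieldType.

(** Vectors (A, B, C) stand for the traceless matrices with rows (A, B), (C, -A), and
the bilinear form of two of them is A A' + (B C' + C B') / 2.  The first three
hypotheses are N y = (y + z) / 2; the next three say that N^T (z - y) is the vector
product of y with the vector v = (- k, h, - g), where coordinates are suitably
ordered and normalized.  With b = N v, the cofactor identity
N^T (N u x N v) = det N (u x v) turns this into the statement that al (z - y) is the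
commutator of the matrices b and (y + z) / 2.  Then (al + b) y - z (al + b) is half
the anticommutator of b and y - z.  That is a scalar matrix, and it vanishes because
the trace of the product of b and a commutator with b is zero. *)
Lemma intertwine_numeric (two : (2 : F) != 0)
  (ya yb yc za zb zc : F) (naa nab nac nba nbb nbc nca ncb ncc : F) (g h k : F) :
  let da := za - ya in let db := zb - yb in let dc := zc - yc in
  let al := naa * (nbb * ncc - nbc * ncb) - nab * (nba * ncc - nbc * nca)
            + nac * (nba * ncb - nbb * nca) in
  let ba := naa * - k + nab * h + nac * - g in
  let bb := nba * - k + nbb * h + nbc * - g in
  let bc := nca * - k + ncb * h + ncc * - g in
  (ya + za) / 2 = naa * ya + nab * yb + nac * yc ->
  (yb + zb) / 2 = nba * ya + nbb * yb + nbc * yc ->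
  (yc + zc) / 2 = nca * ya + ncb * yb + ncc * yc ->
  naa * da + nba * (dc / 2) + nca * (db / 2) = yb * g + yc * h ->
  nab * da + nbb * (dc / 2) + ncb * (db / 2) = yc * k - ya * g ->
  nac * da + nbc * (dc / 2) + ncc * (db / 2) = - (yb * k) - ya * h ->
  al != 0 ->
  [/\ (al + ba) * ya + bb * yc = za * (al + ba) + zb * bc,
      (al + ba) * yb - bb * ya = za * bb + zb * (al - ba),
      bc * ya + (al - ba) * yc = zc * (al + ba) - za * bc &
      bc * yb - (al - ba) * ya = zc * bb - za * (al - ba)].
Proof.
move=> da db dc al ba bb bc ma mb mc wa wb wc al0.
(* the coordinates of al (z - y) minus the commutator; N^T kills them *)
pose xa := al * da - (bb * ((yc + zc) / 2) - bc * ((yb + zb) / 2)).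
pose xb := al * (dc / 2) - (bc * ((ya + za) / 2) - ba * ((yc + zc) / 2)).
pose xc := al * (db / 2) - (ba * ((yb + zb) / 2) - bb * ((ya + za) / 2)).
have ta : naa * xa + nba * xb + nca * xc = 0.
  rewrite /xa /xb /xc ma mb mc.
  transitivity (al * ((naa * da + nba * (dc / 2) + nca * (db / 2))
     - (yb * g + yc * h))); first by rewrite /al /ba /bb /bc; ring.
  by rewrite wa subrr mulr0.
have tb : nab * xa + nbb * xb + ncb * xc = 0.
  rewrite /xa /xb /xc ma mb mc.
  transitivity (al * ((nab * da + nbb * (dc / 2) + ncb * (db / 2))
     - (yc * k - ya * g))); first by rewrite /al /ba /bb /bc; ring.
  by rewrite wb subrr mulr0.
have tc : nac * xa + nbc * xb + ncc * xc = 0.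
  rewrite /xa /xb /xc ma mb mc.
  transitivity (al * ((nac * da + nbc * (dc / 2) + ncc * (db / 2))
     - (- (yb * k) - ya * h))); first by rewrite /al /ba /bb /bc; ring.
  by rewrite wc subrr mulr0.
have ha : xa = 0.
  apply: (mulfI al0); rewrite mulr0.
  transitivity ((nbb * ncc - nbc * ncb) * (naa * xa + nba * xb + nca * xc)
    - (nba * ncc - nbc * nca) * (nab * xa + nbb * xb + ncb * xc)
    + (nba * ncb - nbb * nca) * (nac * xa + nbc * xb + ncc * xc)).
    by rewrite /al; move: xa xb xc {ta tb tc} => *; ring.
  by rewrite ta tb tc !(mulr0, addr0, subr0).
have hb : xb = 0.
  apply: (mulfI al0); rewrite mulr0.
  transitivity (- (nab * ncc - nac * ncb) * (naa * xa + nba * xb + nca * xc)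
    + (naa * ncc - nac * nca) * (nab * xa + nbb * xb + ncb * xc)
    - (naa * ncb - nab * nca) * (nac * xa + nbc * xb + ncc * xc)).
    by rewrite /al; move: xa xb xc {ta tb tc ha} => *; ring.
  by rewrite ta tb tc !(mulr0, addr0, subr0).
have hc : xc = 0.
  apply: (mulfI al0); rewrite mulr0.
  transitivity ((nab * nbc - nac * nbb) * (naa * xa + nba * xb + nca * xc)
    - (naa * nbc - nac * nba) * (nab * xa + nbb * xb + ncb * xc)
    + (naa * nbb - nab * nba) * (nac * xa + nbc * xb + ncc * xc)).
    by rewrite /al; move: xa xb xc {ta tb tc ha hb} => *; ring.
  by rewrite ta tb tc !(mulr0, addr0, subr0).
move: al ba bb bc al0 @xa @xb @xc ha hb hc {ta tb tc ma mb mc wa wb wc} => al ba bb bc al0.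
rewrite /da /db /dc /= => ha hb hc.
set xa := (X in X = 0) in ha; set xb := (X in X = 0) in hb.
set xc := (X in X = 0) in hc.
(* half the anticommutator of z - y and b *)
pose sc := (za - ya) * ba + (zb - yb) / 2 * bc + (zc - yc) / 2 * bb.
have s0 : sc = 0.
  apply: (mulfI al0); rewrite mulr0.
  transitivity (xa * ba + xb * bb + xc * bc).
    by rewrite /sc /xa /xb /xc; field.
  by rewrite ha hb hc !mul0r !addr0.
split; apply/eqP; rewrite -subr_eq0; apply/eqP.
- transitivity (- xa - sc); last by rewrite ha s0 subr0 oppr0.
  by rewrite /sc /xa; field.
- transitivity (- (2 * xc)); last by rewrite hc mulr0 oppr0.
  by rewrite /xc; field.
- transitivity (- (2 * xb)); last by rewrite hb mulr0 oppr0.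
  by rewrite /xb; field.
- transitivity (xa - sc); last by rewrite ha s0 subr0.
  by rewrite /sc /xa; field.
Qed.

End Numeric.

(** * The gauge and its convergence *)

Section GaugeDef.
Variable R : realType.
Local Notation C := (R[i]).
Local Notation M2 := 'M[C]_2.
Local Notation lA := (lA R).
Local Notation lB := (lB R).
Local Notation lC := (lC R).
Variable c : M2 -> M2.
Implicit Type x : M2.

(** The traceless part of c, with coordinates zA, zB, zC; d is its difference to
that of x. *)
Definition zA x : C := lA (c x).
Definition zB x : C := c x 0 1.
Definition zC x : C := c x 1 0.
Definition dA x : C := zA x - lA x.
Definition dB x : C := zB x - lB x.
Definition dC x : C := zC x - lC x.
(** The entries of N = (1 + M) / 2, where M is the matrix of Hadamard coefficients
of the coordinates of c. *)
Definition nAA x : C := (1 + colA zA x) / 2.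
Definition nAB x : C := colB zA x / 2.
Definition nAC x : C := colC zA x / 2.
Definition nBA x : C := colA zB x / 2.
Definition nBB x : C := (1 + colB zB x) / 2.
Definition nBC x : C := colC zB x / 2.
Definition nCA x : C := colA zC x / 2.
Definition nCB x : C := colB zC x / 2.
Definition nCC x : C := (1 + colC zC x) / 2.
(** w = N^T d; the form exchanges the coordinates B and C, with a factor one half. *)
Definition wA x : C := nAA x * dA x + nBA x * (dC x / 2) + nCA x * (dB x / 2).
Definition wB x : C := nAB x * dA x + nBB x * (dC x / 2) + nCB x * (dB x / 2).
Definition wC x : C := nAC x * dA x + nBC x * (dC x / 2) + nCC x * (dB x / 2).
(** The three coefficients provided by [koszul]. *)
Definition kg : M2 -> C := DB wA.
Definition kh : M2 -> C := DC (fun x => wA (ZB x)).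
Definition kk : M2 -> C := DC (fun x => wB x + lA x * kg x).
(** The determinant of N. *)
Definition al x : C := nAA x * (nBB x * nCC x - nBC x * nCB x)
  - nAB x * (nBA x * nCC x - nBC x * nCA x)
  + nAC x * (nBA x * nCB x - nBB x * nCA x).
(** N applied to the vector (- kk, kh, - kg). *)
Definition bA x : C := nAA x * - kk x + nAB x * kh x + nAC x * - kg x.
Definition bB x : C := nBA x * - kk x + nBB x * kh x + nBC x * - kg x.
Definition bC x : C := nCA x * - kk x + nCB x * kh x + nCC x * - kg x.
Definition q0 x : M2 := mx2 (al x + bA x) (bB x) (bC x) (al x - bA x).
Definition detq x : C := (al x + bA x) * (al x - bA x) - bB x * bC x.
Definition gauge x : M2 := (sqrtc (detq x))^-1 *: q0 x.

End GaugeDef.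

Section GaugeCauchy.
Variable R : realType.
Local Notation C := (R[i]).
Local Notation M2 := 'M[C]_2.
Local Notation lA := (lA R).
Local Notation lB := (lB R).
Local Notation lC := (lC R).
Variable a : C.
Local Notation hc := (@hcauchy R M2 a%:M).

Lemma hc_colA F : hc F -> hc (fun n => colA (F n)).
Proof. by move=> hF; apply: (hc_DA (F := fun n x => F n (ZB (ZC x)))); apply: (hc_ZC (F := fun n x => F n (ZB x))); exact: hc_ZB. Qed.
Lemma hc_colB F : hc F -> hc (fun n => colB (F n)). Proof. exact: hc_DB. Qed.
Lemma hc_colC F : hc F -> hc (fun n => colC (F n)).
Proof. by move=> hF; apply: (hc_DC (F := fun n x => F n (ZB x))); exact: hc_ZB. Qed.

Variable c : nat -> M2 -> M2.
Hypothesis hcc : forall j k, hc (fun n x => c n x j k).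

Lemma hc_zA : hc (fun n => zA (c n)).
Proof.
rewrite /zA; apply: hcauchyM; last exact: hcauchy_cst.
by apply: hcauchyB; exact: hcc.
Qed.
Lemma hc_zB : hc (fun n => zB (c n)). Proof. exact: hcc. Qed.
Lemma hc_zC : hc (fun n => zC (c n)). Proof. exact: hcc. Qed.

Lemma hc_half F : hc F -> hc (fun n x => F n x / 2).
Proof. by move=> hF; apply: hcauchyM => //; exact: hcauchy_cst. Qed.
Lemma hc_half1 F : hc F -> hc (fun n x => (1 + F n x) / 2).
Proof. by move=> hF; apply: hc_half; apply: hcauchyD => //; exact: hcauchy_cst. Qed.

Lemma hc_dA : hc (fun n => dA (c n)). Proof. exact: (hcauchyB hc_zA (hc_lA a)). Qed.
Lemma hc_dB : hc (fun n => dB (c n)). Proof. exact: (hcauchyB hc_zB (hc_lB a)). Qed.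
Lemma hc_dC : hc (fun n => dC (c n)). Proof. exact: (hcauchyB hc_zC (hc_lC a)). Qed.
Lemma hc_nAA : hc (fun n => nAA (c n)). Proof. exact: hc_half1 (hc_colA hc_zA). Qed.
Lemma hc_nAB : hc (fun n => nAB (c n)). Proof. exact: hc_half (hc_colB hc_zA). Qed.
Lemma hc_nAC : hc (fun n => nAC (c n)). Proof. exact: hc_half (hc_colC hc_zA). Qed.
Lemma hc_nBA : hc (fun n => nBA (c n)). Proof. exact: hc_half (hc_colA hc_zB). Qed.
Lemma hc_nBB : hc (fun n => nBB (c n)). Proof. exact: hc_half1 (hc_colB hc_zB). Qed.
Lemma hc_nBC : hc (fun n => nBC (c n)). Proof. exact: hc_half (hc_colC hc_zB). Qed.
Lemma hc_nCA : hc (fun n => nCA (c n)). Proof. exact: hc_half (hc_colA hc_zC). Qed.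
Lemma hc_nCB : hc (fun n => nCB (c n)). Proof. exact: hc_half (hc_colB hc_zC). Qed.
Lemma hc_nCC : hc (fun n => nCC (c n)). Proof. exact: hc_half1 (hc_colC hc_zC). Qed.

Lemma hc_dot3 F1 F2 F3 G1 G2 G3 : hc F1 -> hc F2 -> hc F3 -> hc G1 -> hc G2 -> hc G3 ->
  hc (fun n x => F1 n x * G1 n x + F2 n x * G2 n x + F3 n x * G3 n x).
Proof.
by move=> *; apply: hcauchyD; [apply: hcauchyD|]; apply: hcauchyM.
Qed.

Lemma hc_wA : hc (fun n => wA (c n)).
Proof. exact: (hc_dot3 hc_nAA hc_nBA hc_nCA hc_dA (hc_half hc_dC) (hc_half hc_dB)). Qed.
Lemma hc_wB : hc (fun n => wB (c n)).
Proof. exact: (hc_dot3 hc_nAB hc_nBB hc_nCB hc_dA (hc_half hc_dC) (hc_half hc_dB)). Qed.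
Lemma hc_wC : hc (fun n => wC (c n)).
Proof. exact: (hc_dot3 hc_nAC hc_nBC hc_nCC hc_dA (hc_half hc_dC) (hc_half hc_dB)). Qed.
Lemma hc_kg : hc (fun n => kg (c n)). Proof. exact: hc_DB hc_wA. Qed.
Lemma hc_kh : hc (fun n => kh (c n)).
Proof. exact: (hc_DC (F := fun n x => wA (c n) (ZB x)) (hc_ZB hc_wA)). Qed.
Lemma hc_kk : hc (fun n => kk (c n)).
Proof.
apply: (hc_DC (F := fun n x => wB (c n) x + lA x * kg (c n) x)).
exact: (hcauchyD hc_wB (hcauchyM (hc_lA a) hc_kg)).
Qed.
Lemma hc_al : hc (fun n => al (c n)).
Proof.
have m2 F1 F2 F3 F4 : hc F1 -> hc F2 -> hc F3 -> hc F4 ->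
    hc (fun n x => F1 n x * F2 n x - F3 n x * F4 n x).
  by move=> *; apply: hcauchyB; apply: hcauchyM.
apply: (hcauchyD (hcauchyB (hcauchyM hc_nAA _) (hcauchyM hc_nAB _)) (hcauchyM hc_nAC _)).
- exact: (m2 _ _ _ _ hc_nBB hc_nCC hc_nBC hc_nCB).
- exact: (m2 _ _ _ _ hc_nBA hc_nCC hc_nBC hc_nCA).
- exact: (m2 _ _ _ _ hc_nBA hc_nCB hc_nBB hc_nCA).
Qed.
Lemma hc_bA : hc (fun n => bA (c n)).
Proof. exact: (hc_dot3 hc_nAA hc_nAB hc_nAC (hcauchyN hc_kk) hc_kh (hcauchyN hc_kg)). Qed.
Lemma hc_bB : hc (fun n => bB (c n)).
Proof. exact: (hc_dot3 hc_nBA hc_nBB hc_nBC (hcauchyN hc_kk) hc_kh (hcauchyN hc_kg)). Qed.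
Lemma hc_bC : hc (fun n => bC (c n)).
Proof. exact: (hc_dot3 hc_nCA hc_nCB hc_nCC (hcauchyN hc_kk) hc_kh (hcauchyN hc_kg)). Qed.

Lemma hc_q0 j k : hc (fun n x => q0 (c n) x j k).
Proof.
have ext G : hc G -> (forall n x, G n x = q0 (c n) x j k) ->
    hc (fun n x => q0 (c n) x j k).
  by move=> hG E; apply: (@hcauchy_eq _ _ _ _ G 1) => // n y _; exact: E.
case: j k ext => [[|[|//]] j1] [[|[|//]] k1] ext.
- by apply: (ext _ (hcauchyD hc_al hc_bA)) => n x; rewrite /q0 mxE.
- by apply: (ext _ hc_bB) => n x; rewrite /q0 mxE.
- by apply: (ext _ hc_bC) => n x; rewrite /q0 mxE.
- by apply: (ext _ (hcauchyB hc_al hc_bA)) => n x; rewrite /q0 mxE.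
Qed.

Lemma hc_detq : hc (fun n => detq (c n)).
Proof.
exact: (hcauchyB (hcauchyM (hcauchyD hc_al hc_bA) (hcauchyB hc_al hc_bA))
  (hcauchyM hc_bB hc_bC)).
Qed.

End GaugeCauchy.

Section GaugeThm.
Variable R : realType.
Local Notation C := (R[i]).
Local Notation M2 := 'M[C]_2.
Local Notation lA := (lA R).
Local Notation lB := (lB R).
Local Notation lC := (lC R).
Variable a : C.
Local Notation x0 := (a%:M : M2).

(** On the ray x0 + t eX only the coordinate X is nonzero, and it equals t. *)
Lemma form_D f u v w (d : R) : 0 < d -> differentiable f x0 ->
  differentiable u x0 -> differentiable v x0 -> differentiable w x0 ->
  (forall y, nm (y - x0) < d -> f y = lA y * u y + lB y * v y + lC y * w y) ->
  [/\ DA f x0 = u x0, DB f x0 = v x0 & DC f x0 = w x0].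
Proof.
move=> d0 df du dv dw fE.
have f0 : f x0 = 0.
  rewrite fE; last by rewrite subrr nm0.
  by rewrite lA_scalar lB_scalar lC_scalar !mul0r !addr0.
have lin (l : {linear M2 -> C}) t e : l x0 = 0 -> l (x0 + t%:C%C *: e) = t%:C%C * l e.
  by move=> lx; rewrite linearD linearZ /= lx add0r.
have AB : lA (eB R) = 0 by rewrite lAE !mx2E subrr mul0r.
have AC : lA (eC R) = 0 by rewrite lAE !mx2E subrr mul0r.
have BA : lB (eA R) = 0 by rewrite lBE mx2E.
have BC : lB (eC R) = 0 by rewrite lBE mx2E.
have CA : lC (eA R) = 0 by rewrite lCE mx2E.
have CB : lC (eB R) = 0 by rewrite lCE mx2E.
split.
- rewrite DA_scalar; apply: (diff_dir d0 df (differentiable_continuous du)) => t t0 td.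
  rewrite f0 subr0 fE; last by rewrite addrC addKr.
  rewrite !lin ?lA_scalar ?lB_scalar ?lC_scalar //.
  by rewrite lA_e BA CA !mulr0 !mul0r !addr0 mulr1.
- rewrite DB_scalar; apply: (diff_dir d0 df (differentiable_continuous dv)) => t t0 td.
  rewrite f0 subr0 fE; last by rewrite addrC addKr.
  rewrite !lin ?lA_scalar ?lB_scalar ?lC_scalar //.
  by rewrite lB_e AB CB !mulr0 !mul0r !addr0 add0r mulr1.
- rewrite DC_scalar; apply: (diff_dir d0 df (differentiable_continuous dw)) => t t0 td.
  rewrite f0 subr0 fE; last by rewrite addrC addKr.
  rewrite !lin ?lA_scalar ?lB_scalar ?lC_scalar //.
  by rewrite lC_e AC BC !mulr0 !mul0r !add0r mulr1.
Qed.

Let ZB0 : ZB x0 = x0.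
Proof. by apply/eqP; rewrite -subr_eq0 -nm_eq0 eq_le nm_ge0 andbT; apply: le_trans (nm_ZB a x0) _; rewrite subrr nm0 mulr0. Qed.
Let ZC0 : ZC x0 = x0.
Proof. by apply/eqP; rewrite -subr_eq0 -nm_eq0 eq_le nm_ge0 andbT; apply: le_trans (nm_ZC a x0) _; rewrite subrr nm0 mulr0. Qed.

Let dZB (f : M2 -> C) : differentiable f x0 -> differentiable (fun y => f (ZB y)) x0.
Proof. by move=> df; apply: (differentiable_comp (differentiable_ZB x0)); rewrite ZB0. Qed.
Let dZC (f : M2 -> C) : differentiable f x0 -> differentiable (fun y => f (ZC y)) x0.
Proof. by move=> df; apply: (differentiable_comp (differentiable_ZC x0)); rewrite ZC0. Qed.

Lemma form_col f u v w (d : R) : 0 < d -> differentiable f x0 ->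
  differentiable u x0 -> differentiable v x0 -> differentiable w x0 ->
  (forall y, nm (y - x0) < d -> f y = lA y * u y + lB y * v y + lC y * w y) ->
  [/\ colA f x0 = u x0, colB f x0 = v x0 & colC f x0 = w x0].
Proof.
move=> d0 df du dv dw fE; have d2 : 0 < d / 2 by rewrite divr_gt0.
have d4 : 0 < d / 2 / 2 by rewrite divr_gt0.
have [_ EB _] := form_D d0 df du dv dw fE.
have inB s y : nm (y - x0) < s / 2 -> nm (ZB y - x0) < s.
  by move=> yr; apply: le_lt_trans (nm_ZB a y) _; lra.
have inC s y : nm (y - x0) < s / 2 -> nm (ZC y - x0) < s.
  by move=> yr; apply: le_lt_trans (nm_ZC a y) _; lra.
have fB y : nm (y - x0) < d / 2 -> f (ZB y) =
    lA y * u (ZB y) + lB y * 0 + lC y * w (ZB y).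
  by move=> /inB/fE->; rewrite lA_ZB lB_ZB lC_ZB mul0r mulr0.
have d_0 : differentiable (fun _ => 0 : C) x0 by exact: differentiable_cst.
have [_ _ EC] := form_D d2 (dZB df) (dZB du) d_0 (dZB dw) fB.
have fA y : nm (y - x0) < d / 2 / 2 -> f (ZB (ZC y)) =
    lA y * u (ZB (ZC y)) + lB y * 0 + lC y * 0.
  by move=> /inC/fB->; rewrite lA_ZC lC_ZC mul0r !mulr0.
have dBC (g : M2 -> C) : differentiable g x0 -> differentiable (fun y => g (ZB (ZC y))) x0.
  by move=> dg; apply: (dZC (f := fun y => g (ZB y))); exact: dZB.
have [EA _ _] := form_D d4 (dBC _ df) (dBC _ du) d_0 d_0 fA.
by split; [rewrite /colA EA ZC0 ZB0|exact: EB|rewrite /colC EC ZB0].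
Qed.

Lemma conj_entries (r y : M2) : \det r = 1 ->
  let c := r *m y *m adj2 r in
  [/\ lA c = lA y * (r 0 0 * r 1 1 + r 0 1 * r 1 0) + lB y * - (r 0 0 * r 1 0)
        + lC y * (r 0 1 * r 1 1),
      c 0 1 = lA y * - (2 * (r 0 0 * r 0 1)) + lB y * (r 0 0 * r 0 0) + lC y * - (r 0 1 * r 0 1),
      c 1 0 = lA y * (2 * (r 1 0 * r 1 1)) + lB y * - (r 1 0 * r 1 0) + lC y * (r 1 1 * r 1 1) &
      c 0 0 + c 1 1 = y 0 0 + y 1 1].
Proof.
rewrite det2 => dr /=; rewrite !lAE !lBE !lCE !mulmx2 !mx2E.
split; first by field.
- by field.
- by field.
- rewrite -[RHS]mulr1 -dr; ring.
Qed.

Lemma conj_sqr (p q s t A B D : C) : p * t - q * s = 1 ->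
  (A * (p * t + q * s) + B * - (p * s) + D * (q * t)) *
  (A * (p * t + q * s) + B * - (p * s) + D * (q * t)) +
  (A * - (2 * (p * q)) + B * (p * p) + D * - (q * q)) *
  (A * (2 * (s * t)) + B * - (s * s) + D * (t * t)) = A * A + B * D.
Proof.
move=> h; transitivity ((p * t - q * s) * (p * t - q * s) * (A * A + B * D)); first by ring.
by rewrite h !mul1r.
Qed.

(** The left hand side is (N y).(z - y), that is (z + y).(z - y) / 2. *)
Lemma euler_numeric (A B D za zb zc naa nab nac nba nbb nbc nca ncb ncc : C) :
  za * za + zb * zc = A * A + B * D ->
  (A + za) / 2 = naa * A + nab * B + nac * D ->
  (B + zb) / 2 = nba * A + nbb * B + nbc * D ->
  (D + zc) / 2 = nca * A + ncb * B + ncc * D ->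
  A * (naa * (za - A) + nba * ((zc - D) / 2) + nca * ((zb - B) / 2)) +
  B * (nab * (za - A) + nbb * ((zc - D) / 2) + ncb * ((zb - B) / 2)) +
  D * (nac * (za - A) + nbc * ((zc - D) / 2) + ncc * ((zb - B) / 2)) = 0.
Proof.
move=> h ha hb hd.
transitivity ((naa * A + nab * B + nac * D) * (za - A) +
  (nba * A + nbb * B + nbc * D) * ((zc - D) / 2) +
  (nca * A + ncb * B + ncc * D) * ((zb - B) / 2)); first by ring.
rewrite -ha -hb -hd.
transitivity ((za * za + zb * zc - (A * A + B * D)) / 2); first by field.
by rewrite h subrr mul0r.
Qed.

Lemma commute_shift (m A B D za zb zc u bb bc v : C) :
  u * A + bb * D = za * u + zb * bc -> u * B - bb * A = za * bb + zb * v ->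
  bc * A + v * D = zc * u - za * bc -> bc * B - v * A = zc * bb - za * v ->
  [/\ u * (m + A) + bb * D = (m + za) * u + zb * bc,
      u * B + bb * (m - A) = (m + za) * bb + zb * v,
      bc * (m + A) + v * D = zc * u + (m - za) * bc &
      bc * B + v * (m - A) = zc * bb + (m - za) * v].
Proof.
move=> h1 h2 h3 h4; split.
- transitivity (m * u + (u * A + bb * D)); [ring|rewrite h1; ring].
- transitivity (m * bb + (u * B - bb * A)); [ring|rewrite h2; ring].
- transitivity (m * bc + (bc * A + v * D)); [ring|rewrite h3; ring].
- transitivity (m * v + (bc * B - v * A)); [ring|rewrite h4; ring].
Qed.

Variables (c r : nat -> M2 -> M2) (d : R).
Local Notation hc := (@hcauchy R M2 x0).
Hypothesis d0 : 0 < d.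
Hypothesis det_r : forall n y, nm (y - x0) < d -> \det (r n y) = 1.
Hypothesis r_ptau : forall n y, nm (y - x0) < d -> r n (ptau y) = 1%:M.
Hypothesis r_diff : forall n i j, differentiable (fun y => r n y i j : C) x0.
Hypothesis cE : forall n y, nm (y - x0) < d -> c n y = r n y *m y *m adj2 (r n y).
Hypothesis hcc : forall i j, hc (fun n y => c n y i j).

Let at_x0 F n : hc F -> differentiable (F n) x0.
Proof. by move=> [s s0 [dF _]]; apply: dF; rewrite subrr nm0. Qed.

Let x0d : nm (x0 - x0) < d. Proof. by rewrite subrr nm0. Qed.

Let r_x0 n : r n x0 = 1%:M.
Proof. by rewrite -(r_ptau n x0d) ptau_scalar. Qed.

(** To first order at a scalar matrix, c is the identity, because r is. *)
Lemma col_z n :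
  [/\ colA (zA (c n)) x0 = 1, colB (zA (c n)) x0 = 0 & colC (zA (c n)) x0 = 0] /\
  [/\ colA (zB (c n)) x0 = 0, colB (zB (c n)) x0 = 1 & colC (zB (c n)) x0 = 0] /\
  [/\ colA (zC (c n)) x0 = 0, colB (zC (c n)) x0 = 0 & colC (zC (c n)) x0 = 1].
Proof.
have dM i j k l : differentiable (fun y => r n y i j * r n y k l) x0.
  by apply: differentiableM; exact: r_diff.
have dN (f : M2 -> C) : differentiable f x0 -> differentiable (fun y => - f y : C) x0.
  exact: differentiableN.
have d2 (f : M2 -> C) : differentiable f x0 -> differentiable (fun y => 2 * f y : C) x0.
  by move=> df; apply: differentiableM => //; exact: differentiable_cst.
have E y yd := conj_entries y (@det_r n y yd).
have fA y (yd : nm (y - x0) < d) : zA (c n) y = _ :=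
  let: And4 e _ _ _ := E y yd in etrans (congr1 lA (cE n yd)) e.
have fB y (yd : nm (y - x0) < d) : zB (c n) y = _ :=
  let: And4 _ e _ _ := E y yd in etrans (congr1 lB (cE n yd)) e.
have fC y (yd : nm (y - x0) < d) : zC (c n) y = _ :=
  let: And4 _ _ e _ := E y yd in etrans (congr1 lC (cE n yd)) e.
have dD : differentiable (fun y => r n y 0 0 * r n y 1 1 + r n y 0 1 * r n y 1 0) x0.
  exact: differentiableD (dM 0 0 1 1) (dM 0 1 1 0).
have := form_col d0 (at_x0 n (hc_zA hcc)) dD
  (dN _ (dM 0 0 1 0)) (dM 0 1 1 1) fA.
have := form_col d0 (at_x0 n (hc_zB hcc)) (dN _ (d2 _ (dM 0 0 0 1)))
  (dM 0 0 0 0) (dN _ (dM 0 1 0 1)) fB.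
have := form_col d0 (at_x0 n (hc_zC hcc)) (d2 _ (dM 1 0 1 1))
  (dN _ (dM 1 0 1 0)) (dM 1 1 1 1) fC.
rewrite /= !r_x0 !scalar2 !(mulr0, mul0r, mulr1, oppr0, addr0).
by move=> [-> -> ->] [-> -> ->] [-> -> ->].
Qed.

Let z_ptau n y : nm (y - x0) < d ->
  [/\ zA (c n) (ptau y) = 0, zB (c n) (ptau y) = 0 & zC (c n) (ptau y) = 0].
Proof.
move=> yd; have pd : nm (ptau y - x0) < d by apply: le_lt_trans (ptau_near _ _) yd.
have E : c n (ptau y) = (tau y)%:M.
  rewrite (cE n pd) r_ptau// mul1mx /ptau.
  by apply: mx2_ext; rewrite mulmx2 !mx2E !scalar2; ring.
by rewrite /zA /zB /zC E lA_scalar !scalar2.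
Qed.

Let d_form n y : nm (y - x0) < d ->
  [/\ dA (c n) y = lA y * (colA (zA (c n)) y - 1) + lB y * colB (zA (c n)) y
        + lC y * colC (zA (c n)) y,
      dB (c n) y = lA y * colA (zB (c n)) y + lB y * (colB (zB (c n)) y - 1)
        + lC y * colC (zB (c n)) y &
      dC (c n) y = lA y * colA (zC (c n)) y + lB y * colB (zC (c n)) y
        + lC y * (colC (zC (c n)) y - 1)].
Proof.
move=> yd; have [hA hB hC] := z_ptau n yd.
have := hadamard (zA (c n)) y; have := hadamard (zB (c n)) y.
have := hadamard (zC (c n)) y; rewrite hA hB hC !addr0.
rewrite /dA /dB /dC; move: (zA _ y) (zB _ y) (zC _ y) => ? ? ? -> -> ->.
split; ring.
Qed.

Let n_form n y : nm (y - x0) < d ->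
  [/\ (lA y + zA (c n) y) / 2 = nAA (c n) y * lA y + nAB (c n) y * lB y + nAC (c n) y * lC y,
      (lB y + zB (c n) y) / 2 = nBA (c n) y * lA y + nBB (c n) y * lB y + nBC (c n) y * lC y &
      (lC y + zC (c n) y) / 2 = nCA (c n) y * lA y + nCB (c n) y * lB y + nCC (c n) y * lC y].
Proof.
move=> yd; have [hA hB hC] := z_ptau n yd.
have := hadamard (zA (c n)) y; have := hadamard (zB (c n)) y.
have := hadamard (zC (c n)) y; rewrite hA hB hC !addr0.
rewrite /nAA /nAB /nAC /nBA /nBB /nBC /nCA /nCB /nCC.
move: (zA _ y) (zB _ y) (zC _ y) => ? ? ? -> -> ->.
split; by field.
Qed.

Let z_sqr n y : nm (y - x0) < d ->
  zA (c n) y * zA (c n) y + zB (c n) y * zC (c n) y = lA y * lA y + lB y * lC y.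
Proof.
move=> yd; have [eA eB eC _] := conj_entries y (det_r n yd).
rewrite /zA /zB /zC (cE n yd) eA eB eC.
by apply: conj_sqr; rewrite -det2 det_r.
Qed.

(** The difference z - y vanishes to second order at scalar matrices, hence so does
any combination of its coordinates. *)
Let w_flat n (N1 N2 N3 : M2 -> C) : differentiable N1 x0 -> differentiable N2 x0 ->
  differentiable N3 x0 -> exists U V W : M2 -> C,
  [/\ differentiable U x0, differentiable V x0 & differentiable W x0] /\
  [/\ U x0 = 0, V x0 = 0, W x0 = 0 & forall y, nm (y - x0) < d ->
     N1 y * dA (c n) y + N2 y * (dC (c n) y / 2) + N3 y * (dB (c n) y / 2) =
     lA y * U y + lB y * V y + lC y * W y].
Proof.
move=> n1 n2 n3; have [[AA AB AC] [[BA BB BC] [CA CB CC]]] := col_z n.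
have dif (u v w : M2 -> C) : differentiable u x0 -> differentiable v x0 -> differentiable w x0 ->
    differentiable (fun y => N1 y * u y + N2 y * (w y / 2) + N3 y * (v y / 2)) x0.
  have hf (g : M2 -> C) : differentiable g x0 -> differentiable (fun y => g y / 2 : C) x0.
    by move=> dg; apply: differentiableM => //; exact: differentiable_cst.
  move=> du dv dw; apply: differentiableD; last exact: differentiableM n3 (hf _ dv).
  by apply: differentiableD; apply: differentiableM => //; exact: hf.
have z1 (g : M2 -> C) : differentiable g x0 -> differentiable (fun y => g y - 1 : C) x0.
  by move=> dg; apply: differentiableB => //; exact: differentiable_cst.
pose comb u v w y : C := N1 y * u y + N2 y * (w y / 2) + N3 y * (v y / 2).
exists (comb (fun y => colA (zA (c n)) y - 1) (colA (zB (c n))) (colA (zC (c n)))).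
exists (comb (colB (zA (c n))) (fun y => colB (zB (c n)) y - 1) (colB (zC (c n)))).
exists (comb (colC (zA (c n))) (colC (zB (c n))) (fun y => colC (zC (c n)) y - 1)).
split.
  split; apply: dif; try apply: z1.
  - exact: (at_x0 n (hc_colA (hc_zA hcc))).
  - exact: (at_x0 n (hc_colA (hc_zB hcc))).
  - exact: (at_x0 n (hc_colA (hc_zC hcc))).
  - exact: (at_x0 n (hc_colB (hc_zA hcc))).
  - exact: (at_x0 n (hc_colB (hc_zB hcc))).
  - exact: (at_x0 n (hc_colB (hc_zC hcc))).
  - exact: (at_x0 n (hc_colC (hc_zA hcc))).
  - exact: (at_x0 n (hc_colC (hc_zB hcc))).
  - exact: (at_x0 n (hc_colC (hc_zC hcc))).
rewrite /comb AA AB AC BA BB BC CA CB CC subrr !(mul0r, mulr0, addr0).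
split=> // y yd; have [-> -> ->] := d_form n yd; ring.
Qed.

Let k_x0 n : [/\ kg (c n) x0 = 0, kh (c n) x0 = 0 & kk (c n) x0 = 0].
Proof.
have [UA [VA [WA [[dUA dVA dWA] [UA0 VA0 WA0 EA]]]]] := w_flat n (at_x0 n (hc_nAA hcc))
  (at_x0 n (hc_nBA hcc)) (at_x0 n (hc_nCA hcc)).
have [UB [VB [WB [[dUB dVB dWB] [UB0 VB0 WB0 EB]]]]] := w_flat n (at_x0 n (hc_nAB hcc))
  (at_x0 n (hc_nBB hcc)) (at_x0 n (hc_nCB hcc)).
have [_ g0 h0] := form_col d0 (at_x0 n (hc_wA hcc)) dUA dVA dWA EA.
have dg := at_x0 n (hc_kg hcc).
have dAx := differentiable_lA x0.
split; [by rewrite -VA0 -g0|by rewrite -WA0 -h0|].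
have EB' y : nm (y - x0) < d -> wB (c n) y + lA y * kg (c n) y =
   lA y * (UB y + kg (c n) y) + lB y * VB y + lC y * WB y.
  by move=> /EB E; rewrite [X in X + _]E; ring.
have [_ _ k0] := form_D d0 (differentiableD (at_x0 n (hc_wB hcc)) (differentiableM dAx dg))
  (differentiableD dUB dg) dVB dWB EB'.
by rewrite -WB0 -k0.
Qed.

Lemma al_x0 n : al (c n) x0 = 1.
Proof.
have [[AA AB AC] [[BA BB BC] [CA CB CC]]] := col_z n.
rewrite /al /nAA /nAB /nAC /nBA /nBB /nBC /nCA /nCB /nCC AA AB AC BA BB BC CA CB CC.
by field.
Qed.

Lemma detq_x0 n : detq (c n) x0 = 1.
Proof.
have [g h k] := k_x0 n; rewrite /detq al_x0 /bA /bB /bC g h k oppr0 !mulr0 !addr0.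
by rewrite subr0 mul0r subr0 mulr1.
Qed.

(** The radius is the same for all n, since it is extracted from the common balls of
families that are [hcauchy]. *)
Theorem gauge_intertwines : exists2 s : R, 0 < s & forall n y, nm (y - x0) < s ->
  \det (gauge (c n) y) = 1 /\ gauge (c n) y *m y = c n y *m gauge (c n) y.
Proof.
have h2 : (0 : R) < 2^-1 by rewrite invr_gt0.
have [r1 r10 al1] := hcauchy_near1 h2 (hc_al hcc) al_x0.
have [r2 r20 dq1] := hcauchy_near1 h2 (hc_detq hcc) detq_x0.
have [rA rA0 [rAd diffA _]] := hcauchy_shrink (hc_wA hcc) d0.
have [rB rB0 [rBA diffB _]] := hcauchy_shrink (hc_wB hcc) rA0.
have [rC rC0 [rCB diffC _]] := hcauchy_shrink (hc_wC hcc) rB0.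
exists (Num.min (rC / 64) (Num.min r1 r2)).
  by rewrite !lt_min r10 r20 divr_gt0.
move=> n y; rewrite !lt_min => /andP[yC /andP[/al1 aly /dq1 dqy]].
have ne0 (z : C) : nm (z - 1) <= 2^-1 -> z != 0.
  move=> h; apply/eqP => z0; move: h; rewrite z0 sub0r nmN nm1; lra.
have sq0 : sqrtc (detq (c n) y) != 0 by rewrite sqrtc_eq0 (ne0 _ (dqy n)).
have yA : nm (y - x0) < rA by apply: lt_le_trans yC _; lra.
have yd : nm (y - x0) < d by apply: lt_le_trans yA rAd.
split.
  rewrite /gauge detZ.
  have -> : \det (q0 (c n) y) = sqrtc (detq (c n) y) ^+ 2.
    by rewrite sqr_sqrtc det2 /q0 !mx2E.
  by rewrite exprVn mulVf// expf_neq0.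
rewrite /gauge -scalemxAl -scalemxAr; congr (_ *: _).
have euler z : nm (z - x0) < rC ->
    lA z * wA (c n) z + lB z * wB (c n) z + lC z * wC (c n) z = 0.
  move=> zC; have zd : nm (z - x0) < d by lra.
  have [nA nB nC] := n_form n zd.
  exact: euler_numeric (z_sqr n zd) nA nB nC.
have wAd z : nm (z - x0) < rC -> differentiable (wA (c n)) z.
  by move=> zC; apply: diffA; lra.
have wBd z : nm (z - x0) < rC -> differentiable (wB (c n)) z.
  by move=> zC; apply: diffB; lra.
have [kA kB kC] := koszul rC0 wAd wBd (diffC n) euler yC.
have two : (2 : C) != 0 by rewrite pnatr_eq0.
have [nA nB nC] := n_form n yd.
have num := @intertwine_numeric C two (lA y) (lB y) (lC y) (zA (c n) y) (zB (c n) y) (zC (c n) y)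
  _ _ _ _ _ _ _ _ _ (kg (c n) y) (kh (c n) y) (kk (c n) y) nA nB nC kA kB kC.
have al0 : al (c n) y != 0 := ne0 _ (aly n).
have {num}num := num al0.
have [E1 E2 E3 E4] : [/\
    (al (c n) y + bA (c n) y) * lA y + bB (c n) y * lC y
      = zA (c n) y * (al (c n) y + bA (c n) y) + zB (c n) y * bC (c n) y,
    (al (c n) y + bA (c n) y) * lB y - bB (c n) y * lA y
      = zA (c n) y * bB (c n) y + zB (c n) y * (al (c n) y - bA (c n) y),
    bC (c n) y * lA y + (al (c n) y - bA (c n) y) * lC y
      = zC (c n) y * (al (c n) y + bA (c n) y) - zA (c n) y * bC (c n) y &
    bC (c n) y * lB y - (al (c n) y - bA (c n) y) * lA y
      = zC (c n) y * bB (c n) y - zA (c n) y * (al (c n) y - bA (c n) y)].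
  exact: num.
have tr : c n y 0 0 + c n y 1 1 = y 0 0 + y 1 1.
  by rewrite (cE n yd); have [] := conj_entries y (det_r n yd).
have c00 : c n y 0 0 = tau y + zA (c n) y.
  by rewrite /zA lAE /tau -tr; field.
have c11 : c n y 1 1 = tau y - zA (c n) y.
  by rewrite /zA lAE /tau -tr; field.
have y00 : y 0 0 = tau y + lA y by rewrite /tau lAE; field.
have y11 : y 1 1 = tau y - lA y by rewrite /tau lAE; field.
have [F1 F2 F3 F4] := commute_shift (tau y) E1 E2 E3 E4.
apply: mx2_ext; rewrite !mulmx2 /q0 !mx2E ?c00 ?c11 ?y00 ?y11.
- exact: F1.
- exact: F2.
- exact: F3.
- exact: F4.
Qed.

Theorem hc_gauge i j : hc (fun n y => gauge (c n) y i j).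
Proof.
have h2 : (0 : R) < 2^-1 by rewrite invr_gt0.
have [r2 r20 dq1] := hcauchy_near1 h2 (hc_detq hcc) detq_x0.
have hs := hcauchyV h2 r20 (fun n y yr => sqrtc_ge (dq1 n y yr))
  (hcauchy_sqrtc r20 dq1 (hc_detq hcc)).
apply: (@hcauchy_eq _ _ _ _ (fun n y => (sqrtc (detq (c n) y))^-1 * q0 (c n) y i j) 1) => //.
  by move=> n y _; rewrite /gauge [RHS]mxE.
exact: (hcauchyM hs (hc_q0 hcc i j)).
Qed.

End GaugeThm.

(** * Convergence up to sign at scalar matrices *)

Section Signs.
Variable R : realType.
Local Notation C := (R[i]).
Local Notation M2 := 'M[C]_2.
Local Notation lA := (lA R).
Local Notation lB := (lB R).
Local Notation lC := (lC R).

Lemma nm_neq0 (z : C) (e : R) : 0 < e -> e <= nm z -> z != 0.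
Proof. by move=> e0 ez; rewrite -nm_eq0 gt_eqF// (lt_le_trans e0). Qed.

(** The Lipschitz constant of a bounded holomorphic function is too small for a jump
from 1 to -1. *)
Lemma rigid_sign (V : normedModType C) (f : V -> C) (x : V) (r : R) : 0 < r ->
  (forall y, nm (y - x) < r -> differentiable f y) ->
  (forall y, nm (y - x) < r -> f y ^+ 2 = 1) ->
  forall y, nm (y - x) < r / 32 -> f y = f x.
Proof.
move=> r0 df f1 y yr; have xr : nm (x - x) < r by rewrite subrr nm0.
have fM z : nm (z - x) < r -> nm (f z) <= 1.
  move=> /f1/(congr1 (@nm R _)); rewrite nmX nm1 => h.
  by move: (nm_ge0 (f z)) h; move: (nm _) => t *; nra.
have y16 : nm (y - x) < r / 16 by move: yr; move: (nm _) => *; lra.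
have := lip_bound r0 df fM y16; rewrite [x + _]addrC subrK mulr1.
have lt1 : 32 / r * nm (y - x) < 1.
  by rewrite mulrAC ltr_pdivrMr//; move: yr; move: (nm _) => *; lra.
move=> /le_lt_trans/(_ lt1) fyx.
have yr1 : nm (y - x) < r by move: yr; move: (nm _) => *; lra.
have : (f y - f x) * (f y + f x) = 0.
  by rewrite -subr_sqr f1// f1// subrr.
move=> /eqP; rewrite mulf_eq0 subr_eq0 => /orP[/eqP//|].
rewrite addr_eq0 => /eqP E; move: fyx; rewrite E -opprD -mulr2n -mulr_natl.
have -> : nm (- (2%:R * f x)) = 2 * nm (f x) by rewrite nmN nmM nm_nat.
have : nm (f x) ^+ 2 = 1 by rewrite -nmX f1// nm1.
move=> h1 h2; exfalso; move: (nm_ge0 (f x)) h1 h2.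
by move: (nm (f x)) => t *; nra.
Qed.

Variable a : C.
Local Notation x0 := (a%:M : M2).
Local Notation hc := (@hcauchy R M2 x0).

Lemma hc_ptau (F : nat -> M2 -> C) : hc F -> hc (fun n y => F n (ptau y)).
Proof.
apply: (hcauchy_comp ltr01); last exact: differentiable_ptau.
by move=> y; rewrite mul1r ptau_near.
Qed.

Variables (p phi : nat -> M2 -> M2) (d : R).
Hypothesis d0 : 0 < d.
Hypothesis det_p : forall n y, nm (y - x0) < d -> \det (p n y) = 1.
Hypothesis p_diff : forall n y, nm (y - x0) < d -> differentiable (p n) y.
Hypothesis phiE : forall n y, nm (y - x0) < d -> phi n y = p n y *m y *m adj2 (p n y).
Hypothesis hc_phi : forall i j, hc (fun n y => phi n y i j).

Local Notation P n y := (p n (ptau y)).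

Lemma det_at_ptau n y : nm (y - x0) < d -> \det (P n y) = 1.
Proof. by move=> yd; apply: det_p; apply: le_lt_trans yd; exact: ptau_near. Qed.

Lemma P_diff n y i j : nm (y - x0) < d -> differentiable (fun z => P n z i j : C) y.
Proof.
move=> yd; have pd : nm (ptau y - x0) < d by apply: le_lt_trans yd; exact: ptau_near.
exact: (differentiable_comp (differentiable_ptau y) (differentiable_entry i j (p_diff n pd))).
Qed.

(** At scalar matrices the derivative of p x p^-1 only sees p, since the derivative
of p is multiplied by a commutator that vanishes. *)
Lemma derivatives_conjugate : exists2 s : R, 0 < s & forall n y, nm (y - x0) < s ->
  [/\ DA (fun z => lA (phi n z)) (ptau y) = P n y 0 0 * P n y 1 1 + P n y 0 1 * P n y 1 0,
      DB (fun z => lA (phi n z)) (ptau y) = - (P n y 0 0 * P n y 1 0) &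
      DC (fun z => lA (phi n z)) (ptau y) = P n y 0 1 * P n y 1 1] /\
  [/\ DA (fun z => phi n z 0 1) (ptau y) = - (2 * (P n y 0 0 * P n y 0 1)),
      DB (fun z => phi n z 0 1) (ptau y) = P n y 0 0 * P n y 0 0 &
      DC (fun z => phi n z 0 1) (ptau y) = - (P n y 0 1 * P n y 0 1)] /\
  [/\ DA (fun z => phi n z 1 0) (ptau y) = 2 * (P n y 1 0 * P n y 1 1),
      DB (fun z => phi n z 1 0) (ptau y) = - (P n y 1 0 * P n y 1 0) &
      DC (fun z => phi n z 1 0) (ptau y) = P n y 1 1 * P n y 1 1].
Proof.
have [r r0 [rd dA _]] := hcauchy_shrink (hc_zA hc_phi) d0.
have [s s0 [sr dB _]] := hcauchy_shrink (hc_zB hc_phi) r0.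
have [t t0 [ts dC _]] := hcauchy_shrink (hc_zC hc_phi) s0.
exists (t / 2) => [|n y yt]; first by rewrite divr_gt0.
have t2 : 0 < t / 2 by rewrite divr_gt0.
set b := tau y; have bt : nm ((b%:M : M2) - x0) < t / 2.
  by apply: le_lt_trans yt; exact: ptau_near.
have in_t z : nm (z - b%:M) < t / 2 -> nm (z - x0) < t.
  by move=> zb; apply: le_lt_trans (nm_tri b%:M _ _) _; lra.
have bb : nm ((b%:M : M2) - b%:M) < t / 2 by rewrite subrr nm0.
have bd : nm ((b%:M : M2) - x0) < d by have := in_t _ bb; lra.
have dM i j k l : differentiable (fun z => p n z i j * p n z k l : C) (b%:M : M2).
  by apply: differentiableM; exact: differentiable_entry (p_diff n bd).
have dN (f : M2 -> C) : differentiable f (b%:M : M2) -> differentiable (fun y => - f y : C) (b%:M : M2).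
  exact: differentiableN.
have d2 (f : M2 -> C) : differentiable f (b%:M : M2) -> differentiable (fun y => 2 * f y : C) (b%:M : M2).
  by move=> df; apply: differentiableM => //; exact: differentiable_cst.
have dD : differentiable (fun y => p n y 0 0 * p n y 1 1 + p n y 0 1 * p n y 1 0) (b%:M : M2).
  exact: differentiableD (dM 0 0 1 1) (dM 0 1 1 0).
have zd z : nm (z - b%:M) < t / 2 -> nm (z - x0) < d by move=> /in_t; lra.
have E z (zt : nm (z - b%:M) < t / 2) := conj_entries z (@det_p n z (zd z zt)).
have fA z (zt : nm (z - b%:M) < t / 2) : zA (phi n) z = _ :=
  let: And4 e _ _ _ := E z zt in etrans (congr1 lA (phiE n (zd z zt))) e.
have fB z (zt : nm (z - b%:M) < t / 2) : zB (phi n) z = _ :=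
  let: And4 _ e _ _ := E z zt in etrans (congr1 lB (phiE n (zd z zt))) e.
have fC z (zt : nm (z - b%:M) < t / 2) : zC (phi n) z = _ :=
  let: And4 _ _ e _ := E z zt in etrans (congr1 lC (phiE n (zd z zt))) e.
have bt1 := in_t _ bb.
have bs : nm ((b%:M : M2) - x0) < s by lra.
have br : nm ((b%:M : M2) - x0) < r by lra.
split; first exact: (form_D t2 (dA n _ br) dD (dN _ (dM 0 0 1 0)) (dM 0 1 1 1) fA).
split.
  exact: (form_D t2 (dB n _ bs) (dN _ (d2 _ (dM 0 0 0 1))) (dM 0 0 0 0) (dN _ (dM 0 1 0 1)) fB).
exact: (form_D t2 (dC n _ bt1) (d2 _ (dM 1 0 1 1)) (dN _ (dM 1 0 1 0)) (dM 1 1 1 1) fC).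
Qed.

(** The derivatives of the conjugates give all the products but p00 p11 and p01 p10,
of which they give the sum; the determinant gives the difference. *)
Lemma hc_products i j k l : hc (fun n y => P n y i j * P n y k l).
Proof.
have [s s0 E] := derivatives_conjugate.
have hA := hc_zA hc_phi; have hB := hc_zB hc_phi; have hC := hc_zC hc_phi.
have mk F G : hc F -> (forall n y, nm (y - x0) < Num.min s d -> F n (ptau y) = G n y) -> hc G.
  move=> hF FG; apply: (hcauchy_eq _ FG (hc_ptau hF)).
  by rewrite lt_min s0.
have half (z w : C) : z = 2 * w -> z / 2 = w by move=> ->; field.
have nhalf (z w : C) : z = - (2 * w) -> - z / 2 = w by move=> ->; field.
have hs (s1 t u : C) : s1 - t = 1 -> u = s1 + t -> (1 + u) / 2 = s1.
  by move=> /eqP; rewrite subr_eq => /eqP-> ->; field.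
have ht (s1 t u : C) : s1 - t = 1 -> u = s1 + t -> (u - 1) / 2 = t.
  by move=> /eqP; rewrite subr_eq => /eqP-> ->; field.
have opp (z w : C) : z = - w -> - z = w by move=> ->; rewrite opprK.
have hh F : hc F -> hc (fun n y => F n y / 2) by exact: hc_half.
have minP y : nm (y - x0) < Num.min s d -> nm (y - x0) < s /\ nm (y - x0) < d.
  by rewrite lt_min => /andP[].
have q0011 : hc (fun n y => P n y 0 0 * P n y 1 1).
  apply: (mk (fun n y => (1 + DA (zA (phi n)) y) / 2)); first exact: hc_half1 (hc_DA hA).
  move=> n y /minP[/(E n)[[e _ _] _] /(det_at_ptau n)]; rewrite det2 => dt.
  exact: hs dt e.
have q0110 : hc (fun n y => P n y 0 1 * P n y 1 0).
  apply: (mk (fun n y => (DA (zA (phi n)) y - 1) / 2)).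
    by apply: hc_half; apply: hcauchyB; [exact: hc_DA hA|exact: hcauchy_cst].
  move=> n y /minP[/(E n)[[e _ _] _] /(det_at_ptau n)]; rewrite det2 => dt.
  exact: ht dt e.
have q0010 : hc (fun n y => P n y 0 0 * P n y 1 0).
  apply: (mk _ _ (hcauchyN (hc_DB hA))) => n y /minP[/(E n)[[_ e _] _] _]; exact: opp e.
have q0111 : hc (fun n y => P n y 0 1 * P n y 1 1).
  by apply: (mk _ _ (hc_DC hA)) => n y /minP[/(E n)[[_ _ e] _] _]; exact: e.
have q0001 : hc (fun n y => P n y 0 0 * P n y 0 1).
  apply: (mk _ _ (hh _ (hcauchyN (hc_DA hB)))) => n y /minP[/(E n)[_ [[e _ _] _]] _].
  exact: nhalf e.
have q0000 : hc (fun n y => P n y 0 0 * P n y 0 0).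
  by apply: (mk _ _ (hc_DB hB)) => n y /minP[/(E n)[_ [[_ e _] _]] _]; exact: e.
have q0101 : hc (fun n y => P n y 0 1 * P n y 0 1).
  apply: (mk _ _ (hcauchyN (hc_DC hB))) => n y /minP[/(E n)[_ [[_ _ e] _]] _]; exact: opp e.
have q1011 : hc (fun n y => P n y 1 0 * P n y 1 1).
  apply: (mk _ _ (hh _ (hc_DA hC))) => n y /minP[/(E n)[_ [_ [e _ _]]] _]; exact: half e.
have q1010 : hc (fun n y => P n y 1 0 * P n y 1 0).
  apply: (mk _ _ (hcauchyN (hc_DB hC))) => n y /minP[/(E n)[_ [_ [_ e _]]] _]; exact: opp e.
have q1111 : hc (fun n y => P n y 1 1 * P n y 1 1).
  by apply: (mk _ _ (hc_DC hC)) => n y /minP[/(E n)[_ [_ [_ _ e]]] _]; exact: e.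
have sw F G : hc (fun n y => F n y * G n y) -> hc (fun n y => G n y * F n y).
  by move=> h; apply: (hcauchy_eq ltr01 _ h) => n y _; exact: mulrC.
have o2 (m : 'I_2) : m = 0 \/ m = 1.
  by case: m => [[|[|//]] m1]; [left|right]; exact: val_inj.
have [->|->] := o2 i; have [->|->] := o2 j; have [->|->] := o2 k; have [->|->] := o2 l;
  first [exact: q0000|exact: q0001|exact: q0010|exact: q0011|exact: q0101|exact: q0110
        |exact: q0111|exact: q1010|exact: q1011|exact: q1111|apply: sw].
all: first [exact: q0001|exact: q0010|exact: q0011|exact: q0110
        |exact: q0111|exact: q1011].
Qed.

End Signs.

Section Entries.
Variable R : realType.

Lemma ord2P (m : 'I_2) : m = 0 \/ m = 1.
Proof. by case: m => [[|[|//]] m1]; [left|right]; exact: val_inj. Qed.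

Lemma entries_rank (P : 'I_2 -> 'I_2 -> nat -> Prop) :
  (forall i j m n, (m <= n)%N -> P i j m -> P i j n) ->
  (forall i j, exists N, P i j N) -> exists N, forall i j, P i j N.
Proof.
move=> mono H; have [N00 h00] := H 0 0; have [N01 h01] := H 0 1.
have [N10 h10] := H 1 0; have [N11 h11] := H 1 1.
pose N := maxn (maxn N00 N01) (maxn N10 N11).
have [N1 N2 N3 N4] : [/\ (N00 <= N)%N, (N01 <= N)%N, (N10 <= N)%N & (N11 <= N)%N].
  by rewrite !leq_max !leqnn !orbT.
exists N => i j; have [->|->] := ord2P i; have [->|->] := ord2P j.
- exact: mono h00.
- exact: mono h01.
- exact: mono h10.
- exact: mono h11.
Qed.

Lemma entries_radius (P : 'I_2 -> 'I_2 -> R -> Prop) :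
  (forall i j r s, s <= r -> P i j r -> P i j s) ->
  (forall i j, exists2 r, 0 < r & P i j r) -> exists2 r, 0 < r & forall i j, P i j r.
Proof.
move=> mono H; have [a a0 ha] := H 0 0; have [b b0 hb] := H 0 1.
have [c c0 hc] := H 1 0; have [d d0 hd] := H 1 1.
pose r := Num.min (Num.min a b) (Num.min c d).
have [ra rb rc rd] : [/\ r <= a, r <= b, r <= c & r <= d].
  by rewrite /r !ge_min !lexx !orbT.
exists r; first by rewrite !lt_min a0 b0 c0.
move=> i j; have [->|->] := ord2P i; have [->|->] := ord2P j.
- exact: mono ha.
- exact: mono hb.
- exact: mono hc.
- exact: mono hd.
Qed.

End Entries.

Section LocalSign.
Variable R : realType.
Local Notation C := (R[i]).
Local Notation M2 := 'M[C]_2.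
Variable a : C.
Local Notation x0 := (a%:M : M2).
Local Notation hc := (@hcauchy R M2 x0).

Lemma det1_large (x : M2) : \det x = 1 -> exists i j, 2^-1 <= nm (x i j * x i j).
Proof.
rewrite det2 => dx.
have := nmB (x 0 0 * x 1 1) (x 0 1 * x 1 0); rewrite dx nm1 !nmM => h.
have [h00|h00] := leP 2^-1 (nm (x 0 0 * x 0 0)); first by exists 0, 0.
have [h01|h01] := leP 2^-1 (nm (x 0 1 * x 0 1)); first by exists 0, 1.
have [h10|h10] := leP 2^-1 (nm (x 1 0 * x 1 0)); first by exists 1, 0.
have [h11|h11] := leP 2^-1 (nm (x 1 1 * x 1 1)); first by exists 1, 1.
move: h h00 h01 h10 h11; rewrite !nmM; move: (nm _) (nm _) (nm _) (nm _) => p q s t.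
have sq (u v : R) : u * u < 2^-1 -> v * v < 2^-1 -> u * v < 2^-1 by move=> *; nra.
by move=> h hp hq hs ht; have := sq _ _ hp ht; have := sq _ _ hq hs; lra.
Qed.

Variables (P : nat -> M2 -> M2) (d : R).
Hypothesis d0 : 0 < d.
Hypothesis det_P : forall n y, nm (y - x0) < d -> \det (P n y) = 1.
Hypothesis P_diff : forall n y i j, nm (y - x0) < d -> differentiable (fun z => P n z i j : C) y.
Hypothesis hcP : forall i j k l, hc (fun n y => P n y i j * P n y k l).

(** One of the four squared entries is bounded below at the centre for n = N, and by
the Cauchy property it stays close to that value for larger n. *)
Lemma pivot : exists i j N, 2^-1 <= nm (P N x0 i j * P N x0 i j) /\
  exists2 r : R, 0 < r & forall n y, (N <= n)%N -> nm (y - x0) < r ->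
    nm (P n y i j * P n y i j / (P N x0 i j * P N x0 i j) - 1) <= 2^-1.
Proof.
have e8 : (0 : R) < 8^-1 by rewrite invr_gt0.
have [r r0 rP] : exists2 r : R, 0 < r & forall i j, exists N, forall n m y,
    (N <= n)%N -> (N <= m)%N -> nm (y - x0) < r ->
    nm (P n y i j * P n y i j - P m y i j * P m y i j) <= 8^-1.
  apply: entries_radius => [i j r s sr [N HN]|i j].
    by exists N => n m y Nn Nm ys; apply: HN => //; exact: lt_le_trans sr.
  by have [r r0 [_ /(_ _ e8)[N HN]]] := hcP i j i j; exists r => //; exists N.
have [N H] : exists N, forall i j n m y, (N <= n)%N -> (N <= m)%N -> nm (y - x0) < r ->
    nm (P n y i j * P n y i j - P m y i j * P m y i j) <= 8^-1.
  apply: entries_rank rP => i j N N' NN H n m y Nn Nm.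
  by apply: H; [exact: leq_trans Nn|exact: leq_trans Nm].
have x0d : nm (x0 - x0) < d by rewrite subrr nm0.
have [i [j hij]] := det1_large (det_P N x0d).
exists i, j, N; split; first exact: hij.
have dN : differentiable (fun y => P N y i j * P N y i j : C) x0.
  by apply: differentiableM; exact: P_diff.
have := differentiable_continuous dN => /continuous_nm/(_ _ e8)[s sp Hs].
exists (Num.min r s) => [|n y Nn]; first by rewrite lt_min r0.
rewrite lt_min => /andP[yr ys].
have := Hs y; rewrite nmBC => /(_ ys); have := H i j n N y Nn (leqnn N) yr.
move: hij; set w0 := P N x0 i j * _; move=> hw.
have w00 : w0 != 0.
  by apply: nm_neq0 hw; rewrite invr_gt0.
move=> h1 h2.
have := nm_tri (P N y i j * P N y i j) (P n y i j * P n y i j) w0.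
move=> h3.
rewrite -[X in _ - X](divff w00) -mulrBl nmM nmV ler_pdivrMr; last first.
  by apply: lt_le_trans hw; rewrite invr_gt0.
set q := P n y i j * P n y i j in h1 h3 *; set q' := P N y i j * P N y i j in h1 h2 h3.
move: h1 h2 h3 hw; rewrite ?(nmBC w0 q') ?(nmBC w0 q) ?(nmBC q' q).
by move: (nm (q - q')) (nm (q' - w0)) (nm (q - w0)) (nm w0) => *; lra.
Qed.

(** A square root S of the normalized squared pivot is chosen near one, where it is
[hcauchy]; the pivot is then +-c S with a sign that does not depend on y, and
multiplying the row of products by 1 / (c S) recovers all entries up to that
sign. *)
Lemma local_sign : exists sg : nat -> C, (forall n, sg n * sg n = 1) /\
  forall k l, hc (fun n y => sg n * P n y k l).
Proof.
have [i [j [N [hN [r r0 G1]]]]] := pivot.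
set w0 := P N x0 i j * P N x0 i j in hN G1.
have w00 : w0 != 0 by apply: nm_neq0 hN; rewrite invr_gt0.
pose c := sqrtc w0; have cc : c ^+ 2 = w0 by exact: sqr_sqrtc.
have c0 : c != 0 by rewrite sqrtc_eq0.
pose G n y := P (maxn n N) y i j * P (maxn n N) y i j / w0.
have hG : hc G.
  exact: (hcauchyM (hcauchy_max N (hcP i j i j)) (hcauchy_cst _ _)).
have {}G1 n y : nm (y - x0) < r -> nm (G n y - 1) <= 2^-1.
  by move=> yr; apply: G1 yr; exact: leq_maxr.
pose S n y := sqrtc (G n y).
have h2 : (0 : R) < 2^-1 by rewrite invr_gt0.
have Sge n y (yr : nm (y - x0) < r) : 2^-1 <= nm (S n y) := sqrtc_ge (G1 n y yr).
have hS := hcauchyV h2 r0 Sge (hcauchy_sqrtc r0 G1 hG).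
pose I n y := c^-1 * (S n y)^-1.
have hI : hc I by exact: (hcauchyZ c^-1 hS).
have rd : 0 < Num.min r d by rewrite lt_min r0.
have [s s0 [srd dI _]] := hcauchy_shrink hI rd.
have [sr sd] : s <= r /\ s <= d by move: srd; rewrite le_min => /andP[].
pose f n y := P n y i j * I n y.
have df n y : nm (y - x0) < s -> differentiable (f n) y.
  move=> ys; apply: differentiableM; last exact: dI.
  by apply: P_diff; exact: lt_le_trans sd.
have f1 n y : (N <= n)%N -> nm (y - x0) < s -> f n y ^+ 2 = 1.
  move=> Nn ys; have yr : nm (y - x0) < r by exact: lt_le_trans sr.
  have S0 : S n y != 0 := nm_neq0 h2 (Sge n y yr).
  have GE : S n y ^+ 2 = P n y i j ^+ 2 / c ^+ 2.
    by rewrite /S sqr_sqrtc /G (maxn_idPl Nn) cc -expr2.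
  have P2 : P n y i j ^+ 2 = S n y ^+ 2 * c ^+ 2 by rewrite GE divfK// expf_neq0.
  rewrite /f /I !exprMn P2 !exprVn -invfM [X in X^-1]mulrC mulfV// mulf_neq0//.
    exact: expf_neq0.
  exact: expf_neq0.
have s32 : 0 < s / 32 by rewrite divr_gt0.
have x0s : nm (x0 - x0) < s by rewrite subrr nm0.
exists (fun n => if (N <= n)%N then f n x0 else 1); split.
  by move=> n; case: ifP => Nn; [rewrite -expr2 f1|rewrite mulr1].
move=> k l; apply: (@hcauchy_eventually _ _ _ _ (fun n y => P n y i j * P n y k l * I n y) (s / 32) N s32).
- move=> n y ys; apply: differentiableM; first exact: differentiable_cst.
  by apply: P_diff; apply: lt_le_trans ys _; apply: le_trans sd; lra.
- move=> n y Nn ys; rewrite Nn -(rigid_sign s0 (df n) (fun z => f1 n z Nn) ys).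
  by rewrite /f mulrAC.
- exact: (hcauchyM (hcP i j k l) hI).
Qed.

End LocalSign.

Section Glue.
Variable R : realType.
Local Notation C := (R[i]).
Local Notation M2 := 'M[C]_2.
Variable P : nat -> M2 -> M2.

Let good_sign (sg : nat -> C) (b : C) :=
  forall k l, @hcauchy R M2 b%:M (fun n y => sg n * P n y k l).

Lemma good_sign_near sg b : good_sign sg b -> exists2 r : R, 0 < r &
  forall b', nm (b' - b) < r -> good_sign sg b'.
Proof.
move=> H; have [r r0 rP] : exists2 r : R, 0 < r & forall k l (y : M2),
    nm (y - b%:M) < r -> hcauchy y (fun n y => sg n * P n y k l).
  apply: entries_radius => [k l r s sr h y ys|k l]; last exact: hcauchy_near (H k l).
  by apply: h; exact: lt_le_trans sr.
exists r => [|b' bb k l]; first exact: r0.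
by apply: rP; rewrite -raddfB /=; apply: le_lt_trans (nm_scalar _) bb.
Qed.

(** The ratio of the two signs is Cauchy, as it can be computed at b' from the
determinant. *)
Lemma good_sign_transfer ep sg b b' : (forall n, sg n * sg n = 1) ->
  (forall n, \det (P n b'%:M) = 1) ->
  good_sign ep b' -> good_sign sg b' -> good_sign sg b -> good_sign ep b.
Proof.
move=> sg1 det_P eb' sb' sb k l.
have cs : cseq (fun n => ep n * sg n).
  have := hcauchy_at (hcauchyB (hcauchyM (eb' 0 0) (sb' 1 1)) (hcauchyM (eb' 0 1) (sb' 1 0))).
  set u := (X in cseq X); rewrite (_ : u = fun n => ep n * sg n)//.
  apply/funext => n; rewrite /u.
  transitivity (ep n * sg n * \det (P n b'%:M)); last by rewrite det_P mulr1.
  by rewrite det2; ring.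
apply: (hcauchy_eq ltr01 _ (hcauchyM (hcauchy_seq _ cs) (sb k l))) => n y _.
by rewrite mulrA -(mulrA (ep n)) sg1 mulr1.
Qed.

(** The interval is connected. *)
Lemma real_locally_constant (Q : R -> Prop) :
  (forall t, `[0, 1]%classic t -> exists2 r : R, 0 < r & forall s s',
     `[0, 1]%classic s -> `[0, 1]%classic s' -> `|s - t| < r -> `|s' - t| < r ->
     Q s -> Q s') ->
  Q 0 -> forall t, `[0, 1]%classic t -> Q t.
Proof.
move=> H Q0; pose I : set R := `[0, 1]%classic.
pose near_all (D : R -> Prop) : set R := \bigcup_(tr in
  [set tr : R * R | 0 < tr.2 /\ forall s, I s -> `|s - tr.1| < tr.2 -> D s])
  ball tr.1 tr.2.
have open_near D : open (near_all D).
  by apply: bigcup_open => tr [tr0 _]; exact: ball_open.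
have near_sub D s : I s -> near_all D s -> D s.
  by move=> Is [tr [_ h]] /=; rewrite /ball/= distrC; exact: h.
have near_mem (D : R -> Prop) : (forall t r s', I t -> 0 < r -> True) -> True by [].
suff : [set t | I t /\ Q t] = I by move=> E t It; have : I t by []; rewrite -E => -[].
apply: (@segment_connected R 0 1).
- by exists 0; split => //; rewrite /I /= in_itv /= lexx ler01.
- exists (near_all Q) => //; apply/seteqP; split => t [It] h; split => //.
    have [r r0 Hr] := H t It; exists (t, r) => /=; last exact: ballxx.
    by split => // s Is st; apply: (Hr t s) => //; rewrite subrr normr0.
  exact: near_sub h.
- exists (~` near_all (fun t => ~ Q t)); first exact/open_closedC.
  apply/seteqP; split => t [It] h; split => //.
    by move=> /(near_sub _ _ It).
  apply: contrapT => nQ; apply: h.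
  have [r r0 Hr] := H t It; exists (t, r) => /=; last exact: ballxx.
  split => // s Is st Qs; apply: nQ; apply: (Hr s t) => //; by rewrite subrr normr0.
Qed.

Hypothesis loc : forall b : C, nm b < 1 -> exists sg : nat -> C,
  (forall n, sg n * sg n = 1) /\ good_sign sg b.
Hypothesis det_P : forall n b, nm b < 1 -> \det (P n b%:M) = 1.

(** The sign chosen at 0 is propagated along the segment to b. *)
Theorem global_sign : exists ep : nat -> C, (forall n, ep n * ep n = 1) /\
  forall b, nm b < 1 -> good_sign ep b.
Proof.
have n0 : nm (0 : C) < 1 by rewrite nm0 ltr01.
have [ep [ep1 ep0]] := loc n0; exists ep; split; first exact: ep1.
move=> b b1.
have in1 t : `[0, 1]%classic t -> nm (t%:C%C * b) < 1.
  rewrite /= in_itv /= => /andP[t0 t1]; rewrite nmM nmR ger0_norm//.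
  by apply: le_lt_trans b1; rewrite ler_piMl ?nm_ge0.
have I0 : `[0, 1]%classic (0 : R) by rewrite /= in_itv /= lexx ler01.
have I1 : `[0, 1]%classic (1 : R) by rewrite /= in_itv /= lexx ler01.
suff /(_ 1 I1) : forall t : R, `[0, 1]%classic t -> good_sign ep (t%:C%C * b).
  by rewrite mul1r.
apply: real_locally_constant; last by rewrite mul0r.
move=> t /in1 tb1; have [sg [sg1 sgt]] := loc tb1.
have [r r0 Hr] := good_sign_near sgt; exists r; first exact: r0.
move=> s s' Is Is' st st'.
have near s0 : `|s0 - t| < r -> nm (s0%:C%C * b - t%:C%C * b) < r.
  move=> h; rewrite -mulrBl -raddfB nmM nmR; apply: le_lt_trans h.
  by rewrite ler_piMr// ltW.
move=> es; apply: (@good_sign_transfer ep sg _ (s%:C%C * b) sg1 _ es).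
- by move=> n; apply: det_P; exact: in1.
- by apply: Hr; exact: near.
- by apply: Hr; exact: near.
Qed.

End Glue.

Lemma mxB_entry (R : realType) (A B : 'M[R[i]]_2) i j : (A - B) i j = A i j - B i j.
Proof. by rewrite !mxE. Qed.

(** * Families of matrices *)

Section MatrixFamilies.
Variable R : realType.
Local Notation C := (R[i]).
Local Notation M2 := 'M[C]_2.
Implicit Types (A B : M2 -> M2) (x y : M2).

Let dm A x := forall i j, differentiable (fun y => A y i j : C) x.

Lemma differentiable_mulmx A B x : dm A x -> dm B x -> dm (fun y => A y *m B y) x.
Proof.
move=> dA dB i j; rewrite (_ : (fun y => _) = fun y => A y i 0 * B y 0 j + A y i 1 * B y 1 j).
  by apply: differentiableD; apply: differentiableM; [exact: dA|exact: dB|exact: dA|exact: dB].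
by apply/funext => y; rewrite mulmx2.
Qed.

Lemma adj2E x : (adj2 x 0 0 = x 1 1) * (adj2 x 0 1 = - x 0 1) *
  (adj2 x 1 0 = - x 1 0) * (adj2 x 1 1 = x 0 0).
Proof. by rewrite /adj2 !mx2E. Qed.

Lemma differentiable_adj2 A x : dm A x -> dm (fun y => adj2 (A y)) x.
Proof.
move=> dA i j; have dN k l : differentiable (fun y => - A y k l : C) x.
  by apply: differentiableN; exact: dA.
have [->|->] := ord2P i; have [->|->] := ord2P j; under eq_fun do rewrite adj2E.
- exact: dA.
- exact: dN.
- exact: dN.
- exact: dA.
Qed.

Lemma adj2K x : adj2 (adj2 x) = x.
Proof. by apply: mx2_ext; rewrite !adj2E ?opprK. Qed.

Lemma adj2M x y : adj2 (x *m y) = adj2 y *m adj2 x.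
Proof. by apply: mx2_ext; rewrite !(adj2E, mulmx2); ring. Qed.

Lemma adj2Z (c : C) x : adj2 (c *: x) = c *: adj2 x.
Proof.
have Z (z : M2) i j : (c *: z) i j = c * z i j by rewrite mxE.
by apply: mx2_ext; rewrite !(adj2E, Z) ?mulrN.
Qed.

Lemma mul_adj2 x : \det x = 1 -> x *m adj2 x = 1%:M.
Proof.
by move=> dx; rewrite -adj2_inv// mulmxV// unitmxE dx unitr1.
Qed.

Lemma adj2_mul x : \det x = 1 -> adj2 x *m x = 1%:M.
Proof.
by move=> dx; rewrite -adj2_inv// mulVmx// unitmxE dx unitr1.
Qed.

Lemma det_adj2 x : \det (adj2 x) = \det x.
Proof. by rewrite !det2 !adj2E; ring. Qed.

Variable x0 : M2.
Let hcm (F : nat -> M2 -> M2) := forall i j, hcauchy x0 (fun n y => F n y i j : C).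

Lemma hcauchy_mulmx F G : hcm F -> hcm G -> hcm (fun n y => F n y *m G n y).
Proof.
move=> hF hG i j; apply: (hcauchy_eq ltr01 _
  (hcauchyD (hcauchyM (hF i 0) (hG 0 j)) (hcauchyM (hF i 1) (hG 1 j)))) => n y _.
by rewrite mulmx2.
Qed.

Lemma hcauchy_adj2 F : hcm F -> hcm (fun n y => adj2 (F n y)).
Proof.
move=> hF i j; have [->|->] := ord2P i; have [->|->] := ord2P j.
- by apply: (hcauchy_eq ltr01 _ (hF 1 1)) => n y _; rewrite adj2E.
- by apply: (hcauchy_eq ltr01 _ (hcauchyN (hF 0 1))) => n y _; rewrite adj2E.
- by apply: (hcauchy_eq ltr01 _ (hcauchyN (hF 1 0))) => n y _; rewrite adj2E.
- by apply: (hcauchy_eq ltr01 _ (hF 0 0)) => n y _; rewrite adj2E.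
Qed.

Lemma hcauchy_mx_shrink F r0 : hcm F -> 0 < r0 -> exists2 r : R, 0 < r &
  r <= r0 /\ forall n y, nm (y - x0) < r -> dm (F n) y.
Proof.
move=> hF r00; have [r rp rP] : exists2 r : R, 0 < r & forall i j, r <= r0 /\
    forall n y, nm (y - x0) < r -> differentiable (fun y => F n y i j : C) y.
  apply: entries_radius => [i j r s sr [rr0 dF]|i j].
    by split=> [|n y ys]; [exact: le_trans rr0|apply: dF; exact: lt_le_trans sr].
  by have [r rp [rr0 dF _]] := hcauchy_shrink (hF i j) r00; exists r.
exists r; first exact: rp.
split=> [|n y yr i j]; first exact: (proj1 (rP 0 0)).
exact: (proj2 (rP i j)).
Qed.

Lemma hcauchy_mx_near F : hcm F -> exists2 r : R, 0 < r &
  forall y, nm (y - x0) < r -> forall i j, hcauchy y (fun n z => F n z i j : C).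
Proof.
move=> hF; have [r r0 rP] : exists2 r : R, 0 < r & forall i j y, nm (y - x0) < r ->
    hcauchy y (fun n z => F n z i j : C).
  apply: entries_radius => [i j r s sr h y ys|i j]; last exact: hcauchy_near (hF i j).
  by apply: h; exact: lt_le_trans sr.
exists r => [|y yr i j]; first exact: r0.
exact: rP.
Qed.

Definition mxlim (F : nat -> M2 -> M2) y : M2 :=
  \matrix_(i, j) hlim (fun n y => F n y i j) y.

Lemma hcauchy_mxlim F : hcm F -> exists2 r : R, 0 < r &
  (forall y, nm (y - x0) < r -> differentiable (mxlim F) y) /\
  (forall e : R, 0 < e -> exists N, forall n y, (N <= n)%N -> nm (y - x0) < r ->
     nm (mxlim F y - F n y) < e).
Proof.
move=> hF; pose G i j n y : C := F n y i j.
have [r r0 rP] : exists2 r : R, 0 < r & forall i j,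
    (forall y, nm (y - x0) < r -> differentiable (hlim (G i j)) y) /\
    (forall e : R, 0 < e -> exists N, forall n y, (N <= n)%N -> nm (y - x0) < r ->
      nm (G i j n y - hlim (G i j) y) <= e).
  apply: entries_radius => [i j r s sr [dG uG]|i j]; last exact: hcauchy_lim (hF i j).
  split=> [y ys|e /uG[N HN]]; first by apply: dG; exact: lt_le_trans sr.
  by exists N => n y Nn ys; apply: HN => //; exact: lt_le_trans sr.
exists r; first exact: r0.
split=> [y yr|e e0].
  apply: differentiable_mx2 => i j; under eq_fun do rewrite mxE.
  exact: (proj1 (rP i j) y yr).
have e2 : 0 < e / 2 by rewrite divr_gt0.
have [N HN] : exists N, forall i j n y, (N <= n)%N -> nm (y - x0) < r ->
    nm (G i j n y - hlim (G i j) y) <= e / 2.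
  apply: entries_rank => [i j M N MN H n y Nn|i j]; last exact: (proj2 (rP i j) _ e2).
  by apply: H; exact: leq_trans Nn.
exists N => n y Nn yr; apply: (@le_lt_trans _ _ (e / 2)); last by lra.
apply: nm_mxle => [|i j]; first exact: ltW.
by rewrite mxB_entry nmBC [mxlim F y i j]mxE; exact: HN.
Qed.

End MatrixFamilies.

Lemma limit_det (K : numFieldType) (u v w z : nat -> K) (a b c d : K) :
  u @ \oo --> a -> v @ \oo --> b -> w @ \oo --> c -> z @ \oo --> d ->
  (forall n, u n * z n - v n * w n = 1) -> a * d - b * c = 1.
Proof.
move=> ua vb wc zd E.
have h : (fun n => u n * z n - v n * w n) @ \oo --> a * d - b * c.
  by apply: cvgB; apply: cvgM.
rewrite (_ : (fun n => _) = fun=> 1) in h; last exact/funext.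
exact: (cvg_unique _ h (cvg_cst _)).
Qed.

Lemma det_mxlim (R : realType) (F : nat -> 'M[R[i]]_2 -> 'M[R[i]]_2) y :
  (forall i j, hcauchy y (fun n x => F n x i j : R[i])) ->
  (forall n, \det (F n y) = 1) -> \det (mxlim F y) = 1.
Proof.
move=> hF dF; rewrite det2 !mxE.
have c i j := cseq_lim (hcauchy_at (hF i j)).
apply: (limit_det (c 0 0) (c 0 1) (c 1 0) (c 1 1)) => n.
by rewrite -(dF n) det2.
Qed.

(** * Matrices commuting with x *)

Section Commutant.
Variable R : realType.
Local Notation C := (R[i]).
Local Notation M2 := 'M[C]_2.
Local Notation lA := (lA R).
Local Notation lB := (lB R).
Local Notation lC := (lC R).
Variable a : C.
Local Notation x0 := (a%:M : M2).

(** Commuting means that the traceless part of K y is parallel to that of y.  Its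
B-coordinate vanishes where that of y does, so it is divisible by it, and the
quotient is the factor of proportionality for the other coordinates as well. *)
Lemma commutant (K : M2 -> M2) (s : R) : 0 < s ->
  (forall y, nm (y - x0) < s -> forall i j, differentiable (fun z => K z i j : C) y) ->
  (forall y, nm (y - x0) < s -> K y *m y = y *m K y) ->
  let b := DB (fun z => K z 0 1) in
  forall y, nm (y - x0) < s / 8 -> K y = (tau (K y) - b y * tau y)%:M + b y *: y.
Proof.
move=> s0 dK cK b y ys.
have ZBs z t : nm (z - x0) < t / 2 -> nm (ZB z - x0) < t.
  by move=> zr; apply: le_lt_trans (nm_ZB a z) _; lra.
have co z : nm (z - x0) < s -> lB z * K z 1 0 = lC z * K z 0 1 /\
    lB z * lA (K z) = K z 0 1 * lA z.
  move=> /cK E; have e00 : (K z *m z) 0 0 = (z *m K z) 0 0 by rewrite E.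
  have e01 : (K z *m z) 0 1 = (z *m K z) 0 1 by rewrite E.
  rewrite !mulmx2 in e00 e01; rewrite !lAE !lBE !lCE.
  move: e00 e01; move: (K z 0 0) (K z 0 1) (K z 1 0) (K z 1 1) (z 0 0) (z 0 1) (z 1 0) (z 1 1).
  move=> k00 k01 k10 k11 z00 z01 z10 z11 e00 e01.
  have h1 : z01 * k10 = z10 * k01.
    apply/eqP; rewrite -subr_eq0; apply/eqP.
    transitivity (z00 * k00 + z01 * k10 - (k00 * z00 + k01 * z10)); first by ring.
    by rewrite e00 subrr.
  split=> //; apply/eqP; rewrite -subr_eq0; apply/eqP.
  transitivity ((k00 * z01 + k01 * z11 - (z00 * k01 + z01 * k11)) / 2); first by field.
  by rewrite e01 subrr mul0r.
have kB0 z : nm (z - x0) < s / 2 / 2 -> K (ZB z) 0 1 = 0.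
  apply: (@cancel_ball R M2 x0 lC (eC R) (s / 2) (fun z => K (ZB z) 0 1) (lC_e R)).
    move=> u us; exact: (differentiable_comp (differentiable_ZB u) (dK _ (ZBs _ _ us) 0 1)).
  move=> u us; have [+ _] := co _ (ZBs _ _ us).
  by move=> /esym; rewrite lC_ZB lB_ZB mul0r.
have kB z : nm (z - x0) < s / 4 -> K z 0 1 = lB z * b z.
  by move=> zs; rewrite /b DBE kB0 ?subr0//; lra.
have db z : nm (z - x0) < s / 2 -> differentiable b z.
  by apply: (DB_ball s0) => u us; exact: dK.
have dlK z : nm (z - x0) < s -> differentiable (fun z => lA (K z)) z.
  move=> zs; apply: differentiableM; last exact: differentiable_cst.
  by apply: differentiableB; exact: dK.
have s8 : s / 8 = s / 4 / 2 by field.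
have kA : lA (K y) - b y * lA y = 0.
  apply: (@cancel_ball R M2 x0 lB (eB R) (s / 4) (fun z => lA (K z) - b z * lA z) (lB_e R)); last by rewrite -s8.
    move=> z zs; apply: differentiableB; first by apply: dlK; lra.
    by apply: differentiableM; [apply: db; lra|exact: differentiable_lA].
  move=> z zs; have zs' : nm (z - x0) < s by lra.
  have [_ h] := co z zs'; rewrite mulrBr h (kB z zs); ring.
have kC : K y 1 0 - b y * lC y = 0.
  apply: (@cancel_ball R M2 x0 lB (eB R) (s / 4) (fun z => K z 1 0 - b z * lC z) (lB_e R)); last by rewrite -s8.
    move=> z zs; apply: differentiableB; first by apply: dK; lra.
    by apply: differentiableM; [apply: db; lra|exact: differentiable_lC].
  move=> z zs; have zs' : nm (z - x0) < s by lra.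
  have [h _] := co z zs'; rewrite mulrBr h (kB z zs); ring.
have yB : K y 0 1 = lB y * b y by apply: kB; lra.
move/eqP: kA; rewrite subr_eq0 => /eqP; rewrite !lAE => kA.
move/eqP: kC; rewrite subr_eq0 => /eqP; rewrite !lCE => kC.
have ent m (c : C) i j : ((m%:M : M2) + c *: y) i j = (m%:M : M2) i j + c * y i j.
  by rewrite [LHS]mxE [X in _ + X]mxE.
have half (u v m w : C) : (u - v) / 2 = m * w -> u = (u + v) / 2 + m * w.
  by move=> <-; field.
apply: mx2_ext; rewrite ent !scalar2 ?add0r.
- by rewrite {1}(half _ _ _ _ kA) /tau; field.
- by rewrite yB lBE mulrC.
- exact: kC.
- have -> : K y 1 1 = (K y 0 0 + K y 1 1) / 2 - b y * ((y 0 0 - y 1 1) / 2) by rewrite -kA; field.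
  by rewrite /tau; field.
Qed.

End Commutant.

(** * The corrected sequence *)

Lemma conj_transport (K : comRingType) n (f f' g A y : 'M[K]_n) : f *m f' = 1%:M ->
  g *m y = (f' *m A *m f) *m g -> (f *m g) *m y = A *m (f *m g).
Proof. by move=> ff gE; rewrite -mulmxA gE !mulmxA ff mul1mx. Qed.

Lemma commute_transport (K : comRingType) n (f f' q y : 'M[K]_n) : f' *m f = 1%:M ->
  q *m y = (f *m y *m f') *m q -> (f' *m q) *m y = y *m (f' *m q).
Proof. by move=> ff qE; rewrite -mulmxA qE !mulmxA ff mul1mx. Qed.

Section LocalGauge.
Variable R : realType.
Local Notation C := (R[i]).
Local Notation M2 := 'M[C]_2.
Variables (p : nat -> M2 -> M2) (ep : nat -> C).

(** [frame] is P_n, [relative] is r_n, [reduced] is C_n, and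
[corrected] is Q_n in the notation of the introduction. *)
Definition conjugate n y : M2 := p n y *m y *m adj2 (p n y).
Definition frame n y : M2 := ep n *: p n (ptau y).
Definition relative n y : M2 := adj2 (p n (ptau y)) *m p n y.
Definition reduced n y : M2 := adj2 (frame n y) *m conjugate n y *m frame n y.
Definition corrected n y : M2 := frame n y *m gauge (reduced n) y.
Definition commuting n y : M2 := adj2 (p n y) *m corrected n y.
Definition coef_b n : M2 -> C := DB (fun z => commuting n z 0 1).
Definition coef_a n y : C := tau (commuting n y) - coef_b n y * tau y.

Hypothesis ep1 : forall n, ep n * ep n = 1.
Variables (a : C) (d : R).
Local Notation x0 := (a%:M : M2).
Local Notation hc := (@hcauchy R M2 x0).
Hypothesis d0 : 0 < d.
Hypothesis det_p : forall n y, nm (y - x0) < d -> \det (p n y) = 1.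
Hypothesis p_diff : forall n y, nm (y - x0) < d -> differentiable (p n) y.
Hypothesis hc_conjugate : forall i j, hc (fun n y => conjugate n y i j).
Hypothesis hc_ep : forall i j, hc (fun n y => ep n * p n (ptau y) i j).

Let ptau_d y : nm (y - x0) < d -> nm (ptau y - x0) < d.
Proof. by move=> yd; apply: le_lt_trans yd; exact: ptau_near. Qed.

Let hc_frame i j : hc (fun n y => frame n y i j).
Proof. by apply: (hcauchy_eq ltr01 _ (hc_ep i j)) => n y _; rewrite /frame [RHS]mxE. Qed.

Let det_frame n y : nm (y - x0) < d -> \det (frame n y) = 1.
Proof. by move=> yd; rewrite /frame detZ expr2 ep1 mul1r det_p// ptau_d. Qed.

Let hc_reduced i j : hc (fun n y => reduced n y i j).
Proof. exact: (hcauchy_mulmx (hcauchy_mulmx (hcauchy_adj2 hc_frame) hc_conjugate) hc_frame). Qed.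

Let reducedE n y : reduced n y = relative n y *m y *m adj2 (relative n y).
Proof.
rewrite /reduced /frame /conjugate /relative adj2Z adj2M adj2K -!scalemxAl -scalemxAr scalerA ep1 scale1r.
by rewrite !mulmxA.
Qed.

Let x0d : nm (x0 - x0) < d. Proof. by rewrite subrr nm0. Qed.

Let relative_diff n i j : differentiable (fun y => relative n y i j : C) x0.
Proof.
have dP k l : differentiable (fun y => p n (ptau y) k l : C) x0.
  have pd := p_diff n (ptau_d x0d).
  exact: (differentiable_comp (differentiable_ptau x0) (differentiable_entry k l pd)).
apply: (differentiable_mulmx (differentiable_adj2 dP)) => k l.
exact: differentiable_entry (p_diff n x0d).
Qed.

Let det_relative n y : nm (y - x0) < d -> \det (relative n y) = 1.
Proof. by move=> yd; rewrite /relative det_mulmx det_adj2 !det_p ?mulr1// ptau_d. Qed.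

Let relative_ptau n y : nm (y - x0) < d -> relative n (ptau y) = 1%:M.
Proof. by move=> yd; rewrite /relative -[ptau (ptau y)]/(ptau (tau y)%:M) ptau_scalar -/(ptau y) adj2_mul// det_p// ptau_d. Qed.

Lemma hc_corrected i j : hc (fun n y => corrected n y i j).
Proof.
apply: (hcauchy_mulmx hc_frame) => k l.
exact: (hc_gauge d0 det_relative relative_ptau relative_diff (fun n y _ => reducedE n y) hc_reduced).
Qed.

Theorem local_gauge : exists2 s : R, 0 < s & s <= d /\ forall n y, nm (y - x0) < s ->
  [/\ differentiable (coef_a n) y, differentiable (coef_b n) y,
      \det ((coef_a n y)%:M + coef_b n y *: y) = 1 &
      p n y *m ((coef_a n y)%:M + coef_b n y *: y) = corrected n y].
Proof.
have [r r0 H] := gauge_intertwines d0 det_relative relative_ptau relative_diff (fun n y _ => reducedE n y) hc_reduced.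
have rd : 0 < Num.min r d by rewrite lt_min r0.
have [s s0 [srd dQ]] := hcauchy_mx_shrink hc_corrected rd.
have [sr sd] : s <= r /\ s <= d by move: srd; rewrite le_min => /andP[].
have yd y : nm (y - x0) < s -> nm (y - x0) < d by move=> ys; exact: lt_le_trans sd.
have detQ n y : nm (y - x0) < s -> \det (corrected n y) = 1.
  move=> ys; have [dg _] := H n y (lt_le_trans ys sr).
  by rewrite /corrected det_mulmx dg mulr1 det_frame// yd.
have QE n y : nm (y - x0) < s -> corrected n y *m y = conjugate n y *m corrected n y.
  move=> ys; have [_ gE] := H n y (lt_le_trans ys sr).
  exact: conj_transport (mul_adj2 (det_frame n (yd _ ys))) gE.
have dK n y : nm (y - x0) < s -> forall i j, differentiable (fun z => commuting n z i j : C) y.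
  move=> ys; apply: differentiable_mulmx; last exact: dQ.
  apply: differentiable_adj2 => i j; apply: differentiable_entry; apply: p_diff; exact: yd.
have cK n y : nm (y - x0) < s -> commuting n y *m y = y *m commuting n y.
  by move=> ys; exact: commute_transport (adj2_mul (det_p n (yd _ ys))) (QE n y ys).
exists (s / 8); first by rewrite divr_gt0.
split=> [|n y ys]; first by apply: le_trans sd; lra.
have ys1 : nm (y - x0) < s by apply: lt_le_trans ys _; lra.
have ys2 : nm (y - x0) < s / 2 by apply: lt_le_trans ys _; lra.
have E := commutant s0 (dK n) (cK n) ys.
have db : differentiable (coef_b n) y.
  by apply: (DB_ball s0 _ ys2) => z zs; exact: dK.
have dt (A : M2 -> M2) : (forall i j, differentiable (fun z => A z i j : C) y) ->
    differentiable (fun z => tau (A z)) y.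
  move=> dA; apply: differentiableM; last exact: differentiable_cst.
  by apply: differentiableD; exact: dA.
rewrite -[X in \det X]E -[X in p n y *m X]E; split.
- apply: differentiableB; first exact: (dt _ (dK n y ys1)).
  apply: differentiableM; first exact: db.
  by apply: (dt id) => i j; exact: differentiable_coord.
- exact: db.
- by rewrite /commuting det_mulmx det_adj2 detQ// mulr1 det_p// yd.
- by rewrite /commuting mulmxA mul_adj2 ?mul1mx//; apply: det_p; exact: yd.
Qed.

End LocalGauge.

Lemma entry_close (R : realType) (w u v : 'M[R[i]]_2) (e : R) i j :
  nm (w - u) < e / 2 -> nm (w - v) < e / 2 -> nm (u i j - v i j) <= e.
Proof.
rewrite (nmBC w u) -mxB_entry => hu hv; apply: le_trans (nm_entry _ i j) _.
by have := nm_tri w u v; move: hu hv; move: (nm _) (nm _) (nm _) => *; lra.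
Qed.

Section Bridge.
Variable R : realType.
Local Notation C := (R[i]).
Local Notation M2 := 'M[C]_2.
Variables (W : set M2) (p : nat -> M2 -> M2) (psi : M2 -> M2).
Hypothesis W_open : open W.
Hypothesis T_sub_W : noncyclic_ball R `<=` W.
Hypothesis p_holo : forall n, holomorphic_on W (p n).
Hypothesis p_det : forall n x, W x -> \det (p n x) = 1.
Hypothesis phi_cvg : cvg_locally_uniformly W
   (fun n x => p n x *m x *m invmx (p n x)) psi.

Lemma scalar_W (a : C) : nm a < 1 -> W a%:M.
Proof. by move=> a1; apply: T_sub_W; apply/noncyclic_ballP; exists a. Qed.

Lemma conjugate_near (a : C) : nm a < 1 -> exists2 d : R, 0 < d &
    (forall y, nm (y - a%:M) < d -> W y) /\
    forall i j, hcauchy (a%:M : M2) (fun n y => conjugate p n y i j).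
Proof.
move=> /scalar_W Wa; have [N /nbhs_nm[r r0 rN] /uniform_nm uN] := phi_cvg Wa.
have : nbhs (a%:M : M2) W by exact: open_nbhs_nbhs.
move=> /nbhs_nm[s s0 sW].
have d0 : 0 < Num.min r s by rewrite lt_min r0.
have inW y : nm (y - a%:M) < Num.min r s -> W y.
  by rewrite lt_min => /andP[_ ys]; apply: sW; rewrite nmBC.
exists (Num.min r s); first exact: d0.
split=> [|i j]; first exact: inW.
exists (Num.min r s); first exact: d0.
split=> [n y /inW Wy|e e0].
  have dp k l : differentiable (fun z => p n z k l : C) y.
    by apply: differentiable_entry; exact: p_holo.
  have dx k l : differentiable (fun z : M2 => z k l : C) y by exact: differentiable_coord.
  exact: (differentiable_mulmx (differentiable_mulmx dp dx) (differentiable_adj2 dp)).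
have e2 : 0 < e / 2 by rewrite divr_gt0.
have [M HM] := uN _ e2; exists M => m n y Mm Mn ys.
have Wy := inW y ys.
have Ny : (N `&` W) y.
  by split=> //; apply: rN; rewrite nmBC; move: ys; rewrite lt_min => /andP[].
have cE k : p k y *m y *m invmx (p k y) = conjugate p k y.
  by rewrite (adj2_inv (p_det k Wy)).
have hm := HM m y Mm Ny; have hn := HM n y Mn Ny; rewrite !cE in hm hn.
exact: entry_close hm hn.
Qed.

Lemma scalar_signs : exists ep : nat -> C, (forall n, ep n * ep n = 1) /\
  forall b, nm b < 1 -> forall k l,
    hcauchy (b%:M : M2) (fun n y => ep n * p n (ptau y) k l).
Proof.
apply: (@global_sign R (fun n y => p n (ptau y))) => [b b1|n b b1]; last first.
  by rewrite ptau_scalar p_det//; exact: scalar_W.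
have [d d0 [dW hphi]] := conjugate_near b1.
have dp n y : nm (y - b%:M) < d -> differentiable (p n) y by move=> /dW; exact: p_holo.
have detp n y : nm (y - b%:M) < d -> \det (p n y) = 1 by move=> /dW; exact: p_det.
apply: (@local_sign _ b (fun n y => p n (ptau y)) d d0).
- exact: det_at_ptau detp.
- exact: P_diff dp.
- exact: (hc_products d0 detp dp (fun n y _ => erefl) hphi).
Qed.

Variable ep : nat -> C.
Hypothesis ep1 : forall n, ep n * ep n = 1.
Hypothesis hep : forall b, nm b < 1 -> forall k l,
    hcauchy (b%:M : M2) (fun n y => ep n * p n (ptau y) k l).

(** Everything that the theorem requires, on one ball around a scalar matrix; U is
the union of these balls. *)
Definition good_ball (b : C) (s : R) := [/\ 0 < s,
  forall y, nm (y - b%:M) < s -> W y,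
  forall n y, nm (y - b%:M) < s ->
    [/\ differentiable (coef_a p ep n) y, differentiable (coef_b p ep n) y,
        \det ((coef_a p ep n y)%:M + coef_b p ep n y *: y) = 1 &
        p n y *m ((coef_a p ep n y)%:M + coef_b p ep n y *: y) = corrected p ep n y],
  forall y, nm (y - b%:M) < s -> \det (mxlim (corrected p ep) y) = 1 /\
    differentiable (mxlim (corrected p ep)) y &
  forall e : R, 0 < e -> exists N, forall n y, (N <= n)%N -> nm (y - b%:M) < s ->
     nm (mxlim (corrected p ep) y - corrected p ep n y) < e].

Lemma good_ball_exists (b : C) : nm b < 1 -> exists s, good_ball b s.
Proof.
move=> b1; have [d d0 [dW hphi]] := conjugate_near b1.
have dp n y : nm (y - b%:M) < d -> differentiable (p n) y by move=> /dW; exact: p_holo.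
have detp n y : nm (y - b%:M) < d -> \det (p n y) = 1 by move=> /dW; exact: p_det.
have [s s0 [sd H]] := local_gauge ep1 d0 detp dp hphi (hep b1).
have hQ := hc_corrected ep1 d0 detp dp hphi (hep b1).
have [r r0 [dr ur]] := hcauchy_mxlim hQ.
have [r1 r10 h1] := hcauchy_mx_near hQ.
pose t := Num.min s (Num.min r r1).
have t0 : 0 < t by rewrite !lt_min s0 r0.
have ts (y : M2) : nm (y - b%:M) < t -> nm (y - b%:M) < s by rewrite lt_min => /andP[].
have tr (y : M2) : nm (y - b%:M) < t -> nm (y - b%:M) < r by rewrite !lt_min => /andP[_ /andP[]].
have tr1 (y : M2) : nm (y - b%:M) < t -> nm (y - b%:M) < r1.
  by rewrite !lt_min => /andP[_ /andP[]].
have ty y : nm (y - b%:M) < t -> W y by move=> /ts ys; apply: dW; exact: lt_le_trans sd.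
exists t; split; [exact: t0|exact: ty| | |].
- by move=> n y /ts; exact: H.
- move=> y yt; split; last exact: dr (tr y yt).
  apply: det_mxlim; first exact: h1 (tr1 y yt).
  move=> n; have [_ _ d1 <-] := H n y (ts y yt).
  by rewrite det_mulmx d1 mulr1; apply: p_det; exact: ty.
- move=> e /ur[N HN]; exists N => n y Nn /tr; exact: HN.
Qed.

End Bridge.

Theorem lemma5 (R : realType) (W : set 'M[R[i]]_2)
    (p : nat -> 'M[R[i]]_2 -> 'M[R[i]]_2) (psi : 'M[R[i]]_2 -> 'M[R[i]]_2)
    (W_open : open W)
    (T_sub_W : noncyclic_ball R `<=` W)
    (W_sub_Omega : W `<=` spectral_ball R 2)
    (p_unit : forall n x, W x -> p n x \in unitmx)
    (p_holo : forall n, holomorphic_on W (p n))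
    (p_det : forall n x, W x -> \det (p n x) = 1)
    (psi_Omega : forall x, W x -> spectral_ball R 2 (psi x))
    (psi_holo : holomorphic_on W psi)
    (phi_cvg : cvg_locally_uniformly W
       (fun n x => p n x *m x *m invmx (p n x)) psi) :
  exists (U : set 'M[R[i]]_2) (a b : nat -> 'M[R[i]]_2 -> R[i])
         (u : 'M[R[i]]_2 -> 'M[R[i]]_2),
    [/\ open U, noncyclic_ball R `<=` U & U `<=` W] /\
    [/\ forall n, holomorphic_on U (a n),
        forall n, holomorphic_on U (b n) &
        forall n x, U x -> \det ((a n x)%:M + b n x *: x) = 1] /\
    [/\ forall x, U x -> u x \in unitmx,
        holomorphic_on U u &
        cvg_locally_uniformly U
          (fun n x => p n x *m ((a n x)%:M + b n x *: x)) u].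
Proof.
have [ep [ep1 hep]] := scalar_signs W_open T_sub_W p_holo p_det phi_cvg.
have good := good_ball_exists W_open T_sub_W p_holo p_det phi_cvg ep1 hep.
pose U := \bigcup_(bs in [set bs : R[i] * R | nm bs.1 < 1 /\ good_ball W p ep bs.1 bs.2])
  ball (bs.1%:M : 'M[R[i]]_2) (bs.2%:C)%C.
have UP x : U x -> exists b s, good_ball W p ep b s /\ nm (x - b%:M) < s.
  by move=> [[b s] /= [_ g]]; rewrite ballnm /= nmBC; exists b, s.
exists U, (coef_a p ep), (coef_b p ep), (mxlim (corrected p ep)); split; [split|split].
- apply: bigcup_open => -[b s] /= [_ [s0 _ _ _ _]].
  by apply: ball_open; rewrite ltcR.
- move=> x /noncyclic_ballP[b b1 ->]; have [s g] := good b b1.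
  by exists (b, s) => //=; rewrite ballnm /= subrr nm0; case: g.
- by move=> x /UP[b [s [[_ h _ _ _] xs]]]; exact: h.
- split=> n x /UP[b [s [[_ _ h _ _] xs]]].
  + by have [] := h n x xs.
  + by have [] := h n x xs.
  + by have [] := h n x xs.
- split=> [x /UP[b [s [[_ _ _ h _] xs]]]|x /UP[b [s [[_ _ _ h _] xs]]]|x].
  + by rewrite unitmxE (proj1 (h x xs)) unitr1.
  + exact: (proj2 (h x xs)).
  + move=> /UP[b [s [[s0 _ hE _ hu] xs]]]; exists [set y | nm (y - b%:M) < s].
      apply/nbhs_nm; exists (s - nm (x - b%:M)); first by rewrite subr_gt0.
      move=> y; rewrite nmBC ltrBrDr => yx /=.
      by apply: le_lt_trans yx; exact: nm_tri.
    apply/uniform_nm => e /hu[N HN]; exists N => n y Nn [/= ys _].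
    by have [_ _ _ ->] := hE n y ys; exact: HN.
Qed.
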